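(* Let $(M,\omega,J)$ be a Kähler manifold of real dimension $2m$, equipped with an effective Hamiltonian action $\rho: T^n\to \mathrm{Diff}(M,\omega,J)$ of an $n$-dimensional torus by isometries, with moment map $\mu: M\to\mathfrak t^*$. Then the singular complex distribution $\mathcal P_{\mathrm{mix}}=(\mathcal P_J\cap\mathcal D_{\mathbb C})\oplus\mathcal I_{\mathbb C}$ is a singular polarization on $M$, and $\mathrm{rk}_{\mathbb R}(\mathcal P_{\mathrm{mix}}|_{\check M})=n$.
   Context: Conventions: $\mathfrak t$ is the Lie algebra of $T^n$; for $\xi\in\mathfrak t$, $\xi^\#$ is the fundamental vector field on $M$; the moment map is $T^n$-invariant and satisfies $\omega(-,\xi^\#)=d\mu^\xi$, where $\mu^\xi=\langle\mu,\xi\rangle$. For $p\in M$, $H_p\subset T^n$ is the stabilizer of $p$, and $\check M=\{p\in M: \dim H_p=0\}$ is the open set of points with $n$-dimensional orbit. $\mathcal P_J=T^{0,1}_J\subset TM\otimes\mathbb C$ is the Kähler polarization of $J$. $\mathcal D_{\mathbb C}=\mathcal D_{\mathbb R}\otimes\mathbb C$ with $(\mathcal D_{\mathbb R})_p=\ker (d\mu)_p\subset T_pM$. $\mathcal I_{\mathbb C}=\mathcal I_{\mathbb R}\otimes\mathbb C$ with $(\mathcal I_{\mathbb R})_p=\{\xi^\#_p:\xi\in\mathfrak t\}\subset T_pM$ (tangent space to the orbit through $p$). Intersections and sums of distributions are taken pointwise. A singular complex distribution $\mathcal P\subset TM\otimes\mathbb C$ is an assignment to each $p\in M$ of a complex vector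 subspace $\mathcal P_p\subset T_pM\otimes\mathbb C$; it is smooth on $\check M$ if $\mathcal P|_{\check M}$ is a smooth subbundle of $T\check M\otimes\mathbb C$. For $U\subset M$ open, $\Gamma(U,\mathcal P)=\{v\in\Gamma(U,TM\otimes\mathbb C): v_p\in\mathcal P_p\ \forall p\in U\}$ (smooth sections). $\mathcal P$ is involutive if $[u,v]\in\Gamma(M,\mathcal P)$ for all $u,v\in\Gamma(M,\mathcal P)$. A singular polarization on $M$ is a singular complex distribution $\mathcal P$, smooth on $\check M$, such that (a) $\mathcal P$ is involutive; (b) for every $p\in\check M$, $\mathcal P_p\subset T_pM\otimes\mathbb C$ is Lagrangian (for the complex-bilinear extension of $\omega$); (c) the real rank $\mathrm{rk}_{\mathbb R}(\mathcal P|_{\check M}):=\dim_{\mathbb R}(\mathcal P\cap\overline{\mathcal P}\cap TM)_p$, $p\in\check M$, is constant on $\check M$. *)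

(* Defs.v *)
From HB Require Import structures.
From mathcomp Require Import all_boot all_order all_algebra.
From mathcomp Require Import all_classical all_reals all_analysis.
From mathcomp Require Import complex.

Set Implicit Arguments.
Unset Strict Implicit.
Unset Printing Implicit Defensive.
Import Order.TTheory GRing.Theory Num.Theory numFieldNormedType.Exports.
Local Open Scope classical_set_scope.
Local Open Scope ring_scope.

(* Vectors are row vectors; a linear map A : 'M_(a, b) acts by v |-> v *m A and
   a bilinear form B : 'M_d is (u, v) |-> u *m B *m v^T. In particular the
   library's Jacobian 'J F x is the differential of F at x acting on rows. *)

Definition subspace (K : fieldType) (d : nat) (W : set 'rV[K]_d) : Prop :=
  W 0 /\ forall (a : K) (u v : 'rV[K]_d), W u -> W v -> W (a *: u + v).

Definition has_dim (K : fieldType) (d : nat) (W : set 'rV[K]_d) (k : nat) : Prop :=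
  exists B : 'M[K]_(k, d), row_free B /\ W = [set v | (v <= B)%MS].

Definition set_sum (K : fieldType) (d : nat) (V W : set 'rV[K]_d) : set 'rV[K]_d :=
  [set v + w | v in V & w in W].

Definition toC (R : realType) (a b : nat) (A : 'M[R]_(a, b)) : 'M[R[i]]_(a, b) :=
  map_mx (real_complex R) A.

Definition ReM (R : realType) (a b : nat) (A : 'M[R[i]]_(a, b)) : 'M[R]_(a, b) :=
  map_mx (@complex.Re R) A.

Definition ImM (R : realType) (a b : nat) (A : 'M[R[i]]_(a, b)) : 'M[R]_(a, b) :=
  map_mx (@complex.Im R) A.

Definition complexify (R : realType) (d : nat) (W : set 'rV[R]_d) : set 'rV[R[i]]_d :=
  [set toC u + 'i%C *: toC w | u in W & w in W].

Definition conj_set (R : realType) (d : nat) (W : set 'rV[R[i]]_d) : set 'rV[R[i]]_d :=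
  [set map_mx (@conjc R) v | v in W].

(* For V finite-dimensional and U open this is the usual class C^k(U, W), except
   that differentiability is asked along with the existence and regularity of
   the directional derivatives, so that smooth_on is the usual C^oo. *)
Fixpoint Ck (R : realType) (V W : normedModType R) (k : nat) (U : set V)
    (f : V -> W) : Prop :=
  match k with
  | 0 => forall x, U x -> {for x, continuous f}
  | k'.+1 => (forall x, U x -> differentiable f x) /\
             forall v, Ck k' U (fun x => 'D_v f x)
  end.

Definition smooth_on (R : realType) (V W : normedModType R) (U : set V)
  (f : V -> W) : Prop := forall k, Ck k U f.

(* cmap and cinv are total functions; they are only meaningful on cdom and on
   cmap @` cdom respectively. *)
Record chart (R : realType) (d : nat) (M : topologicalType) := Chart {
  cdom : set M;
  cmap :> M -> 'rV[R]_d;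
  cinv : 'rV[R]_d -> M;
  cdom_open : open cdom;
  cimage_open : open (cmap @` cdom);
  cmapK : forall p, cdom p -> cinv (cmap p) = p;
  cmap_continuous : forall p, cdom p -> {for p, continuous cmap};
  cinv_continuous : forall p, cdom p -> {for cmap p, continuous cinv}
}.

Definition smooth_transition (R : realType) (d : nat) (M : topologicalType)
    (c c' : chart R d M) : Prop :=
  smooth_on (c @` (cdom c `&` cdom c')) (c' \o cinv c).

Definition compatible (R : realType) (d : nat) (M : topologicalType)
    (c c' : chart R d M) : Prop :=
  smooth_transition c c' /\ smooth_transition c' c.

(* The smooth structure is given by an atlas indexed by the points: chart_at p
   is a preferred chart around p. *)
Record manifold (R : realType) (d : nat) := Manifold {
  points :> topologicalType;
  manifold_hausdorff : hausdorff_space points;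
  manifold_second_countable : @second_countable points;
  chart_at : points -> chart R d points;
  mem_chart_at : forall p, cdom (chart_at p) p;
  chart_at_compatible : forall p q, compatible (chart_at p) (chart_at q)
}.
Arguments chart_at {R d m} p.

(* T_pM is identified with 'rV[R]_d by means of chart_at p (v stands for the
   vector \sum_i v_i d/dx_i at p, where x = chart_at p), and T_pM (x) C with
   'rV[R[i]]_d. Change of coordinates is always explicit. *)
Section Calculus.
Variables (R : realType) (d : nat) (M : manifold R d).

Definition smooth_chart (c : chart R d M) : Prop :=
  forall p : M, compatible c (chart_at p).

Definition smooth_map (W : normedModType R) (U : set M) (F : M -> W) : Prop :=
  forall p : M,
    smooth_on (chart_at p @` (U `&` cdom (chart_at p))) (F \o cinv (chart_at p)).

Definition diff_at (k : nat) (F : M -> 'rV[R]_k) (p : M) : 'M[R]_(d, k) :=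
  'J (F \o cinv (chart_at p)) (chart_at p p).

(* row j is the coordinate vector d/dx_j of the chart c at q *)
Definition coord_frame (c : chart R d M) (q : M) : 'M[R]_d :=
  'J (chart_at q \o cinv c) (c q).

Definition tangent_map (f : M -> M) (p : M) : 'M[R]_d :=
  diff_at (chart_at (f p) \o f) p.

Definition smooth_mapC (k : nat) (U : set M) (F : M -> 'rV[R[i]]_k) : Prop :=
  smooth_map U (fun q => ReM (F q)) /\ smooth_map U (fun q => ImM (F q)).

Definition diffC_at (k : nat) (F : M -> 'rV[R[i]]_k) (p : M) : 'M[R[i]]_(d, k) :=
  toC (diff_at (fun q => ReM (F q)) p) + 'i%C *: toC (diff_at (fun q => ImM (F q)) p).

Definition coordC (c : chart R d M) (X : M -> 'rV[R[i]]_d) (q : M) : 'rV[R[i]]_d :=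
  X q *m toC (diff_at c q).

Definition smooth_field (U : set M) (X : M -> 'rV[R[i]]_d) : Prop :=
  forall p : M, smooth_mapC (U `&` cdom (chart_at p)) (coordC (chart_at p) X).

(* [X, Y]^i = X (Y^i) - Y (X^i) in the coordinates chart_at p *)
Definition lie_bracket (X Y : M -> 'rV[R[i]]_d) (p : M) : 'rV[R[i]]_d :=
  X p *m diffC_at (coordC (chart_at p) Y) p - Y p *m diffC_at (coordC (chart_at p) X) p.

Definition form_in_chart (c : chart R d M) (omega : M -> 'M[R]_d) (x : 'rV[R]_d) : 'M[R]_d :=
  let G := coord_frame c (cinv c x) in G *m omega (cinv c x) *m G^T.

Definition endo_in_chart (c : chart R d M) (J : M -> 'M[R]_d) (x : 'rV[R]_d) : 'M[R]_d :=
  coord_frame c (cinv c x) *m J (cinv c x) *m diff_at c (cinv c x).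

Definition closed_form (omega : M -> 'M[R]_d) : Prop :=
  forall (p : M) (x : 'rV[R]_d) (i j k : 'I_d),
    (chart_at p @` cdom (chart_at p)) x ->
    let partial l := 'D_(delta_mx 0 l) (form_in_chart (chart_at p) omega) x in
    partial i j k + partial j k i + partial k i j = 0.

Record symplectic (omega : M -> 'M[R]_d) : Prop := {
  symplectic_smooth : forall p : M,
    smooth_on (chart_at p @` cdom (chart_at p)) (form_in_chart (chart_at p) omega);
  symplectic_skew : forall p, (omega p)^T = - omega p;
  symplectic_nondegenerate : forall p, omega p \in unitmx;
  symplectic_closed : closed_form omega
}.

End Calculus.

(* On 'rV_(m + m), with coordinates (x, y): d/dx_j |-> d/dy_j |-> - d/dx_j *)
Definition J_std (R : realType) (m : nat) : 'M[R]_(m + m) :=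
  block_mx 0 1%:M (- 1%:M) 0.

Section Kahler.
Variables (R : realType) (m : nat) (M : manifold R (m + m)).

Definition holomorphic_chart (J : M -> 'M[R]_(m + m)) (c : chart R (m + m) M) : Prop :=
  smooth_chart c /\
  forall q, cdom c q -> J q *m diff_at c q = diff_at c q *m J_std R m.

Record complex_structure (J : M -> 'M[R]_(m + m)) : Prop := {
  complex_smooth : forall p : M,
    smooth_on (chart_at p @` cdom (chart_at p)) (endo_in_chart (chart_at p) J);
  complex_square : forall p, J p *m J p = - 1%:M;
  complex_integrable : forall p : M, exists c, holomorphic_chart J c /\ cdom c p
}.

(* g (u, v) = omega (u, J v) *)
Definition metric (omega J : M -> 'M[R]_(m + m)) (p : M) : 'M[R]_(m + m) :=
  omega p *m (J p)^T.

Record kahler (omega J : M -> 'M[R]_(m + m)) : Prop := {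
  kahler_symplectic : symplectic omega;
  kahler_complex : complex_structure J;
  kahler_metric_symmetric : forall p, (metric omega J p)^T = metric omega J p;
  kahler_metric_positive : forall p (v : 'rV[R]_(m + m)),
    v != 0 -> 0 < (v *m metric omega J p *m v^T) 0 0
}.

End Kahler.

(* T^n = R^n / Z^n, with Lie algebra t = R^n and exponential the quotient map:
   an action of T^n is an action rho of R^n for which Z^n acts trivially. *)
Section Torus.
Variables (R : realType) (d n : nat) (M : manifold R d).

Record torus_action (rho : 'rV[R]_n -> M -> M) : Prop := {
  torus_act0 : forall p, rho 0 p = p;
  torus_actD : forall x y p, rho (x + y) p = rho x (rho y p);
  torus_act_int : forall (z : 'rV[int]_n) p, rho (map_mx intr z) p = p;
  torus_act_continuous : continuous (fun u : 'rV[R]_n * M => rho u.1 u.2);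
  torus_act_smooth : forall p q : M,
    smooth_on
      [set u : 'rV[R]_(n + d) |
        (chart_at p @` cdom (chart_at p)) (rsubmx u) /\
        cdom (chart_at q) (rho (lsubmx u) (cinv (chart_at p) (rsubmx u)))]
      (fun u => chart_at q (rho (lsubmx u) (cinv (chart_at p) (rsubmx u))))
}.

Definition effective (rho : 'rV[R]_n -> M -> M) : Prop :=
  forall x, (forall p, rho x p = p) -> exists z : 'rV[int]_n, x = map_mx intr z.

Definition preserves_form (f : M -> M) (B : M -> 'M[R]_d) : Prop :=
  forall p, tangent_map f p *m B (f p) *m (tangent_map f p)^T = B p.

Definition preserves_endo (f : M -> M) (J : M -> 'M[R]_d) : Prop :=
  forall p, J p *m tangent_map f p = tangent_map f p *m J (f p).

(* xi^# *)
Definition fundamental (rho : 'rV[R]_n -> M -> M) (xi : 'rV[R]_n) (p : M) : 'rV[R]_d :=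
  derive1 (fun t : R => chart_at p (rho (t *: xi) p)) 0.

(* Elements of t^* are row vectors too, with <a, xi> = a *m xi^T. *)
Definition mu_comp (mu : M -> 'rV[R]_n) (xi : 'rV[R]_n) (p : M) : 'rV[R]_1 :=
  mu p *m xi^T.

Record moment_map (omega : M -> 'M[R]_d) (rho : 'rV[R]_n -> M -> M)
    (mu : M -> 'rV[R]_n) : Prop := {
  moment_smooth : smooth_map setT mu;
  moment_invariant : forall x p, mu (rho x p) = mu p;
  moment_hamiltonian : forall xi p (v : 'rV[R]_d),
    v *m omega p *m (fundamental rho xi p)^T = v *m diff_at (mu_comp mu xi) p
}.

(* The Lie algebra of the stabilizer H_p of p; its dimension is dim H_p. *)
Definition stabilizer_lie (rho : 'rV[R]_n -> M -> M) (p : M) : set 'rV[R]_n :=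
  [set xi | forall t : R, rho (t *: xi) p = p].

Definition regular_points (rho : 'rV[R]_n -> M -> M) : set M :=
  [set p | has_dim (stabilizer_lie rho p) 0].

Definition DR (mu : M -> 'rV[R]_n) (p : M) : set 'rV[R]_d :=
  [set v | v *m diff_at mu p = 0].

Definition IR (rho : 'rV[R]_n -> M -> M) (p : M) : set 'rV[R]_d :=
  [set fundamental rho xi p | xi in setT].

(* T^{0,1}, the (- i)-eigenspace of J *)
Definition PJ (J : M -> 'M[R]_d) (p : M) : set 'rV[R[i]]_d :=
  [set v | v *m toC (J p) = - 'i%C *: v].

End Torus.

Section Polarization.
Variables (R : realType) (d : nat) (M : manifold R d).
Implicit Types (P : M -> set 'rV[R[i]]_d) (reg : set M).

Definition singular_distribution P : Prop := forall p, subspace (P p).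

Definition smooth_subbundle_on reg P : Prop :=
  forall p, reg p -> exists (U : set M) (k : nat) (E : 'I_k -> M -> 'rV[R[i]]_d),
    [/\ open U, U p, U `<=` reg, forall i, smooth_field U (E i) &
        forall q, U q -> row_free (\matrix_(i < k) E i q) /\
                         P q = [set v | (v <= \matrix_(i < k) E i q)%MS]].

Definition sections (U : set M) P (X : M -> 'rV[R[i]]_d) : Prop :=
  smooth_field U X /\ forall p, U p -> P p (X p).

Definition involutive P : Prop :=
  forall X Y, sections setT P X -> sections setT P Y ->
    sections setT P (lie_bracket X Y).

(* W equals its orthogonal for the complex-bilinear extension of omega *)
Definition lagrangian (omega : 'M[R]_d) (W : set 'rV[R[i]]_d) : Prop :=
  W = [set v | forall w, W w -> v *m toC omega *m w^T = 0].

Definition real_part (W : set 'rV[R[i]]_d) : set 'rV[R]_d :=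
  [set v | (W `&` conj_set W) (toC v)].

Definition real_rank_on reg P (k : nat) : Prop :=
  forall p, reg p -> has_dim (real_part (P p)) k.

Record singular_polarization (omega : M -> 'M[R]_d) reg P : Prop := {
  polarization_distribution : singular_distribution P;
  polarization_smooth : smooth_subbundle_on reg P;
  polarization_involutive : involutive P;
  polarization_lagrangian : forall p, reg p -> lagrangian (omega p) (P p);
  polarization_real_rank : exists k, real_rank_on reg P k
}.

End Polarization.

Definition Pmix (R : realType) (d n : nat) (M : manifold R d) (J : M -> 'M[R]_d)
    (rho : 'rV[R]_n -> M -> M) (mu : M -> 'rV[R]_n) (p : M) : set 'rV[R[i]]_d :=
  set_sum (PJ J p `&` complexify (DR mu p)) (complexify (IR rho p)).

(* Main.v *)
(* In a holomorphic chart J is constant, omega is a field w of skew matrices and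
   the fundamental fields are the rows of an n x d matrix N. Writing
   v = v1 + i v2, the vector v lies in P_mix iff v1, v2 lie in ker (d mu) and
   v1 + v2 J (twice the (1,0)-part, seen as a real vector) lies in the span of
   N and N J.

   Involutivity, at an arbitrary (possibly singular) point x0. If X, Y are
   sections and x = X1 + X2 J, y = Y1 + Y2 J, then Z = [X, Y] satisfies
   Z1 + Z2 J = D_X1 y + (D_X2 y) J - D_Y1 x - (D_Y2 x) J.
   After subtraction of a combination of the holomorphic, pairwise commuting
   rows of N and N J one may assume y(x0) = 0, and one has to see that D_u y
   lies in the span of N(x0) and N(x0) J for u = X1, X2, which is tangent to the
   fixed locus of the stabiliser of x0. If th N(x0) = 0, the linearisation A of
   th N at x0 is skew for the metric. Differentiating twice the relations
   Yi w (th N)^T = 0 shows that D_u y is orthogonal to the images of all the A.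
   On the other hand (y(x0 + tq)) / t tends to D_q y and lies in a span of
   vectors which, for generic q, converge to independent vectors: the orbit
   directions N(x0), q A and their images by J. As q A = (u + q) A, the
   difference D_u y = D_(u+q) y - D_q y lies in that span, so by orthogonality
   its A-components vanish. The number of independent vectors does not drop
   because a combination of fundamental fields with zero 1-jet at x0 vanishes
   in a neighbourhood of x0 that does not depend on the combination; this is
   where the compactness of the torus enters.

   At a regular point N J (d mu) is invertible, which gives an explicit smooth
   projector onto P_mix; a Lagrangian subspace has rank m, so the projector has
   constant rank and P_mix has local frames. *)

Require Import Defs.
From HB Require Import structures.
From mathcomp Require Import all_boot all_order all_algebra.
From mathcomp Require Import all_classical all_reals all_analysis.
From mathcomp Require Import complex.
From mathcomp Require Import ring lra.
Set Implicit Arguments.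
Unset Strict Implicit.
Unset Printing Implicit Defensive.
Import Order.TTheory GRing.Theory Num.Theory numFieldNormedType.Exports.
Import Defs.
Local Open Scope classical_set_scope.
Local Open Scope ring_scope.

(** * Functions of class C^k on matrix spaces *)

(** The span of [N] and [N J] drops dimension at singular points, so a bracket that lies in it at
    nearby regular points need not lie in it at [x0]: continuity alone settles nothing there. The d
    mu condition causes no trouble, since a bracket of fields killing a function kills it. For the
    span, each of the two arguments is too weak alone. The limit puts the derivative in a space that
    exceeds the span at [x0] by the directions [q A] and their images by J; the orthogonality
    relations do not see the span at all. They combine because the excess space is J-stable and made
    of images of the [A]: the excess component z is orthogonal to z J, that is g(z, z) = 0. A
    generic [q] makes the excess as large as the stabiliser allows, so that every remaining
    combination of fundamental fields has zero 1-jet. For Killing fields the vanishing of such a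
    combination is usually read off the exponential map of the metric; here the flow is iterated,
    and a nonzero displacement would accumulate until it left a ball that the flow cannot leave. *)

Section CkBasics.
Variables (R : realType) (V W : normedModType R).
Implicit Types (U : set V) (f g : V -> W).

Lemma eq_open_near U f g x : open U -> (forall y, U y -> f y = g y) -> U x ->
  \near x, f x = g x.
Proof. by move=> oU fg Ux; apply: filterS (open_nbhs_nbhs (conj oU Ux)). Qed.

Lemma near_eq_derive_fun f g x v : (\near x, f x = g x) -> 'D_v f x = 'D_v g x.
Proof.
move=> fg; have [->|v0] := eqVneq v 0; first by rewrite !derive0.
exact: near_eq_derive.
Qed.

(** The first-order expansion of [f] is also one of [g], and uniqueness identifies the two
    differentials. *)
Lemma near_eq_differentiable f g x : (\near x, f x = g x) ->
  differentiable f x -> differentiable g x.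
Proof.
move=> fg df; have fgx : f x = g x by exact: nbhs_singleton fg.
have E : g \o shift x = cst (g x) + 'd f x +o_ (0 : V) id.
  apply/eqaddoP => e e0.
  have /eqaddoP/(_ _ e0) := diff_locally df; apply: filter_app.
  have : \forall y \near (0 : V), f (y + x) = g (y + x).
    by move: fg; rewrite (near_shift 0) /= ; apply: filterS => y; rewrite /= subr0.
  by apply: filterS => y E; rewrite /= -[(_ + _ : _ -> _) y]/(_ + _) /= !fctE /= E fgx.
have Dg : 'd g x = 'd f x :> (V -> W) by apply: diff_unique; first exact: diff_continuous.
by apply/diff_locallyP; rewrite Dg; split=> //; exact: diff_continuous.
Qed.

Lemma Ck_eq k U f g : open U -> (forall y, U y -> f y = g y) -> Ck k U f -> Ck k U g.
Proof.
move=> oU; elim: k f g => [|k IH] f g fg /=.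
  move=> cf x Ux; have E := eq_open_near oU fg Ux.
  apply: cvg_trans (near_eq_cvg E) _; rewrite -fg //; exact: cf.
move=> [df Df]; split=> [x Ux|v].
  exact: near_eq_differentiable (eq_open_near oU fg Ux) (df _ Ux).
apply: IH (Df v) => x Ux.
exact: near_eq_derive_fun (eq_open_near oU fg Ux).
Qed.

Lemma Ck_sub k U U' f : U' `<=` U -> Ck k U f -> Ck k U' f.
Proof.
move=> sub; elim: k f => [|k IH] f /=; first by move=> cf x /sub /cf.
by move=> [df Df]; split=> [x /sub /df //|v]; exact: IH.
Qed.

Lemma Ck_local k U f : (forall x, U x -> exists U', U' x /\ Ck k U' f) -> Ck k U f.
Proof.
elim: k f => [|k IH] f H /=; first by move=> x /H[U' [U'x /(_ _ U'x)]].
split=> [x /H[U' [U'x [/(_ _ U'x)]]] //|v].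
by apply: IH => x /H[U' [U'x [_ /(_ v) ?]]]; exists U'.
Qed.

Lemma Ck_differentiable k U f x : Ck k.+1 U f -> U x -> differentiable f x.
Proof. by case=> + _; apply. Qed.

Lemma CkS k U f : Ck k.+1 U f -> Ck k U f.
Proof.
elim: k f => [|k IH] f; first by move=> [df _] x Ux; exact/differentiable_continuous/df.
by move=> [df Df]; split=> // v; apply: IH.
Qed.

Lemma Ck_continuous k U f x : Ck k U f -> U x -> {for x, continuous f}.
Proof. by elim: k => [|k IH]; [move=> + Ux; apply|move=> /CkS]. Qed.

Lemma Ck_cst k U (a : W) : Ck k U (fun=> a).
Proof.
elim: k a => [|k IH] a /=; first by move=> x _; exact: cvg_cst.
split=> [x _|v]; first exact: differentiable_cst.
by rewrite (_ : derive _ ^~ v = fun=> 0) //; apply/funext => x; rewrite derive_cst.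
Qed.

Lemma CkD k U f g : open U -> Ck k U f -> Ck k U g -> Ck k U (fun x => f x + g x).
Proof.
move=> oU; elim: k f g => [|k IH] f g /=.
  by move=> cf cg x Ux; apply: cvgD; [exact: cf|exact: cg].
move=> [df Df] [dg Dg]; split=> [x Ux|v].
  by apply: differentiableD; [exact: df|exact: dg].
apply: (Ck_eq oU) (IH _ _ (Df v) (Dg v)) => x Ux.
by rewrite -deriveD //; apply/diff_derivable; [exact: df|exact: dg].
Qed.

Lemma CkZ k U (a : R) f : open U -> Ck k U f -> Ck k U (fun x => a *: f x).
Proof.
move=> oU; elim: k f => [|k IH] f /=.
  by move=> cf x Ux; apply: cvgZr; exact: cf.
move=> [df Df]; split=> [x Ux|v]; first by apply: differentiableZ; exact: df.
apply: (Ck_eq oU) (IH _ (Df v)) => x Ux.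
by rewrite -deriveZ //; apply/diff_derivable/df.
Qed.

Lemma CkN k U f : open U -> Ck k U f -> Ck k U (fun x => - f x).
Proof.
move=> oU /(CkZ (-1) oU); apply: Ck_eq => // x _; by rewrite scaleN1r.
Qed.

Lemma CkB k U f g : open U -> Ck k U f -> Ck k U g -> Ck k U (fun x => f x - g x).
Proof. by move=> oU cf /(CkN oU) cg; exact: CkD. Qed.

Lemma Ck_sum k U (I : Type) (r : seq I) (P : pred I) (F : I -> V -> W) : open U ->
  (forall i, Ck k U (F i)) -> Ck k U (fun x => \sum_(i <- r | P i) F i x).
Proof.
move=> oU H; elim: r => [|i r IH].
  by apply: (Ck_eq oU) (Ck_cst k U 0) => x _; rewrite big_nil.
case E: (P i).
  by apply: (Ck_eq oU) (CkD oU (H i) IH) => x _; rewrite big_cons E.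
by apply: (Ck_eq oU) IH => x _; rewrite big_cons E.
Qed.

End CkBasics.

Section CkReal.
Variables (R : realType) (V : normedModType R).
Implicit Types (U : set V) (f g : V -> R).

Lemma CkM k U f g : open U -> Ck k U f -> Ck k U g -> Ck k U (fun x => f x * g x).
Proof.
move=> oU; elim: k f g => [|k IH] f g.
  by move=> cf cg x Ux; apply: cvgM; [exact: cf|exact: cg].
move=> cf cg; have [df Df] := cf; have [dg Dg] := cg.
split=> [x Ux|v].
  by apply: differentiableM; [exact: df|exact: dg].
apply: (Ck_eq oU) (CkD oU (IH _ _ (CkS cf) (Dg v)) (IH _ _ (CkS cg) (Df v))) => x Ux.
rewrite -[RHS]/('D_v (f * g) x) deriveM //; apply/diff_derivable; [exact: df|exact: dg].
Qed.

Lemma CkV k U f : open U -> (forall x, U x -> f x != 0) -> Ck k U f ->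
  Ck k U (fun x => (f x)^-1).
Proof.
move=> oU f0; elim: k f f0 => [|k IH] f f0.
  by move=> cf x Ux; apply: cvgV; [exact: f0|exact: cf].
move=> cf; have [df Df] := cf; split=> [x Ux|v].
  by apply: differentiableV; [exact: df|exact: f0].
have fV := IH _ f0 (CkS cf).
apply: (Ck_eq oU) (CkN oU (CkM oU (CkM oU fV fV) (Df v))) => x Ux.
rewrite deriveV; [|exact: f0|exact/diff_derivable/df].
by rewrite expr2 invfM -scaleNr.
Qed.

End CkReal.

Section CkMatrix.
Variables (R : realType) (V : normedModType R).
Implicit Types (U : set V).

Lemma continuous_mx m n (F : V -> 'M[R]_(m, n)) x :
  (forall i j, {for x, continuous (fun y => F y i j)}) -> {for x, continuous F}.
Proof.
move=> H; apply/cvgrPdist_le => e e0; near=> y.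
rewrite [leLHS]/Num.Def.normr/= mx_normrE (bigmax_le _ (ltW e0))//= => i _.
rewrite !mxE; move: i; near: y; apply: filter_forall => /= i.
exact: ((cvgrPdist_le _ _).1 (H i.1 i.2)).
Unshelve. all: by end_near. Qed.

Lemma differentiable_mx m n (F : V -> 'M[R]_(m, n)) x :
  (forall i j, differentiable (fun y => F y i j) x) -> differentiable F x.
Proof.
move=> H.
rewrite (_ : F = fun y => \sum_(i < m) \sum_(j < n) F y i j *: delta_mx i j); last first.
  by apply/funext => y; exact: matrix_sum_delta.
rewrite (_ : (fun _ => _) = \sum_(i < m) (fun y => \sum_(j < n) F y i j *: delta_mx i j)).
  apply: differentiable_sum => i.
  rewrite (_ : (fun _ => _) = \sum_(j < n) (fun y => F y i j *: delta_mx i j)).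
    by apply: differentiable_sum => j; exact: differentiableZl.
  by apply/funext => y; rewrite fct_sumE.
by apply/funext => y; rewrite fct_sumE.
Qed.

Lemma differentiable_entry m n (F : V -> 'M[R]_(m, n)) x i j :
  differentiable F x -> differentiable (fun y => F y i j) x.
Proof.
move=> dF; apply: (@differentiable_comp _ _ _ _ F (fun M : 'M[R]_(m,n) => M i j)) => //.
exact: differentiable_coord.
Qed.

Lemma derive_entry m n (F : V -> 'M[R]_(m, n)) x v i j :
  differentiable F x -> ('D_v F x) i j = 'D_v (fun y => F y i j) x.
Proof.
by move=> /diff_derivable dF; rewrite derive_mx // mxE.
Qed.

Lemma Ck_mx k m n U (F : V -> 'M[R]_(m, n)) : open U ->
  (forall i j, Ck k U (fun x => F x i j)) -> Ck k U F.
Proof.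
move=> oU; elim: k F => [|k IH] F H.
  by move=> x Ux; apply: continuous_mx => i j; exact: H.
have dF x : U x -> differentiable F x.
  by move=> Ux; apply: differentiable_mx => i j; case: (H i j) => + _; apply.
split=> // v; apply: IH => i j; have [_ /(_ v)] := H i j.
by apply: Ck_eq => // x Ux; rewrite derive_entry //; exact: dF.
Qed.

Lemma Ck_entry k m n U (F : V -> 'M[R]_(m, n)) i j : open U -> Ck k U F ->
  Ck k U (fun x => F x i j).
Proof.
move=> oU; elim: k F => [|k IH] F.
  move=> cF x Ux; apply: (@continuous_comp _ _ _ F (fun M : 'M[R]_(m,n) => M i j)).
    exact: cF.
  exact: coord_continuous.
move=> [dF DF]; split=> [x Ux|v]; first exact/differentiable_entry/dF.
by apply: (Ck_eq oU) (IH _ (DF v)) => x Ux; rewrite derive_entry //; exact: dF.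
Qed.

End CkMatrix.

(** * Directional derivatives, matrix products and the chain rule *)

Section Deriv.
Variables (R : realType).

Lemma derive_comp (V W X : normedModType R) (g : V -> W) (f : W -> X) x v :
  differentiable g x -> differentiable f (g x) ->
  'D_v (f \o g) x = 'D_('D_v g x) f (g x).
Proof.
move=> dg df; rewrite deriveE; last exact: differentiable_comp.
by rewrite diff_comp //= !deriveE.
Qed.

Lemma derive_dirD (V W : normedModType R) (f : V -> W) x u v :
  differentiable f x -> 'D_(u + v) f x = 'D_u f x + 'D_v f x.
Proof. by move=> df; rewrite !deriveE // linearD. Qed.

Lemma derive_dirZ (V W : normedModType R) (f : V -> W) x a v :
  differentiable f x -> 'D_(a *: v) f x = a *: 'D_v f x.
Proof. by move=> df; rewrite !deriveE // linearZ. Qed.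

Lemma derive_dir_sum (V W : normedModType R) (f : V -> W) x (I : Type) (r : seq I)
    (P : pred I) (F : I -> V) :
  differentiable f x -> 'D_(\sum_(i <- r | P i) F i) f x = \sum_(i <- r | P i) 'D_(F i) f x.
Proof.
move=> df; rewrite deriveE // linear_sum.
by apply: eq_bigr => i _; rewrite deriveE.
Qed.

Lemma derive_expand (W : normedModType R) d (f : 'rV[R]_d -> W) x v :
  differentiable f x -> 'D_v f x = \sum_j v 0 j *: 'D_(delta_mx 0 j) f x.
Proof.
move=> df; rewrite {1}[v]row_sum_delta derive_dir_sum //.
by apply: eq_bigr => j _; rewrite derive_dirZ.
Qed.

(** The two difference quotients are the same function of [h]. Many identities below are proved by
    passing to a line and back. *)
Lemma derive_line (V W : normedModType R) (f : V -> W) x u (s : R) :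
  'D_1 (fun t : R => f (x + t *: u)) s = 'D_u f (x + s *: u).
Proof.
rewrite /derive.
suff -> : (fun h : R => h^-1 *: (((fun t : R => f (x + t *: u)) \o shift s) (h *: (1 : R)) -
    f (x + s *: u))) =
  (fun h : R => h^-1 *: ((f \o shift (x + s *: u)) (h *: u) - f (x + s *: u))) by [].
apply/funext => h /=.
by rewrite [h *: 1]mulr1 scalerDl addrCA.
Qed.

Lemma differentiable_line (V W : normedModType R) (f : V -> W) x u (s : R) :
  differentiable f (x + s *: u) -> differentiable (fun t : R => f (x + t *: u)) s.
Proof.
move=> df; apply: (@differentiable_comp _ _ _ _ (fun t : R => x + t *: u) f) => //.
Qed.

Section Mx.
Variables (V : normedModType R).

Lemma differentiable_mulmx a b c (A : V -> 'M[R]_(a, b)) (B : V -> 'M[R]_(b, c)) x :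
  differentiable A x -> differentiable B x -> differentiable (fun y => A y *m B y) x.
Proof.
move=> dA dB; apply: differentiable_mx => i j.
rewrite (_ : (fun _ => _) = \sum_k (fun y => A y i k * B y k j)); last first.
  by apply/funext => y; rewrite mxE fct_sumE.
apply: differentiable_sum => k.
by apply: differentiableM; exact: differentiable_entry.
Qed.

Lemma derive_mulmx a b c (A : V -> 'M[R]_(a, b)) (B : V -> 'M[R]_(b, c)) x v :
  differentiable A x -> differentiable B x ->
  'D_v (fun y => A y *m B y) x = 'D_v A x *m B x + A x *m 'D_v B x.
Proof.
move=> dA dB; apply/matrixP => i j.
rewrite derive_entry; last exact: differentiable_mulmx.
rewrite (_ : (fun _ => _) = \sum_k (fun y => A y i k * B y k j)); last first.
  by apply/funext => y; rewrite mxE fct_sumE.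
have dAk i0 k : derivable (fun y => A y i0 k) x v.
  by apply/diff_derivable/differentiable_entry.
have dBk k j0 : derivable (fun y => B y k j0) x v.
  by apply/diff_derivable/differentiable_entry.
rewrite derive_sum; last by move=> k; apply: (@derivableM _ _ (fun y => A y i k) (fun y => B y k j)).
rewrite !mxE -big_split /=; apply: eq_bigr => k _.
rewrite [LHS](@deriveM _ _ (fun y => A y i k) (fun y => B y k j)) //.
rewrite (derive_entry _ _ _ dA) (derive_entry _ _ _ dB) addrC; congr (_ + _) => //; exact: mulrC.
Qed.

Lemma differentiable_mulmxl a b c (A : V -> 'M[R]_(a, b)) (B : 'M[R]_(b, c)) x :
  differentiable A x -> differentiable (fun y => A y *m B) x.
Proof. by move=> dA; apply: differentiable_mulmx => //; exact: differentiable_cst. Qed.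

Lemma differentiable_mulmxr a b c (A : 'M[R]_(a, b)) (B : V -> 'M[R]_(b, c)) x :
  differentiable B x -> differentiable (fun y => A *m B y) x.
Proof. by move=> dA; apply: differentiable_mulmx => //; exact: differentiable_cst. Qed.

Lemma derive_mulmxl a b c (A : V -> 'M[R]_(a, b)) (B : 'M[R]_(b, c)) x v :
  differentiable A x -> 'D_v (fun y => A y *m B) x = 'D_v A x *m B.
Proof.
move=> dA; rewrite derive_mulmx //.
by rewrite derive_cst mulmx0 addr0.
Qed.

Lemma derive_mulmxr a b c (A : 'M[R]_(a, b)) (B : V -> 'M[R]_(b, c)) x v :
  differentiable B x -> 'D_v (fun y => A *m B y) x = A *m 'D_v B x.
Proof.
move=> dB; rewrite derive_mulmx //.
by rewrite derive_cst mul0mx add0r.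
Qed.

Lemma differentiable_tr a b (A : V -> 'M[R]_(a, b)) x :
  differentiable A x -> differentiable (fun y => (A y)^T) x.
Proof.
move=> dA; apply: differentiable_mx => i j.
rewrite (_ : (fun _ => _) = fun y => A y j i); first exact: differentiable_entry.
by apply/funext => y; rewrite mxE.
Qed.

Lemma derive_tr a b (A : V -> 'M[R]_(a, b)) x v :
  differentiable A x -> 'D_v (fun y => (A y)^T) x = ('D_v A x)^T.
Proof.
move=> dA; apply/matrixP => i j; rewrite derive_entry; last exact: differentiable_tr.
rewrite mxE derive_entry //.
by congr ('D_v _ x); apply/funext => y; rewrite mxE.
Qed.

Implicit Types U : set V.

Lemma Ck_mulmx k a b c U (A : V -> 'M[R]_(a, b)) (B : V -> 'M[R]_(b, c)) : open U ->
  Ck k U A -> Ck k U B -> Ck k U (fun y => A y *m B y).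
Proof.
move=> oU cA cB; apply: Ck_mx => // i j.
rewrite (_ : (fun _ => _) = (fun y => \sum_k A y i k * B y k j)); last first.
  by apply/funext => y; rewrite mxE.
by apply: Ck_sum => // l; apply: CkM => //; exact: Ck_entry.
Qed.

Lemma Ck_tr k a b U (A : V -> 'M[R]_(a, b)) : open U ->
  Ck k U A -> Ck k U (fun y => (A y)^T).
Proof.
move=> oU cA; apply: Ck_mx => // i j.
rewrite (_ : (fun _ => _) = fun y => A y j i); first exact: Ck_entry.
by apply/funext => y; rewrite mxE.
Qed.

Lemma Ck_prod k U (I : Type) (r : seq I) (P : pred I) (F : I -> V -> R) : open U ->
  (forall i, Ck k U (F i)) -> Ck k U (fun x => \prod_(i <- r | P i) F i x).
Proof.
move=> oU H; elim: r => [|i r IH].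
  by apply: (Ck_eq oU) (@Ck_cst R V R k U 1) => x _; rewrite big_nil.
case E: (P i).
  by apply: (Ck_eq oU) (CkM oU (H i) IH) => x _; rewrite big_cons E.
by apply: (Ck_eq oU) IH => x _; rewrite big_cons E.
Qed.

Lemma Ck_det k n U (A : V -> 'M[R]_n) : open U ->
  Ck k U A -> Ck k U (fun y => \det (A y)).
Proof.
move=> oU cA; rewrite /determinant; apply: Ck_sum => // s.
apply: CkM => //; first exact: Ck_cst.
by apply: Ck_prod => // i; exact: Ck_entry.
Qed.

Lemma Ck_adj k n U (A : V -> 'M[R]_n) : open U ->
  Ck k U A -> Ck k U (fun y => \adj (A y)).
Proof.
move=> oU cA; apply: Ck_mx => // i j.
apply: (Ck_eq oU (f := fun y => cofactor (A y) j i)) => [y _|]; first by rewrite mxE.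
rewrite /cofactor; apply: CkM => //; first exact: Ck_cst.
apply: Ck_det => //; apply: Ck_mx => // i' j'.
apply: (Ck_eq oU) (Ck_entry (lift j i') (lift i j') oU cA) => y _.
by rewrite !mxE.
Qed.

Lemma Ck_scalemx k a b U (f : V -> R) (A : V -> 'M[R]_(a, b)) : open U ->
  Ck k U f -> Ck k U A -> Ck k U (fun y => f y *: A y).
Proof.
move=> oU cf cA; apply: Ck_mx => // i j.
apply: (Ck_eq oU) (CkM oU cf (Ck_entry i j oU cA)) => y _.
by rewrite mxE.
Qed.

Lemma Ck_invmx k n U (A : V -> 'M[R]_n) : open U ->
  (forall y, U y -> A y \in unitmx) -> Ck k U A -> Ck k U (fun y => invmx (A y)).
Proof.
move=> oU uA cA.
apply: (Ck_eq oU) (Ck_scalemx oU (CkV oU _ (Ck_det oU cA)) (Ck_adj oU cA)) => y Uy.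
  by rewrite /invmx uA.
by rewrite -unitfE; exact: uA.
Qed.

Lemma Ck_row_mx k a b c U (A : V -> 'M[R]_(a, b)) (B : V -> 'M[R]_(a, c)) : open U ->
  Ck k U A -> Ck k U B -> Ck k U (fun y => row_mx (A y) (B y)).
Proof.
move=> oU cA cB; apply: Ck_mx => // i j; case: (splitP j) => l jE.
  apply: (Ck_eq oU) (Ck_entry i l oU cA) => y _.
  by rewrite (_ : j = lshift _ l) ?row_mxEl //; exact: val_inj.
apply: (Ck_eq oU) (Ck_entry i l oU cB) => y _.
by rewrite (_ : j = rshift _ l) ?row_mxEr //; exact: val_inj.
Qed.

End Mx.

Lemma Ck_id (V : normedModType R) k (U : set V) : Ck k U (fun x => x).
Proof.
case: k => [|k] /=; first by move=> x _; exact: cvg_id.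
split=> // v; rewrite (_ : derive _ ^~ v = fun=> v); first exact: Ck_cst.
by apply/funext => x; rewrite derive_id.
Qed.

(** In the chain rule the direction ['D_v g x] moves with [x], which the induction on [k] cannot
    handle. Expanding it in the basis leaves partial derivatives of [f] in fixed directions,
    composed with [g]. *)
Lemma Ck_comp_real k (V : normedModType R) b (U : set V) (U' : set 'rV[R]_b)
    (g : V -> 'rV[R]_b) (f : 'rV[R]_b -> R) : open U ->
  (forall x, U x -> U' (g x)) -> Ck k U g -> Ck k U' f -> Ck k U (f \o g).
Proof.
move=> oU gU; elim: k g f gU => [|k IH] g f gU cg cf.
  by move=> x Ux; apply: continuous_comp; [exact: cg|exact/cf/gU].
have [dg Dg] := cg; have [df Df] := cf; split=> [x Ux|v].
  by apply: differentiable_comp; [exact: dg|exact/df/gU].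
have H j : Ck k U (fun x => ('D_v g x) 0 j * (derive f ^~ (delta_mx 0 j) \o g) x).
  apply: CkM => //; first exact: (Ck_entry 0 j oU (Dg v)).
  exact: IH gU (CkS cg) (Df _).
apply: (Ck_eq oU) (Ck_sum (index_enum _) predT oU H) => x Ux.
rewrite [RHS]derive_comp; [|exact: dg|exact/df/gU].
by rewrite derive_expand //; exact/df/gU.
Qed.

Lemma Ck_comp k (V : normedModType R) b c d (U : set V) (U' : set 'rV[R]_b)
    (g : V -> 'rV[R]_b) (f : 'rV[R]_b -> 'M[R]_(c, d)) : open U -> open U' ->
  (forall x, U x -> U' (g x)) -> Ck k U g -> Ck k U' f -> Ck k U (f \o g).
Proof.
move=> oU oU' gU cg cf; apply: Ck_mx => // i j.
by apply: (Ck_comp_real oU gU cg (f := fun y => f y i j)); exact: Ck_entry.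
Qed.

Lemma Ck_jacobian k a b (U : set 'rV[R]_a) (f : 'rV[R]_a -> 'rV[R]_b) : open U ->
  Ck k.+1 U f -> Ck k U (jacobian f).
Proof.
move=> oU [df Df]; apply: Ck_mx => // i j.
apply: (Ck_eq oU) (Ck_entry 0 j oU (Df (delta_mx 0 i))) => x Ux.
rewrite deriveEjacobian; last exact: df.
by rewrite -rowE mxE.
Qed.

Lemma row_jacobian a b (f : 'rV[R]_a -> 'rV[R]_b) x i :
  differentiable f x -> row i ('J f x) = 'D_(delta_mx 0 i) f x.
Proof. by move=> df; rewrite rowE (deriveEjacobian _ df). Qed.

Lemma jacobian_comp a b c (g : 'rV[R]_a -> 'rV[R]_b) (f : 'rV[R]_b -> 'rV[R]_c) x :
  differentiable g x -> differentiable f (g x) ->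
  'J (f \o g) x = 'J g x *m 'J f (g x).
Proof.
move=> dg df; apply/row_matrixP => i; rewrite row_mul (row_jacobian _ dg).
rewrite row_jacobian; last exact: differentiable_comp.
by rewrite derive_comp // (deriveEjacobian _ df).
Qed.

Lemma near_eq_jacobian a b (g f : 'rV[R]_a -> 'rV[R]_b) x :
  differentiable f x -> (\near x, f x = g x) -> 'J f x = 'J g x.
Proof.
move=> df fg; have dg := near_eq_differentiable fg df.
apply/row_matrixP => i; apply: etrans (row_jacobian i df) _.
apply: etrans (esym (row_jacobian i dg)); exact: near_eq_derive_fun.
Qed.

Lemma jacobian_comp_eq a b c (g : 'rV[R]_a -> 'rV[R]_b) (f : 'rV[R]_b -> 'rV[R]_c) h x y :
  differentiable g x -> g x = y -> differentiable f y -> (\near x, (f \o g) x = h x) ->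
  'J h x = 'J g x *m 'J f y.
Proof.
move=> dg <- df fgh; apply: etrans (jacobian_comp dg df).
by apply/esym; apply: near_eq_jacobian fgh; exact: differentiable_comp.
Qed.

Lemma jacobian_id a x : 'J (fun y : 'rV[R]_a => y) x = 1%:M.
Proof.
by apply/row_matrixP => i; rewrite row_jacobian // derive_id row1.
Qed.

End Deriv.

(** * Symmetry of second derivatives *)

Section Schwarz.
Variables (R : realType) (V : normedModType R).

Lemma MVT_line (f : V -> R) x u (h : R) : 0 < h ->
  (forall s, 0 <= s <= h -> differentiable f (x + s *: u)) ->
  exists2 s, 0 < s < h & f (x + h *: u) - f x = 'D_u f (x + s *: u) * h.
Proof.
move=> h0 df.
have D (s : R) : 0 <= s <= h -> differentiable (fun t : R => f (x + t *: u)) s.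
  by move=> /df; exact: differentiable_line.
have [||s] := @MVT R (fun t => f (x + t *: u)) (fun t => 'D_u f (x + t *: u)) 0 h h0.
- move=> s; rewrite in_itv /= => /andP[s0 sh].
  rewrite -derive_line; apply: derivableP; apply/diff_derivable/D.
  by rewrite !ltW.
- apply: continuous_in_subspaceT => s; rewrite inE /= in_itv /= => ?.
  exact/differentiable_continuous/D.
rewrite in_itv /= => sh; rewrite subr0 scale0r addr0 => E.
by exists s.
Qed.

(** The mean value theorem twice: along [u] for [phi y = f (y + h v) - f y], then along [v] for
    ['D_u f]. *)
Lemma second_difference (f : V -> R) x u v (h : R) : 0 < h ->
  (forall s t, 0 <= s <= h -> 0 <= t <= h ->
     differentiable f (x + s *: u + t *: v) /\
     differentiable ('D_u f) (x + s *: u + t *: v)) ->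
  exists s t, [/\ 0 < s < h, 0 < t < h &
   f (x + h *: u + h *: v) - f (x + h *: u) - f (x + h *: v) + f x
   = 'D_v ('D_u f) (x + s *: u + t *: v) * h * h].
Proof.
move=> h0 df; have hh : 0 <= h <= h by rewrite ltW // lexx.
pose phi y := f (y + h *: v) - f y.
have dsh s : 0 <= s <= h -> differentiable (fun y => f (y + h *: v)) (x + s *: u).
  move=> sh; apply: (@differentiable_comp _ _ _ _ (fun y => y + h *: v) f).
    by apply: (@differentiableD _ _ _ id (fun=> h *: v)) => //; exact: differentiable_cst.
  exact: (df s h sh hh).1.
have ds s : 0 <= s <= h -> differentiable f (x + s *: u).
  by move=> sh; have := (df s 0 sh); rewrite scale0r addr0 lexx ltW // => /(_ isT)[].
have [|s sh E] := @MVT_line phi x u h h0.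
  by move=> s sh; apply: differentiableB; [exact: dsh|exact: ds].
have sh' : 0 <= s <= h by case/andP: sh => *; rewrite !ltW.
have [|t th F] := @MVT_line ('D_u f) (x + s *: u) v h h0.
  by move=> t th; exact: (df s t sh' th).2.
exists s, t; split=> //; rewrite -F.
have Duv y w : 'D_u (fun z => f (z + w)) y = 'D_u f (y + w).
  rewrite /derive.
  suff -> : (fun k : R => k^-1 *: (((fun z => f (z + w)) \o shift y) (k *: u) - f (y + w))) =
    (fun k : R => k^-1 *: ((f \o shift (y + w)) (k *: u) - f (y + w))) by [].
  by apply/funext => k /=; rewrite addrA.
have sI : 0 <= s <= h by case/andP: sh => *; rewrite !ltW.
have Dphi : 'D_u phi (x + s *: u) = 'D_u f (x + s *: u + h *: v) - 'D_u f (x + s *: u).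
  rewrite -Duv -[LHS]/('D_u ((fun y => f (y + h *: v)) - f) (x + s *: u)).
  by rewrite deriveB //; apply/diff_derivable; [exact: dsh|exact: ds].
rewrite -Dphi -E /phi; move: (f (x + h *: u + h *: v)) (f (x + h *: u)) (f (x + h *: v)) (f x).
by move=> ? ? ? ?; rewrite opprD opprK addrA.
Qed.

(** The second difference is symmetric in [u] and [v], so the two mixed derivatives take a common
    value at two points close to [x]; their continuity at [x] concludes. *)
Lemma Ck_schwarz_real (U : set V) (f : V -> R) x u v : open U -> U x -> Ck 2 U f ->
  'D_v ('D_u f) x = 'D_u ('D_v f) x.
Proof.
move=> oU Ux cf; have [df Df] := cf.
have cont a b : {for x, continuous ('D_b ('D_a f))}.
  by have [_ /(_ b)] := Df a; move=> /(_ x Ux).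
apply/eqP; rewrite -subr_eq0 -normr_le0; apply/ler_addgt0Pl => e e0; rewrite addr0.
have e2 : 0 < e / 2 by rewrite divr_gt0.
have close a b : \forall y \near x, `|'D_b ('D_a f) x - 'D_b ('D_a f) y| < e / 2.
  exact: ((cvgrPdist_lt _ _).1 (cont a b)).
have : \forall y \near x, [/\ U y, `|'D_v ('D_u f) x - 'D_v ('D_u f) y| < e / 2
    & `|'D_u ('D_v f) x - 'D_u ('D_v f) y| < e / 2].
  have nU : \forall y \near x, U y by exact: open_nbhs_nbhs.
  by apply: filterS3 nU (close u v) (close v u) => y *; split.
move=> /nbhs_ballP[r /= r0 Br].
(* Keeps the parallelogram of the points [x + s u + t v], with [s] and [t] at most [h], inside the
   ball of radius [r]. *)
pose h := r / (1 + `|u| + `|v|).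
have n0 : 0 < 1 + `|u| + `|v| by rewrite -addrA ltr_pwDl // addr_ge0.
have h0 : 0 < h by rewrite divr_gt0.
have inball a b s t : 1 + `|a| + `|b| = 1 + `|u| + `|v| -> 0 <= s <= h -> 0 <= t <= h ->
    ball x r (x + s *: a + t *: b).
  move=> ab /andP[s0 sh] /andP[t0 th]; rewrite -ball_normE /= -addrA opprD addrA subrr sub0r normrN.
  apply: le_lt_trans (ler_normD _ _) _; rewrite !normrZ !ger0_norm //.
  have : r = h * (1 + `|a| + `|b|) by rewrite ab /h divfK // gt_eqF.
  move=> ->; rewrite !mulrDr mulr1 -addrA ltr_pwDl // lerD // ler_wpM2r //.
have dd a b s t : 1 + `|a| + `|b| = 1 + `|u| + `|v| -> 0 <= s <= h -> 0 <= t <= h ->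
   differentiable f (x + s *: a + t *: b) /\
   differentiable ('D_a f) (x + s *: a + t *: b).
  move=> ab sh th; have [Uy _ _] := Br _ (inball _ _ _ _ ab sh th).
  by split; [exact: df|have [+ _] := Df a; apply].
have [s [t [sh th E]]] := second_difference h0 (fun s t => dd u v s t erefl).
have vu : 1 + `|v| + `|u| = 1 + `|u| + `|v| by rewrite addrAC.
have [s' [t' [sh' th' E']]] := second_difference h0 (fun s t => dd v u s t vu).
have W (a : R) : 0 < a < h -> 0 <= a <= h by case/andP=> *; rewrite !ltW.
have [_ C1 _] := Br _ (inball _ _ _ _ erefl (W _ sh) (W _ th)).
have [_ _ C2] := Br _ (inball _ _ _ _ vu (W _ sh') (W _ th')).
have hI (a b : R) : a * h * h = b * h * h -> a = b.
  by have hn0 : h != 0 by [rewrite gt_eqF]; move=> /(mulIf hn0)/(mulIf hn0).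
have tri (a b c : R) : `|a - c| < e / 2 -> `|b - c| < e / 2 -> `|a - b| <= e.
  move=> ac bc; rewrite (_ : a - b = (a - c) - (b - c)); last by rewrite opprB addrA subrK.
  by apply: le_trans (ler_normB _ _) _; rewrite [e]splitr; apply: lerD; apply: ltW.
have swap : f (x + h *: u + h *: v) - f (x + h *: u) - f (x + h *: v) + f x =
  f (x + h *: v + h *: u) - f (x + h *: v) - f (x + h *: u) + f x.
  by rewrite (addrAC x); congr (_ + _); exact: addrAC.
have EE := hI _ _ (etrans (esym E) (etrans swap E')).
by apply: tri C1 _; rewrite EE.
Qed.

Lemma Ck_schwarz a b (U : set V) (f : V -> 'M[R]_(a, b)) x u v : open U -> U x ->
  Ck 2 U f -> 'D_v ('D_u f) x = 'D_u ('D_v f) x.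
Proof.
move=> oU Ux cf; have [df Df] := cf.
have E u' v' i j : ('D_v' ('D_u' f) x) i j = 'D_v' ('D_u' (fun y => f y i j)) x.
  have [dD _] := Df u'.
  rewrite derive_entry; last exact: dD.
  apply: near_eq_derive_fun; apply: eq_open_near oU _ Ux => y Uy.
  by rewrite derive_entry //; exact: df.
apply/matrixP => i j; apply: etrans (E u v i j) (etrans _ (esym (E v u i j))).
exact: (Ck_schwarz_real u v oU Ux (Ck_entry i j oU cf)).
Qed.

End Schwarz.

(** * Directional derivatives *)

(* The library's derive and jacobian are sealed: comparing two of them up to
   conversion would unfold them to limits of filters. *)
HB.lock Definition dv (R : realType) (V W : normedModType R) (v : V) (f : V -> W) (x : V) : W :=
  'D_v f x.
HB.lock Definition jac (R : realType) (a b : nat) (f : 'rV[R]_a -> 'rV[R]_b) (x : 'rV[R]_a)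
  : 'M[R]_(a, b) := 'J f x.
HB.lock Definition dble (R : realType) (V W : normedModType R) (f : V -> W) (x : V) : Prop :=
  differentiable f x.

Section Dv.
Variable R : realType.

Lemma Ck_dble k (V W : normedModType R) (U : set V) (f : V -> W) x :
  Ck k.+1 U f -> U x -> dble f x.
Proof. by rewrite dble.unlock; exact: Ck_differentiable. Qed.

Lemma dble_comp (V W X : normedModType R) (g : V -> W) (f : W -> X) x y :
  dble g x -> g x = y -> dble f y -> dble (f \o g) x.
Proof. by rewrite dble.unlock => dg <-; exact: differentiable_comp. Qed.

Lemma dbleD (V W : normedModType R) (f g : V -> W) x :
  dble f x -> dble g x -> dble (fun y => f y + g y) x.
Proof. by rewrite dble.unlock; exact: differentiableD. Qed.

Lemma dbleN (V W : normedModType R) (f : V -> W) x : dble f x -> dble (fun y => - f y) x.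
Proof. by rewrite dble.unlock; exact: differentiableN. Qed.

Lemma dbleB (V W : normedModType R) (f g : V -> W) x :
  dble f x -> dble g x -> dble (fun y => f y - g y) x.
Proof. by move=> df /dbleN; exact: dbleD. Qed.

Lemma dble_continuous (V W : normedModType R) (f : V -> W) x : dble f x -> {for x, continuous f}.
Proof. by rewrite dble.unlock; exact: differentiable_continuous. Qed.

Lemma near_eq_dv (V W : normedModType R) (f g : V -> W) x v :
  (\near x, f x = g x) -> dv v f x = dv v g x.
Proof. by rewrite dv.unlock; exact: near_eq_derive_fun. Qed.

Lemma dv_cst (V W : normedModType R) (a : W) (x v : V) : dv v (fun=> a) x = 0.
Proof. by rewrite dv.unlock derive_cst. Qed.

Lemma dv_id (V : normedModType R) (x v : V) : dv v (fun y => y) x = v.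
Proof. by rewrite dv.unlock derive_id. Qed.

Lemma dvD (V W : normedModType R) (f g : V -> W) x v :
  dble f x -> dble g x -> dv v (fun y => f y + g y) x = dv v f x + dv v g x.
Proof.
by rewrite dble.unlock dv.unlock => df dg; apply: deriveD; exact/diff_derivable.
Qed.

Lemma dvN (V W : normedModType R) (f : V -> W) x v :
  dble f x -> dv v (fun y => - f y) x = - dv v f x.
Proof. by rewrite dble.unlock dv.unlock => df; apply: deriveN; exact/diff_derivable. Qed.

Lemma dvB (V W : normedModType R) (f g : V -> W) x v :
  dble f x -> dble g x -> dv v (fun y => f y - g y) x = dv v f x - dv v g x.
Proof. by move=> df dg; rewrite dvD ?dvN //; exact: dbleN. Qed.

Lemma dv_comp (V W X : normedModType R) (g : V -> W) (f : W -> X) x y v :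
  dble g x -> g x = y -> dble f y -> dv v (f \o g) x = dv (dv v g x) f y.
Proof. by rewrite dble.unlock dv.unlock => dg <- df; exact: derive_comp. Qed.

Lemma dv_dirD (V W : normedModType R) (f : V -> W) x u v :
  dble f x -> dv (u + v) f x = dv u f x + dv v f x.
Proof. by rewrite dble.unlock dv.unlock; exact: derive_dirD. Qed.

Lemma dv_dirZ (V W : normedModType R) (f : V -> W) x a v :
  dble f x -> dv (a *: v) f x = a *: dv v f x.
Proof. by rewrite dble.unlock dv.unlock; exact: derive_dirZ. Qed.

Lemma dv_dir0 (V W : normedModType R) (f : V -> W) x : dv 0 f x = 0.
Proof. by rewrite dv.unlock derive0. Qed.

Lemma dv_line (V W : normedModType R) (f : V -> W) x u (s : R) :
  dv (1 : R) (fun t : R => f (x + t *: u)) s = dv u f (x + s *: u).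
Proof. by rewrite dv.unlock derive_line. Qed.

Lemma dble_line (V W : normedModType R) (f : V -> W) x u (s : R) :
  dble f (x + s *: u) -> dble (fun t : R => f (x + t *: u)) s.
Proof. by rewrite dble.unlock; exact: differentiable_line. Qed.

Lemma dble_mulmx (V : normedModType R) a b c (A : V -> 'M[R]_(a, b)) (B : V -> 'M[R]_(b, c)) x :
  dble A x -> dble B x -> dble (fun y => A y *m B y) x.
Proof. by rewrite dble.unlock; exact: differentiable_mulmx. Qed.

Lemma dv_mulmx (V : normedModType R) a b c (A : V -> 'M[R]_(a, b)) (B : V -> 'M[R]_(b, c)) x v :
  dble A x -> dble B x -> dv v (fun y => A y *m B y) x = dv v A x *m B x + A x *m dv v B x.
Proof. by rewrite dble.unlock dv.unlock; exact: derive_mulmx. Qed.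

Lemma dble_mulmxl (V : normedModType R) a b c (A : V -> 'M[R]_(a, b)) (B : 'M[R]_(b, c)) x :
  dble A x -> dble (fun y => A y *m B) x.
Proof. by rewrite dble.unlock; exact: differentiable_mulmxl. Qed.

Lemma dble_mulmxr (V : normedModType R) a b c (A : 'M[R]_(a, b)) (B : V -> 'M[R]_(b, c)) x :
  dble B x -> dble (fun y => A *m B y) x.
Proof. by rewrite dble.unlock; exact: differentiable_mulmxr. Qed.

Lemma dv_mulmxl (V : normedModType R) a b c (A : V -> 'M[R]_(a, b)) (B : 'M[R]_(b, c)) x v :
  dble A x -> dv v (fun y => A y *m B) x = dv v A x *m B.
Proof. by rewrite dble.unlock dv.unlock; exact: derive_mulmxl. Qed.

Lemma dv_mulmxr (V : normedModType R) a b c (A : 'M[R]_(a, b)) (B : V -> 'M[R]_(b, c)) x v :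
  dble B x -> dv v (fun y => A *m B y) x = A *m dv v B x.
Proof. by rewrite dble.unlock dv.unlock; exact: derive_mulmxr. Qed.

Lemma dble_tr (V : normedModType R) a b (A : V -> 'M[R]_(a, b)) x :
  dble A x -> dble (fun y => (A y)^T) x.
Proof. by rewrite dble.unlock; exact: differentiable_tr. Qed.

Lemma dv_tr (V : normedModType R) a b (A : V -> 'M[R]_(a, b)) x v :
  dble A x -> dv v (fun y => (A y)^T) x = (dv v A x)^T.
Proof. by rewrite dble.unlock dv.unlock; exact: derive_tr. Qed.

Lemma dv_jac a b (f : 'rV[R]_a -> 'rV[R]_b) x v : dble f x -> dv v f x = v *m jac f x.
Proof. by rewrite dble.unlock dv.unlock jac.unlock => df; exact: deriveEjacobian. Qed.

Lemma Ck_dv k (V W : normedModType R) (U : set V) (f : V -> W) v :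
  Ck k.+1 U f -> Ck k U (dv v f).
Proof. by case=> _ /(_ v); rewrite dv.unlock. Qed.

Lemma Ck_jac k a b (U : set 'rV[R]_a) (f : 'rV[R]_a -> 'rV[R]_b) : open U ->
  Ck k.+1 U f -> Ck k U (jac f).
Proof. by rewrite jac.unlock; exact: Ck_jacobian. Qed.

Lemma dv_schwarz (V : normedModType R) a b (U : set V) (f : V -> 'M[R]_(a, b)) x u v :
  open U -> U x -> Ck 2 U f -> dv v (dv u f) x = dv u (dv v f) x.
Proof. by rewrite dv.unlock; exact: Ck_schwarz. Qed.

Lemma jac_comp a b c (g : 'rV[R]_a -> 'rV[R]_b) (f : 'rV[R]_b -> 'rV[R]_c) h x y :
  dble g x -> g x = y -> dble f y -> (\near x, (f \o g) x = h x) ->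
  jac h x = jac g x *m jac f y.
Proof. by rewrite dble.unlock jac.unlock; exact: jacobian_comp_eq. Qed.

Lemma near_eq_jac a b (g f : 'rV[R]_a -> 'rV[R]_b) x :
  dble f x -> (\near x, f x = g x) -> jac f x = jac g x.
Proof. by rewrite dble.unlock jac.unlock; exact: near_eq_jacobian. Qed.

Lemma jac_id a x : jac (fun y : 'rV[R]_a => y) x = 1%:M.
Proof. by rewrite jac.unlock jacobian_id. Qed.

Lemma dble_id (V : normedModType R) (x : V) : dble (fun y => y) x.
Proof. by rewrite dble.unlock. Qed.

End Dv.

(** * Charts and vector fields *)

(** Converts the components of a tangent vector at [q] from the chart [c] to the chart [c']. As
    vectors are rows, successive changes of chart multiply from left to right. *)
HB.lock Definition tr (R : realType) (d : nat) (M : manifold R d) (c c' : chart R d M) (q : M)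
  : 'M[R]_d := jac (c' \o cinv c) (c q).

Section Charts.
Variables (R : realType) (d : nat) (M : manifold R d).
Implicit Types (c : chart R d M) (U V : set M) (q p : M).

Lemma open_chart_image c U : open U -> open (c @` (U `&` cdom c)).
Proof.
move=> oU; rewrite openE => _ [p [Up cp] <-]; rewrite /interior.
have n1 : \forall y \near c p, (c @` cdom c) y.
  by apply: open_nbhs_nbhs; split; [exact: cimage_open|exists p].
have n2 : \forall y \near c p, U (cinv c y).
  have nU : nbhs (cinv c (c p)) U by rewrite cmapK //; exact: open_nbhs_nbhs.
  exact: (cinv_continuous cp nU).
by apply: filterS2 n1 n2 => _ [r cr <-]; rewrite cmapK // => Ur; exists r.
Qed.

Local Notation tr := (@tr R d M).

Lemma smooth_chart_at p : smooth_chart (chart_at p).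
Proof. by move=> q; exact: chart_at_compatible. Qed.

(** All smooth charts are allowed, not only the preferred ones, because the holomorphic charts used
    for involutivity are not preferred. *)
Definition smoothF a b U (F : M -> 'M[R]_(a, b)) :=
  forall c, smooth_chart c -> smooth_on (c @` (U `&` cdom c)) (F \o cinv c).

Lemma smooth_on_local (V W : normedModType R) (U : set V) (f : V -> W) :
  (forall x, U x -> exists U' : set V, [/\ open U', U' x & smooth_on U' f]) -> smooth_on U f.
Proof.
move=> H k; apply: Ck_local => x /H[U' [_ U'x sf]].
by exists U'; split=> //; exact: sf.
Qed.

(** Smooth charts are only known to be compatible with the preferred ones, so the transition is
    factored through [chart_at p] near [p]. *)
Lemma smooth_transition_local c c' p : smooth_chart c -> smooth_chart c' ->
  cdom c p -> cdom c' p ->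
  exists U' : set 'rV[R]_d, [/\ open U', U' (c p), smooth_on U' (c' \o cinv c) &
                U' `<=` c @` (cdom c `&` cdom c')].
Proof.
move=> sc sc' cp c'p; pose b := chart_at p; have bp : cdom b p := mem_chart_at p.
have [cb _] := sc p; have [_ bc'] := sc' p.
pose U := cdom c' `&` cdom b.
have oU : open U by apply: openI; exact: cdom_open.
exists (c @` (U `&` cdom c)); split.
- exact: open_chart_image.
- by exists p.
- move=> k; pose U' := b @` (cdom c' `&` cdom b).
  have oU' : open U' by apply/open_chart_image/cdom_open.
  have E y : (c @` (U `&` cdom c)) y -> ((c' \o cinv b) \o (b \o cinv c)) y = (c' \o cinv c) y.
    by move=> [q [[c'q bq] cq] <-] /=; rewrite !cmapK.
  apply: (Ck_eq (open_chart_image oU) E).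
  apply: (@Ck_comp _ _ _ _ _ _ _ U') => //; first exact: open_chart_image.
  + by move=> _ [q [[c'q bq] cq] <-] /=; rewrite !cmapK //; exists q.
  + by apply: Ck_sub (cb k) => _ [q [[c'q bq] cq] <-]; exists q.
  + by apply: Ck_sub (bc' k) => _ [q [c'q bq] <-]; exists q.
- by move=> _ [q [[c'q bq] cq] <-]; exists q.
Qed.

Lemma smooth_transitionP c c' : smooth_chart c -> smooth_chart c' ->
  smooth_on (c @` (cdom c' `&` cdom c)) (c' \o cinv c).
Proof.
move=> sc sc'; apply: smooth_on_local => _ [p [c'p cp] <-].
by have [U' [oU' U'p s _]] := smooth_transition_local sc sc' cp c'p; exists U'.
Qed.

Lemma differentiable_transition c c' p : smooth_chart c -> smooth_chart c' ->
  cdom c p -> cdom c' p -> dble (c' \o cinv c) (c p).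
Proof.
move=> sc sc' cp c'p.
have [U' [oU' U'p s _]] := smooth_transition_local sc sc' cp c'p.
exact: (Ck_dble (s 1%N)).
Qed.

Lemma near_chart c p U : cdom c p -> open U -> U p ->
  \forall y \near c p, exists q, [/\ U q, cdom c q & y = c q].
Proof.
move=> cp oU Up.
have : (c @` (U `&` cdom c)) (c p) by exists p.
move=> /(conj (open_chart_image (c:=c) oU))/open_nbhs_nbhs.
by apply: filterS => _ [q [Uq cq] <-]; exists q.
Qed.

Lemma near_chart_comp (T : Type) (F : M -> T) c c' p : cdom c p -> cdom c' p ->
  \forall y \near c p, ((F \o cinv c') \o (c' \o cinv c)) y = (F \o cinv c) y.
Proof.
move=> cp c'p; have := near_chart cp (cdom_open c') c'p.
by apply: filterS => _ [q [c'q cq ->]] /=; rewrite !cmapK.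
Qed.

Lemma tr_comp c c' c'' p : smooth_chart c -> smooth_chart c' -> smooth_chart c'' ->
  cdom c p -> cdom c' p -> cdom c'' p -> tr c c'' p = tr c c' p *m tr c' c'' p.
Proof.
move=> sc sc' sc'' cp c'p c''p.
have E : (c' \o cinv c) (c p) = c' p by rewrite /= cmapK.
rewrite tr.unlock; exact: (jac_comp (differentiable_transition sc sc' cp c'p) E
  (differentiable_transition sc' sc'' c'p c''p) (near_chart_comp c'' cp c'p)).
Qed.

Lemma tr_id c p : cdom c p -> tr c c p = 1%:M.
Proof.
move=> cp; rewrite tr.unlock -(jac_id (c p)); apply/esym/near_eq_jac; first exact: dble_id.
have := near_chart cp (cdom_open c) cp.
by apply: filterS => _ [q [c'q cq ->]] /=; rewrite !cmapK.
Qed.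

Lemma trK c c' p : smooth_chart c -> smooth_chart c' ->
  cdom c p -> cdom c' p -> tr c c' p *m tr c' c p = 1%:M.
Proof. by move=> sc sc' cp c'p; rewrite -tr_comp // tr_id. Qed.

Lemma smoothF_local a b U (F : M -> 'M[R]_(a, b)) :
  (forall p, U p -> exists c V, [/\ smooth_chart c, cdom c p, open V, V p &
     smooth_on (c @` (V `&` cdom c)) (F \o cinv c)]) -> smoothF U F.
Proof.
move=> H c sc; apply: smooth_on_local => _ [p [Up cp] <-].
have [c' [V [sc' c'p oV Vp sF]]] := H p Up.
pose V' := V `&` cdom c'.
have oV' : open V' by apply: openI => //; exact: cdom_open.
exists (c @` (V' `&` cdom c)); split.
- exact: open_chart_image.
- by exists p.
- move=> k.
  have E y : (c @` (V' `&` cdom c)) y -> ((F \o cinv c') \o (c' \o cinv c)) y = (F \o cinv c) y.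
    by move=> [q [[Vq c'q] cq] <-] /=; rewrite !cmapK.
  apply: (Ck_eq (open_chart_image oV') E).
  apply: (@Ck_comp _ _ _ _ _ _ _ (c' @` (V `&` cdom c'))) => //.
  + exact: open_chart_image.
  + exact: open_chart_image.
  + by move=> _ [q [[Vq c'q] cq] <-] /=; rewrite !cmapK //; exists q.
  + by apply: Ck_sub (smooth_transitionP sc sc' k) => _ [q [[Vq c'q] cq] <-]; exists q.
Qed.

Lemma smooth_map_smoothF k U (F : M -> 'rV[R]_k) : open U -> smooth_map U F <-> smoothF U F.
Proof.
move=> oU; split=> [sF|sF p]; last exact/sF/smooth_chart_at.
apply: smoothF_local => p Up; exists (chart_at p), U; split=> //.
- exact: smooth_chart_at.
- exact: mem_chart_at.
Qed.

Lemma smoothF_eq a b U (F G : M -> 'M[R]_(a, b)) : open U ->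
  (forall p, U p -> F p = G p) -> smoothF U F -> smoothF U G.
Proof.
move=> oU FG sF c sc k; apply: Ck_eq (sF c sc k); first exact: open_chart_image.
by move=> _ [q [Uq cq] <-] /=; rewrite cmapK // FG.
Qed.

Lemma smoothF_sub a b U V (F : M -> 'M[R]_(a, b)) : V `<=` U -> smoothF U F -> smoothF V F.
Proof.
move=> VU sF c sc k; apply: Ck_sub (sF c sc k).
by move=> _ [q [Uq cq] <-]; exists q => //; split=> //; exact: VU.
Qed.

Lemma smoothF_cst a b U (A : 'M[R]_(a, b)) : smoothF U (fun=> A).
Proof. by move=> c _ k; exact: Ck_cst. Qed.

Lemma smoothF_mulmx a b e U (F : M -> 'M[R]_(a, b)) (G : M -> 'M[R]_(b, e)) : open U ->
  smoothF U F -> smoothF U G -> smoothF U (fun q => F q *m G q).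
Proof.
move=> oU sF sG c sc k; have o := open_chart_image (c:=c) oU.
exact: (Ck_mulmx o (sF c sc k) (sG c sc k)).
Qed.

Lemma smoothF_add a b U (F G : M -> 'M[R]_(a, b)) : open U ->
  smoothF U F -> smoothF U G -> smoothF U (fun q => F q + G q).
Proof.
move=> oU sF sG c sc k; have o := open_chart_image (c:=c) oU.
exact: (CkD o (sF c sc k) (sG c sc k)).
Qed.

Lemma smoothF_opp a b U (F : M -> 'M[R]_(a, b)) : open U ->
  smoothF U F -> smoothF U (fun q => - F q).
Proof.
move=> oU sF c sc k; have o := open_chart_image (c:=c) oU.
exact: (CkN o (sF c sc k)).
Qed.

Lemma smoothF_sub_mx a b U (F G : M -> 'M[R]_(a, b)) : open U ->
  smoothF U F -> smoothF U G -> smoothF U (fun q => F q - G q).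
Proof. by move=> oU sF sG; apply: smoothF_add => //; exact: smoothF_opp. Qed.

Lemma smoothF_scale a b U (x : R) (F : M -> 'M[R]_(a, b)) : open U ->
  smoothF U F -> smoothF U (fun q => x *: F q).
Proof.
move=> oU sF c sc k; have o := open_chart_image (c:=c) oU.
exact: (CkZ x o (sF c sc k)).
Qed.

Lemma smoothF_invmx a U (F : M -> 'M[R]_a) : open U -> (forall p, U p -> F p \in unitmx) ->
  smoothF U F -> smoothF U (fun q => invmx (F q)).
Proof.
move=> oU uF sF c sc k; have o := open_chart_image (c:=c) oU.
apply: (Ck_invmx o _ (sF c sc k)).
by move=> _ [q [Uq cq] <-] /=; rewrite cmapK //; exact: uF.
Qed.

Lemma smoothF_tr c c' : smooth_chart c -> smooth_chart c' ->
  smoothF (cdom c `&` cdom c') (tr c c').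
Proof.
move=> sc sc'; apply: smoothF_local => p [cp c'p].
exists c, (cdom c'); split=> //; first exact: cdom_open.
move=> k; have o := open_chart_image (c:=c) (cdom_open c').
apply: Ck_eq o _ (Ck_jac o (smooth_transitionP sc sc' k.+1)).
by move=> _ [q [c'q cq] <-] /=; rewrite tr.unlock cmapK.
Qed.

Lemma smoothF_continuous a b U (F : M -> 'M[R]_(a, b)) p : open U -> U p ->
  smoothF U F -> {for p, continuous F}.
Proof.
move=> oU Up sF; pose c := chart_at p; have cp : cdom c p := mem_chart_at p.
have s := sF c (@smooth_chart_at p).
have cF : {for c p, continuous (F \o cinv c)} by apply: (s 0%N); exists p.
have G : {for p, continuous ((F \o cinv c) \o c)}.
  by apply: continuous_comp => //; exact: cmap_continuous.
have E : \forall q \near p, ((F \o cinv c) \o c) q = F q.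
  apply: filterS (open_nbhs_nbhs (conj (cdom_open c) cp)) => q cq.
  by rewrite /= cmapK.
apply: cvg_trans (near_eq_cvg E) _; rewrite -(nbhs_singleton E); exact: G.
Qed.

Definition chart_diff k (F : M -> 'rV[R]_k) c p : 'M[R]_(d, k) := jac (F \o cinv c) (c p).

Lemma chart_diffE k (F : M -> 'rV[R]_k) c c' U p : open U -> U p -> smoothF U F ->
  smooth_chart c -> smooth_chart c' -> cdom c p -> cdom c' p ->
  chart_diff F c p = tr c c' p *m chart_diff F c' p.
Proof.
rewrite tr.unlock; move=> oU Up sF sc sc' cp c'p; have E : (c' \o cinv c) (c p) = c' p by rewrite /= cmapK.
have d2 : dble (F \o cinv c') (c' p).
  by apply: (Ck_dble (sF c' sc' 1%N)); exists p.
exact: (jac_comp (differentiable_transition sc sc' cp c'p) E d2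
  (near_chart_comp F cp c'p)).
Qed.

End Charts.

(** * Real and imaginary parts of complex matrices *)

Section Complex.
Variable R : realType.

Lemma toC_N a b (A : 'M[R]_(a, b)) : toC (- A) = - toC A.
Proof. exact: map_mxN. Qed.

Lemma toC_M a b c (A : 'M[R]_(a, b)) (B : 'M[R]_(b, c)) : toC (A *m B) = toC A *m toC B.
Proof. exact: map_mxM. Qed.

Lemma ReM_toC a b (A : 'M[R]_(a, b)) : ReM (toC A) = A.
Proof. by apply/matrixP => i j; rewrite !mxE. Qed.

Lemma ImM_toC a b (A : 'M[R]_(a, b)) : ImM (toC A) = 0.
Proof. by apply/matrixP => i j; rewrite !mxE. Qed.

Lemma ReM_D a b (A B : 'M[R[i]]_(a, b)) : ReM (A + B) = ReM A + ReM B.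
Proof. by apply/matrixP => i j; rewrite !mxE; case: (A i j); case: (B i j). Qed.

Lemma ImM_D a b (A B : 'M[R[i]]_(a, b)) : ImM (A + B) = ImM A + ImM B.
Proof. by apply/matrixP => i j; rewrite !mxE; case: (A i j); case: (B i j). Qed.

Lemma ReM_N a b (A : 'M[R[i]]_(a, b)) : ReM (- A) = - ReM A.
Proof. by apply/matrixP => i j; rewrite !mxE; case: (A i j). Qed.

Lemma ImM_N a b (A : 'M[R[i]]_(a, b)) : ImM (- A) = - ImM A.
Proof. by apply/matrixP => i j; rewrite !mxE; case: (A i j). Qed.

Lemma ReM_i a b (A : 'M[R[i]]_(a, b)) : ReM ('i%C *: A) = - ImM A.
Proof. by apply/matrixP => i j; rewrite !mxE; case: (A i j) => x y /=; rewrite mul0r mul1r sub0r. Qed.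

Lemma ImM_i a b (A : 'M[R[i]]_(a, b)) : ImM ('i%C *: A) = ReM A.
Proof. by apply/matrixP => i j; rewrite !mxE; case: (A i j) => x y /=; rewrite mul0r mul1r add0r. Qed.

Lemma ReIm a b (A : 'M[R[i]]_(a, b)) : A = toC (ReM A) + 'i%C *: toC (ImM A).
Proof.
apply/matrixP => i j; rewrite !mxE; case: (A i j) => x y /=.
by apply/eqP; rewrite eq_complex /= !mul0r !mul1r ?mulr0 ?subr0 ?addr0 ?add0r ?addr0 !eqxx.
Qed.

Lemma ReIm_inj a b (A B : 'M[R[i]]_(a, b)) : ReM A = ReM B -> ImM A = ImM B -> A = B.
Proof. by move=> r i; rewrite [A]ReIm [B]ReIm r i. Qed.

Lemma ReM_mul a b c (A : 'M[R[i]]_(a, b)) (B : 'M[R[i]]_(b, c)) :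
  ReM (A *m B) = ReM A *m ReM B - ImM A *m ImM B.
Proof.
rewrite {1}[A]ReIm {1}[B]ReIm !mulmxDl !mulmxDr -!scalemxAl -!scalemxAr -!toC_M.
by rewrite !ReM_D !ReM_i !ImM_i !ReM_toC !ImM_toC oppr0 add0r addr0.
Qed.

Lemma ImM_mul a b c (A : 'M[R[i]]_(a, b)) (B : 'M[R[i]]_(b, c)) :
  ImM (A *m B) = ReM A *m ImM B + ImM A *m ReM B.
Proof.
rewrite {1}[A]ReIm {1}[B]ReIm !mulmxDl !mulmxDr -!scalemxAl -!scalemxAr -!toC_M.
by rewrite !ImM_D !ImM_i !ReM_i !ReM_toC !ImM_toC oppr0 add0r addr0.
Qed.

Lemma ReM_mulr a b c (A : 'M[R[i]]_(a, b)) (B : 'M[R]_(b, c)) :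
  ReM (A *m toC B) = ReM A *m B.
Proof. by rewrite ReM_mul ReM_toC ImM_toC mulmx0 subr0. Qed.

Lemma ImM_mulr a b c (A : 'M[R[i]]_(a, b)) (B : 'M[R]_(b, c)) :
  ImM (A *m toC B) = ImM A *m B.
Proof. by rewrite ImM_mul ReM_toC ImM_toC mulmx0 add0r. Qed.

Lemma complexifyP d (W : set 'rV[R]_d) (v : 'rV[R[i]]_d) :
  complexify W v <-> W (ReM v) /\ W (ImM v).
Proof.
split=> [[u Wu [w Ww <-]]|[r i]]; last by exists (ReM v) => //; exists (ImM v) => //; rewrite -ReIm.
by rewrite ReM_D ImM_D ReM_i ImM_i !ReM_toC !ImM_toC oppr0 addr0 add0r.
Qed.

End Complex.

(** * Vector fields and their brackets in an arbitrary chart *)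

Section Fields.
Variables (R : realType) (d : nat) (M : manifold R d).
Implicit Types (c : chart R d M) (U V : set M) (q p : M).

Lemma diff_atE k (F : M -> 'rV[R]_k) p : diff_at F p = chart_diff F (chart_at p) p.
Proof. by rewrite /chart_diff jac.unlock. Qed.

Lemma diff_at_chart c p : diff_at c p = tr (chart_at p) c p.
Proof. by rewrite tr.unlock jac.unlock. Qed.

Lemma coord_frameE c p : coord_frame c p = tr c (chart_at p) p.
Proof. by rewrite tr.unlock jac.unlock. Qed.

(** The value [X q] refers to the frame of [chart_at q], which may jump with [q]; only these
    components in a fixed chart can be differentiated. Having [a] rows allows all the fundamental
    fields to be treated at once. *)
Definition coord a c (X : M -> 'M[R]_(a, d)) q := X q *m tr (chart_at q) c q.

Definition rsmooth a U (X : M -> 'M[R]_(a, d)) :=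
  forall c, smooth_chart c -> smoothF (U `&` cdom c) (coord c X).

Lemma coord_tr a c c' (X : M -> 'M[R]_(a, d)) q : smooth_chart c -> smooth_chart c' ->
  cdom c q -> cdom c' q -> coord c' X q = coord c X q *m tr c c' q.
Proof.
move=> sc sc' cq c'q; rewrite /coord -mulmxA -tr_comp //; first exact: smooth_chart_at.
exact: mem_chart_at.
Qed.

Lemma coord_at a (X : M -> 'M[R]_(a, d)) q : coord (chart_at q) X q = X q.
Proof. by rewrite /coord tr_id ?mulmx1 //; exact: mem_chart_at. Qed.

Lemma smoothF_pointwise a b U (F : M -> 'M[R]_(a, b)) :
  (forall p, U p -> exists V, [/\ open V, V p & smoothF V F]) -> smoothF U F.
Proof.
move=> H; apply: smoothF_local => p /H[V [oV Vp sF]].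
exists (chart_at p), V; split=> //.
- exact: smooth_chart_at.
- exact: mem_chart_at.
- exact/sF/smooth_chart_at.
Qed.

Lemma rsmooth_local a U (X : M -> 'M[R]_(a, d)) :
  (forall p, U p -> exists c V, [/\ smooth_chart c, cdom c p, open V, V p &
     smoothF V (coord c X)]) -> rsmooth U X.
Proof.
move=> H c sc; apply: smoothF_pointwise => p [Up cp].
have [c' [V [sc' c'p oV Vp sX]]] := H p Up.
pose V' := V `&` (cdom c `&` cdom c').
have oV' : open V' by apply: openI => //; apply: openI; exact: cdom_open.
exists V'; split; [exact: oV'|by []|].
apply: (smoothF_eq oV' (F := fun q => coord c' X q *m tr c' c q)).
  by move=> q [_ [cq c'q]]; rewrite -coord_tr.
apply: smoothF_mulmx => //; first by apply: smoothF_sub sX => q [].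
by apply: smoothF_sub (smoothF_tr sc' sc) => q [_ []].
Qed.

Lemma smooth_fieldP U (X : M -> 'rV[R[i]]_d) : open U ->
  smooth_field U X <-> rsmooth U (fun q => ReM (X q)) /\ rsmooth U (fun q => ImM (X q)).
Proof.
move=> oU.
have oUp p : open (U `&` cdom (chart_at p)) by apply: openI => //; exact: cdom_open.
have Ere p : (fun q => ReM (coordC (chart_at p) X q)) = coord (chart_at p) (fun q => ReM (X q)).
  by apply/funext => q; rewrite /coordC ReM_mulr diff_at_chart.
have Eim p : (fun q => ImM (coordC (chart_at p) X q)) = coord (chart_at p) (fun q => ImM (X q)).
  by apply/funext => q; rewrite /coordC ImM_mulr diff_at_chart.
split=> [H|[Hr Hi] p].
  split; apply: rsmooth_local => p Up; exists (chart_at p), (U `&` cdom (chart_at p));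
  (have mp := mem_chart_at p); split=> //; try exact: smooth_chart_at; have [h1 h2] := H p.
    by rewrite -Ere; apply/smooth_map_smoothF.
  by rewrite -Eim; apply/smooth_map_smoothF.
split; apply/smooth_map_smoothF => //.
  rewrite Ere; exact/Hr/smooth_chart_at.
rewrite Eim; exact/Hi/smooth_chart_at.
Qed.

Definition br c (X Y : M -> 'rV[R]_d) p : 'rV[R]_d :=
  coord c X p *m chart_diff (coord c Y) c p - coord c Y p *m chart_diff (coord c X) c p.

(** Changing charts adds to each half of the bracket a second derivative of the transition map along
    [X] and [Y]; the two contributions cancel by symmetry. *)
Lemma br_tr c c' U (X Y : M -> 'rV[R]_d) p : open U -> U p -> rsmooth U X -> rsmooth U Y ->
  smooth_chart c -> smooth_chart c' -> cdom c p -> cdom c' p ->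
  br c' X Y p = br c X Y p *m tr c c' p.
Proof.
move=> oU Up sX sY sc sc' cp c'p.
pose tau := c' \o cinv c; have E : tau (c p) = c' p by rewrite /tau /= cmapK.
pose O := c @` (U `&` cdom c' `&` cdom c).
have oO : open O by apply/open_chart_image/openI => //; exact: cdom_open.
have Op : O (c p) by exists p.
have stau k : Ck k O tau.
  by apply: Ck_sub (smooth_transitionP sc sc' k) => _ [q [[_ c'q] cq] <-]; exists q.
have dtau y : O y -> dble tau y by exact: Ck_dble (stau 1%N).
have dJ : dble (jac tau) (c p).
  exact: Ck_dble (Ck_jac oO (stau 2%N)) Op.
have dc e (Z : M -> 'rV[R]_d) : smooth_chart e -> cdom e p -> rsmooth U Z ->
    dble (coord e Z \o cinv e) (e p).
  move=> se ep sZ.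
  by apply: (Ck_dble (sZ e se e se 1%N)); exists p.
have trE q : cdom c q -> tr c c' q = jac tau (c q) by rewrite tr.unlock.
have key Z W : rsmooth U Z -> coord c' W p *m chart_diff (coord c' Z) c' p =
    coord c W p *m chart_diff (coord c Z) c p *m tr c c' p +
    dv (coord c W p) (dv (coord c Z p) tau) (c p).
  move=> sZ; have dcZ := dc _ Z sc cp sZ; have dc'Z := dc _ Z sc' c'p sZ.
  have nE : \forall y \near c p, ((coord c' Z \o cinv c') \o tau) y =
      (coord c Z \o cinv c) y *m jac tau y.
    have := near_chart cp (cdom_open c') c'p.
    apply: filterS => _ [q [c'q cq ->]]; rewrite /tau /= (cmapK cq) (cmapK c'q) -/tau.
    by rewrite -trE //; exact: coord_tr.
  have D1 : dv (coord c W p) ((coord c' Z \o cinv c') \o tau) (c p) =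
      coord c' W p *m chart_diff (coord c' Z) c' p.
    rewrite (dv_comp _ (dtau _ Op) E dc'Z) (dv_jac _ dc'Z) (dv_jac _ (dtau _ Op)).
    by rewrite (coord_tr W sc sc') // trE.
  have D2 : dv (coord c W p) (fun y => (coord c Z \o cinv c) y *m jac tau y) (c p) =
    coord c W p *m chart_diff (coord c Z) c p *m tr c c' p +
    dv (coord c W p) (dv (coord c Z p) tau) (c p).
    rewrite dv_mulmx // (dv_jac _ dcZ) trE //; congr (_ + _).
    rewrite {1}/comp cmapK // -dv_mulmxr //.
    apply: near_eq_dv; apply: filterS (open_nbhs_nbhs (conj oO Op)) => y Oy.
    by rewrite dv_jac //; exact: dtau.
  by rewrite -D1 -D2; exact: near_eq_dv nE.
rewrite /br (key Y X sY) (key X Y sX) mulmxBl.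
rewrite (dv_schwarz (coord c Y p) (coord c X p) oO Op (stau 2%N)).
by rewrite opprD addrACA subrr addr0.
Qed.

Lemma diffC_at_coord (Z : M -> 'rV[R[i]]_d) p :
  diffC_at (coordC (chart_at p) Z) p =
    toC (chart_diff (coord (chart_at p) (fun q => ReM (Z q))) (chart_at p) p) +
    'i%C *: toC (chart_diff (coord (chart_at p) (fun q => ImM (Z q))) (chart_at p) p).
Proof.
have Er : (fun q => ReM (coordC (chart_at p) Z q)) = coord (chart_at p) (fun q => ReM (Z q)).
  by apply/funext => q; rewrite /coordC ReM_mulr diff_at_chart.
have Ei : (fun q => ImM (coordC (chart_at p) Z q)) = coord (chart_at p) (fun q => ImM (Z q)).
  by apply/funext => q; rewrite /coordC ImM_mulr diff_at_chart.
by rewrite /diffC_at !diff_atE Er Ei.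
Qed.

Lemma ReM_lie_bracket (X Y : M -> 'rV[R[i]]_d) p :
  ReM (lie_bracket X Y p) =
    br (chart_at p) (fun q => ReM (X q)) (fun q => ReM (Y q)) p -
    br (chart_at p) (fun q => ImM (X q)) (fun q => ImM (Y q)) p.
Proof.
rewrite /lie_bracket !diffC_at_coord ReM_D ReM_N !ReM_mul !ReM_D !ImM_D !ReM_i !ImM_i !ReM_toC !ImM_toC.
rewrite !oppr0 !addr0 !add0r /br !coord_at.
set a := _ *m _; set b := _ *m _; set c := _ *m _; set d' := _ *m _.
by rewrite !opprB !addrA (addrAC a (- b)) (addrAC (a + d')) (addrAC a d').
Qed.

Lemma ImM_lie_bracket (X Y : M -> 'rV[R[i]]_d) p :
  ImM (lie_bracket X Y p) =
    br (chart_at p) (fun q => ReM (X q)) (fun q => ImM (Y q)) p +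
    br (chart_at p) (fun q => ImM (X q)) (fun q => ReM (Y q)) p.
Proof.
rewrite /lie_bracket !diffC_at_coord ImM_D ImM_N !ImM_mul !ReM_D !ImM_D !ReM_i !ImM_i !ReM_toC !ImM_toC.
rewrite !oppr0 !addr0 !add0r /br !coord_at.
set a := _ *m _; set b := _ *m _; set c := _ *m _; set d' := _ *m _.
by rewrite (addrC c) opprD addrACA.
Qed.

End Fields.

(** * Torus actions in charts *)

Section Torus.
Variables (R : realType) (d n : nat) (M : manifold R d) (rho : 'rV[R]_n -> M -> M).
Hypothesis act : torus_action rho.
Implicit Types (c : chart R d M) (p q : M) (h th : 'rV[R]_n) (x : 'rV[R]_d).

Lemma lsubmx_cvg (u : 'rV[R]_(n + d)) : {for u, continuous (@lsubmx R 1 n d)}.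
Proof. exact/differentiable_continuous/differentiable_lsubmx. Qed.

Lemma rsubmx_cvg (u : 'rV[R]_(n + d)) : {for u, continuous (@rsubmx R 1 n d)}.
Proof. exact/differentiable_continuous/differentiable_rsubmx. Qed.

(* rhoF is the action read in charts, as a function of (h, c(x)); rhoO is the
   part of its domain with x in A and rho h x in B. *)
Definition rhoO c (A B : set M) : set 'rV[R]_(n + d) :=
  [set u | (c @` (A `&` cdom c)) (rsubmx u) /\ B (rho (lsubmx u) (cinv c (rsubmx u)))].

Definition rhoF c c' (u : 'rV[R]_(n + d)) := c' (rho (lsubmx u) (cinv c (rsubmx u))).

Lemma rho_cont h p : {for (h, p), continuous (fun u : 'rV[R]_n * M => rho u.1 u.2)}.
Proof. exact: torus_act_continuous. Qed.

Lemma open_rhoO c A B : open A -> open B -> open (rhoO c A B).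
Proof.
move=> oA oB; rewrite openE => u [[p [Ap cp] E] Bp]; rewrite /interior.
have n1 : \forall v \near u, (c @` (A `&` cdom c)) (rsubmx v).
  have nA : nbhs (rsubmx u) (c @` (A `&` cdom c)).
    by rewrite -E; apply: open_nbhs_nbhs; split; [exact: open_chart_image|exists p].
  exact: (@rsubmx_cvg u _ nA).
have cc : {for u, continuous (fun v => (lsubmx v, cinv c (rsubmx v)))}.
  have cr : {for u, continuous (fun v => cinv c (rsubmx v))}.
    apply: continuous_comp; first exact: rsubmx_cvg.
    by rewrite -E; exact: cinv_continuous.
  exact: (cvg_pair (@lsubmx_cvg u) cr).
have n2 : \forall v \near u, B (rho (lsubmx v) (cinv c (rsubmx v))).
  have cg := continuous_comp cc (@rho_cont (lsubmx u) (cinv c (rsubmx u))).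
  exact: (cg _ (open_nbhs_nbhs (conj oB Bp))).
exact: filterI.
Qed.

(** The action is assumed smooth in preferred charts only; [g] changes the chart at the source, and
    a second transition changes it at the target. *)
Lemma rhoF_smooth c c' : smooth_chart c -> smooth_chart c' ->
  smooth_on (rhoO c setT (cdom c')) (rhoF c c').
Proof.
move=> sc sc'; apply: smooth_on_local => u [[p [_ cp] E] c'r].
have Ep : cinv c (rsubmx u) = p by rewrite -E cmapK.
pose b := chart_at p; have bp : cdom b p := mem_chart_at p.
pose q := rho (lsubmx u) p; pose b' := chart_at q; have b'q : cdom b' q := mem_chart_at q.
pose O := rhoO c (cdom b) (cdom c' `&` cdom b').
have oO : open O by apply: open_rhoO; [|apply: openI]; exact: cdom_open.
exists O; split=> // [|k].
  by split; [exists p|rewrite Ep in c'r *].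
pose g (v : 'rV[R]_(n + d)) := row_mx (lsubmx v) ((b \o cinv c) (rsubmx v)).
pose D := [set v : 'rV[R]_(n + d) | (b @` cdom b) (rsubmx v) /\
        cdom b' (rho (lsubmx v) (cinv b (rsubmx v)))].
have ED : D = rhoO b setT (cdom b') by rewrite /D /rhoO setTI.
have oD : open (rhoO b setT (cdom b')) by apply: open_rhoO; [exact: openT|exact: cdom_open].
pose D' := rhoO b (cdom c) (cdom c' `&` cdom b').
have oD' : open D' by apply: open_rhoO; [|apply: openI]; exact: cdom_open.
have Og v : O v -> D' (g v).
  move=> [[r [br cr] Er] [c'r' b'r']]; rewrite /D' /rhoO /= /g row_mxKl row_mxKr.
  by rewrite -Er /= cmapK // in c'r' b'r' *; rewrite cmapK //; split=> //; exists r.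
have cg : Ck k O g.
  have cl : Ck k O (fun v : 'rV[R]_(n + d) => lsubmx v).
    apply: Ck_mx => // i j.
    apply: (Ck_eq oO _ (Ck_entry i (lshift d j) oO (Ck_id k O))).
    by move=> v _; rewrite mxE.
  have cr : Ck k O (fun v : 'rV[R]_(n + d) => rsubmx v).
    apply: Ck_mx => // i j.
    apply: (Ck_eq oO _ (Ck_entry i (rshift n j) oO (Ck_id k O))).
    by move=> v _; rewrite mxE.
  apply: Ck_row_mx => //.
  apply: (Ck_comp (U' := c @` (cdom b `&` cdom c)) oO _ _ cr) => //.
  - by apply: open_chart_image; exact: cdom_open.
  - by move=> v [].
  - exact: smooth_transitionP sc (@smooth_chart_at _ _ _ p) k.
have cF : Ck k D' (rhoF b b').
  have := torus_act_smooth act p q k; rewrite -/D ED; apply: Ck_sub.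
  by move=> v [[r [cr br] Er] [_ b'r]]; split=> //; exists r.
have cT : Ck k (b' @` (cdom c' `&` cdom b')) (c' \o cinv b').
  exact: smooth_transitionP (@smooth_chart_at _ _ _ q) sc' k.
have oT : open (b' @` (cdom c' `&` cdom b')) by apply: open_chart_image; exact: cdom_open.
have c1 : Ck k O (rhoF b b' \o g) by exact: Ck_comp oO oD' Og cg cF.
have gT v : O v -> (b' @` (cdom c' `&` cdom b')) ((rhoF b b' \o g) v).
  move=> /Og [_ cb']; rewrite /rhoF /=; by exists (rho (lsubmx (g v)) (cinv b (rsubmx (g v)))).
apply: (Ck_eq oO _ (Ck_comp oO oT gT c1 cT)).
move=> v Ov; have [_ [_ b'g]] := Og v Ov; move: Ov => [[r [br cr] Er] _].
rewrite /rhoF /= (cmapK b'g) /g row_mxKl row_mxKr -Er /= !cmapK //.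
Qed.

Lemma open_rhoO' c c' : open (rhoO c setT (cdom c')).
Proof. by apply: open_rhoO; [exact: openT|exact: cdom_open]. Qed.

Lemma rhoF_dble c c' h p : smooth_chart c -> smooth_chart c' -> cdom c p ->
  cdom c' (rho h p) -> dble (rhoF c c') (row_mx h (c p)).
Proof.
move=> sc sc' cp c'p; apply: (Ck_dble (rhoF_smooth sc sc' 1%N)).
by rewrite /rhoO /= row_mxKl row_mxKr cmapK //; split=> //; exists p.
Qed.

(** The matrix of the infinitesimal action at [p]: its row space is the tangent space to the orbit,
    and its left kernel is the Lie algebra of the stabiliser. *)
Definition Nf p : 'M[R]_(n, d) := \matrix_j fundamental rho (delta_mx 0 j) p.

Lemma row_mx_line (h th : 'rV[R]_n) (x v : 'rV[R]_d) (t : R) :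
  row_mx h x + t *: row_mx th v = row_mx (h + t *: th) (x + t *: v).
Proof. by rewrite scale_row_mx add_row_mx. Qed.

Lemma rho_near0 c p th : cdom c p -> \forall t \near (0 : R), cdom c (rho (t *: th) p).
Proof.
move=> cp.
have cf : {for (0 : R), continuous (fun t : R => (t *: th, p))}.
  have cs : {for (0 : R), continuous (fun t : R => t *: th)} by exact: scalel_continuous.
  exact: (cvg_pair cs (cvg_cst p)).
have cg := continuous_comp cf (@rho_cont (0 *: th) p).
have c0 : cdom c (rho (0 *: th) p) by rewrite scale0r torus_act0.
exact: (cg _ (open_nbhs_nbhs (conj (cdom_open c) c0))).
Qed.

Lemma fundamental_dv p th :
  fundamental rho th p = dv (row_mx th 0) (rhoF (chart_at p) (chart_at p)) (row_mx 0 (chart_at p p)).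
Proof.
rewrite -[X in _ = dv _ _ X]addr0 -(scale0r (row_mx th 0)) -dv_line.
transitivity (dv (1 : R) (fun t : R => chart_at p (rho (t *: th) p)) 0).
  by rewrite /fundamental derive1E dv.unlock.
congr (dv _ _ _); apply/funext => t.
rewrite row_mx_line add0r scaler0 addr0 /rhoF row_mxKl row_mxKr cmapK //.
exact: mem_chart_at.
Qed.

Lemma fundamental_chart c p th : smooth_chart c -> cdom c p ->
  dv (row_mx th 0) (rhoF c c) (row_mx 0 (c p)) = fundamental rho th p *m tr (chart_at p) c p.
Proof.
move=> sc cp; pose b := chart_at p; have bp : cdom b p := mem_chart_at p.
have sb : smooth_chart b by exact: smooth_chart_at.
have r0 : rho 0 p = p by exact: torus_act0.
rewrite fundamental_dv -/b.
have -> : row_mx 0 (c p) = row_mx 0 (c p) + 0 *: row_mx th 0 :> 'rV[R]_(n + d).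
  by rewrite scale0r addr0.
have -> : row_mx 0 (b p) = row_mx 0 (b p) + 0 *: row_mx th 0 :> 'rV[R]_(n + d).
  by rewrite scale0r addr0.
rewrite -!dv_line.
pose g (t : R) := rhoF b b (row_mx 0 (b p) + t *: row_mx th 0).
have gE t : g t = b (rho (t *: th) p).
  by rewrite /g row_mx_line add0r scaler0 addr0 /rhoF row_mxKl row_mxKr cmapK.
have dg : dble g 0.
  by apply: dble_line; rewrite scale0r addr0; apply: rhoF_dble; rewrite ?r0.
have dT : dble (c \o cinv b) (b p) by exact: differentiable_transition.
have g0 : g 0 = b p by rewrite gE scale0r r0.
rewrite tr.unlock -(dv_jac _ dT) -(dv_comp _ dg g0 dT).
apply: near_eq_dv; apply: filterS2 (rho_near0 th cp) (rho_near0 th bp) => t ct bt.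
by rewrite /= gE row_mx_line add0r scaler0 addr0 /rhoF row_mxKl row_mxKr !cmapK.
Qed.

(** Linearity in [th] holds because the fundamental field is the differential of [rhoF] in the
    direction [(th, 0)]. *)
Lemma fundamental_Nf p th : fundamental rho th p = th *m Nf p.
Proof.
have df : dble (rhoF (chart_at p) (chart_at p)) (row_mx 0 (chart_at p p)).
  apply: rhoF_dble; rewrite ?torus_act0 //; try exact: smooth_chart_at; exact: mem_chart_at.
have E (f : 'rV[R]_(n + d) -> 'rV[R]_d) u : dble f u ->
    dv (row_mx th 0) f u = \sum_j th 0 j *: dv (row_mx (delta_mx 0 j) 0) f u.
  move=> dfu; rewrite !(dv_jac _ dfu).
  under eq_bigr do rewrite (dv_jac _ dfu) scalemxAl.
  rewrite -mulmx_suml; congr (_ *m _).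
  under eq_bigr do rewrite scale_row_mx scaler0.
  by rewrite {1}[th]row_sum_delta; elim/big_rec2: _ => [|j y1 y2 _ <-]; rewrite ?row_mx0 // add_row_mx addr0.
rewrite fundamental_dv E //; apply/rowP => k; rewrite summxE mxE.
by apply: eq_bigr => j _; rewrite !mxE fundamental_dv.
Qed.

Lemma coord_Nf c p th : smooth_chart c -> cdom c p ->
  th *m coord c Nf p = dv (row_mx th 0) (rhoF c c) (row_mx 0 (c p)).
Proof. by move=> sc cp; rewrite fundamental_chart // fundamental_Nf /coord mulmxA. Qed.

Lemma rsmooth_Nf : rsmooth setT Nf.
Proof.
apply: rsmooth_local => p _; exists (chart_at p), (cdom (chart_at p)).
have bp := mem_chart_at p; have sb : smooth_chart (chart_at p) by exact: smooth_chart_at.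
split=> //; first exact: cdom_open.
apply: smoothF_local => q bq; exists (chart_at p), (cdom (chart_at p)); split=> //.
  exact: cdom_open.
rewrite setIid; set b := chart_at p in bp bq sb *; move=> k.
have oB : open (b @` cdom b) by exact: cimage_open.
apply: Ck_mx => // i j.
have H : Ck k (b @` cdom b) (dv (row_mx (delta_mx 0 i) 0) (rhoF b b) \o (fun x => row_mx 0 x)).
  have cg : Ck k (b @` cdom b) (fun x => row_mx 0 x : 'rV[R]_(n + d)).
    by apply: Ck_row_mx => //; [exact: Ck_cst|exact: Ck_id].
  have gU x : (b @` cdom b) x -> rhoO b setT (cdom b) (row_mx 0 x).
    move=> [r br <-]; rewrite /rhoO /= row_mxKl row_mxKr cmapK // torus_act0 //.
    by split=> //; exists r.
  have H2 := Ck_dv (row_mx (delta_mx 0 i) 0) (rhoF_smooth sb sb k.+1).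
  exact: (Ck_comp oB (@open_rhoO' b b) gU cg H2).
apply: (Ck_eq oB _ (Ck_entry 0 j oB H)) => _ [r br <-].
by rewrite /= -coord_Nf // cmapK // -rowE mxE.
Qed.

End Torus.

(** * Mean value inequality *)

Section MeanValue.
Variable R : realType.

Lemma mx_norm_leP a b (A : 'M[R]_(a, b)) (C : R) : 0 <= C ->
  (forall i j, `|A i j| <= C) -> `|A| <= C.
Proof.
move=> C0 H; rewrite [leLHS]/Num.Def.normr/= mx_normrE (bigmax_le _ C0) //= => i _.
Qed.

Lemma mx_norm_ge a b (A : 'M[R]_(a, b)) i j : `|A i j| <= `|A|.
Proof.
rewrite [leRHS]/Num.Def.normr/= mx_normrE.
exact: (le_bigmax _ (fun ij : 'I_a * 'I_b => `|A ij.1 ij.2|) (i, j)).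
Qed.

(** The norm is the maximum of the absolute values of the entries, so the scalar theorem applied to
    each entry loses no constant. *)
Lemma mean_value_inequality (V : normedModType R) a b (f : V -> 'M[R]_(a, b)) x u (C : R) :
  (forall s : R, 0 <= s <= 1 -> dble f (x + s *: u) /\ `|dv u f (x + s *: u)| <= C) ->
  `|f (x + u) - f x| <= C.
Proof.
move=> H; have C0 : 0 <= C.
  by have [|_] := H 0; [rewrite lexx ler01|apply: le_trans].
apply: mx_norm_leP => // i j; rewrite !mxE.
have [|s sI] := @MVT_line R V (fun y => f y i j) x u 1 ltr01.
  by move=> s /H[+ _]; rewrite dble.unlock => /differentiable_entry; apply.
rewrite scale1r mulr1 => ->.
have [ds] : dble f (x + s *: u) /\ `|dv u f (x + s *: u)| <= C.
  by apply: H; case/andP: sI => *; rewrite !ltW.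
apply: le_trans; move: ds; rewrite dble.unlock dv.unlock => ds.
by rewrite -derive_entry //; exact: mx_norm_ge.
Qed.

Lemma dv0_const (V : normedModType R) a b (f : V -> 'M[R]_(a, b)) x u :
  (forall s : R, 0 <= s <= 1 -> dble f (x + s *: u) /\ dv u f (x + s *: u) = 0) ->
  f (x + u) = f x.
Proof.
move=> H; apply/eqP; rewrite -subr_eq0 -normr_le0; apply: mean_value_inequality => s /H[df ->].
by rewrite normr0.
Qed.

End MeanValue.

(** * Differential calculus of the action in one chart *)

Section Flow.
Variables (R : realType) (d n : nat) (M : manifold R d) (rho : 'rV[R]_n -> M -> M).
Hypothesis act : torus_action rho.
Variable c : chart R d M.
Hypothesis sc : smooth_chart c.
Implicit Types (p q : M) (h th : 'rV[R]_n) (x v w : 'rV[R]_d).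

Local Notation F := (rhoF rho c c).
Local Notation O := (rhoO rho c setT (cdom c)).
Local Notation N := (coord c (Nf rho)).

Lemma rhoO_in h p : cdom c p -> cdom c (rho h p) -> O (row_mx h (c p)).
Proof. by move=> cp cr; rewrite /rhoO /= row_mxKl row_mxKr cmapK //; split=> //; exists p. Qed.

Lemma rhoO_elim u : O u -> exists h q, [/\ cdom c q, cdom c (rho h q) & u = row_mx h (c q)].
Proof.
move=> [[q [_ cq] E] cr]; exists (lsubmx u), q.
by split=> //; [move: cr; rewrite -E cmapK|rewrite E hsubmxK].
Qed.

Lemma rhoFE h p : cdom c p -> F (row_mx h (c p)) = c (rho h p).
Proof. by move=> cp; rewrite /rhoF row_mxKl row_mxKr cmapK. Qed.

Lemma dble_N p th : cdom c p -> dble (fun x => th *m N (cinv c x)) (c p).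
Proof.
move=> cp; apply: dble_mulmxr; apply: (Ck_dble (rsmooth_Nf act sc sc 1%N)).
by exists p.
Qed.

(** Moving [h] along [th] is the same as applying the flow of [th] after [rho h]. *)
Lemma dv_rhoF_act h p th : cdom c p -> cdom c (rho h p) ->
  dv (row_mx th 0) F (row_mx h (c p)) = th *m N (rho h p).
Proof.
move=> cp cr; rewrite (coord_Nf act) //.
rewrite -[X in dv _ _ X = _]addr0 -[X in _ = dv _ _ X]addr0 -(scale0r (row_mx th 0)) -!dv_line.
congr (dv _ _ _); apply/funext => t.
rewrite !row_mx_line scaler0 !addr0 add0r !rhoFE //.
by rewrite addrC (torus_actD act).
Qed.

Lemma dv_rhoF_snd h x v : dv (row_mx 0 v) F (row_mx h x) = dv v (fun y => F (row_mx h y)) x.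
Proof.
have E1 := dv_line F (row_mx h x) (row_mx 0 v) 0.
have E2 := dv_line (fun y => F (row_mx h y)) x v 0.
rewrite scale0r addr0 in E1; rewrite scale0r addr0 in E2; rewrite -E1 -E2.
by congr (dv _ _ _); apply/funext => t; rewrite row_mx_line scaler0 addr0.
Qed.

Lemma dble_rhoF h p : cdom c p -> cdom c (rho h p) -> dble F (row_mx h (c p)).
Proof. by move=> cp cr; exact: rhoF_dble. Qed.

(** The group is commutative, so [rho h] maps the orbit curve of [th] through [p] to the one through
    [rho h p]: fundamental fields are invariant under the action. *)
Lemma dv_rhoF_fund h p th : cdom c p -> cdom c (rho h p) ->
  dv (row_mx 0 (th *m N p)) F (row_mx h (c p)) = th *m N (rho h p).
Proof.
move=> cp cr; rewrite dv_rhoF_snd.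
have dG : dble (fun y => F (row_mx h y)) (c p).
  have dr : dble (fun y => row_mx h y : 'rV[R]_(n + d)) (c p).
    by apply: (Ck_dble (k := 0) (U := setT)) => //; apply: Ck_row_mx;
      [exact: openT|exact: Ck_cst|exact: Ck_id].
  by apply: (dble_comp dr (erefl _)); exact: dble_rhoF.
have r0 : rho 0 p = p by exact: torus_act0.
pose g (t : R) := F (row_mx 0 (c p) + t *: row_mx th 0).
have gE t : g t = c (rho (t *: th) p).
  by rewrite /g row_mx_line add0r scaler0 addr0 rhoFE.
have dg : dble g 0 by apply: dble_line; rewrite scale0r addr0; apply: dble_rhoF; rewrite ?r0.
have g0 : g 0 = c p by rewrite gE scale0r r0.
rewrite (coord_Nf act th sc cp).
have -> : dv (row_mx th 0) F (row_mx 0 (c p)) = dv (1 : R) g 0.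
  by rewrite dv_line scale0r addr0.
rewrite -(dv_comp _ dg g0 dG) -dv_rhoF_act //.
rewrite -[X in _ = dv _ _ X]addr0 -(scale0r (row_mx th 0)) -dv_line.
apply: near_eq_dv; apply: filterS (rho_near0 act th cp) => t ct.
rewrite /= gE row_mx_line scaler0 addr0 !rhoFE //.
by rewrite (torus_actD act).
Qed.

(** The variational equation of the flow, obtained by exchanging the derivatives in time and in
    space. *)
Lemma dv_rhoF_mixed h p th v : cdom c p -> cdom c (rho h p) ->
  dv (row_mx th 0) (dv (row_mx 0 v) F) (row_mx h (c p)) =
  dv (dv (row_mx 0 v) F (row_mx h (c p))) (fun x => th *m N (cinv c x)) (c (rho h p)).
Proof.
move=> cp cr; have oO : open O by exact: open_rhoO'.
have Oh := rhoO_in cp cr.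
rewrite (dv_schwarz _ _ oO Oh (rhoF_smooth act sc sc 2%N)).
rewrite -(dv_comp _ (dble_rhoF cp cr) (rhoFE h cp) (dble_N th cr)).
apply: near_eq_dv; apply: filterS (open_nbhs_nbhs (conj oO Oh)) => _ /rhoO_elim[h' [q [cq cu ->]]].
by rewrite dv_rhoF_act //= rhoFE // cmapK.
Qed.

Lemma dv_rhoF0 p v : cdom c p -> dv (row_mx 0 v) F (row_mx 0 (c p)) = v.
Proof.
move=> cp; have r0 : rho 0 p = p by exact: torus_act0.
rewrite dv_rhoF_snd.
rewrite -[RHS](dv_id (c p)); apply: near_eq_dv.
apply: filterS (near_chart cp (cdom_open c) cp) => _ [q [_ cq ->]].
by rewrite rhoFE // torus_act0.
Qed.

(** The brackets vanish: the two sides are the mixed second derivatives of [rhoF] in the group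
    directions [th] and [th'] at the identity. *)
Lemma fundamental_commute p th th' : cdom c p ->
  dv (th *m N p) (fun x => th' *m N (cinv c x)) (c p) =
  dv (th' *m N p) (fun x => th *m N (cinv c x)) (c p).
Proof.
move=> cp; have r0 : rho 0 p = p by exact: torus_act0.
have cr : cdom c (rho 0 p) by rewrite r0.
have oO : open O by exact: open_rhoO'.
have Oh := rhoO_in cp cr.
have key t t' : dv (row_mx t 0) (dv (row_mx t' 0) F) (row_mx 0 (c p)) =
    dv (t *m N p) (fun x => t' *m N (cinv c x)) (c p).
  transitivity (dv (row_mx t 0) ((fun x => t' *m N (cinv c x)) \o F) (row_mx 0 (c p))).
    apply: near_eq_dv; apply: filterS (open_nbhs_nbhs (conj oO Oh)) => _ /rhoO_elim[h' [q [cq cu ->]]].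
    by rewrite dv_rhoF_act //= rhoFE // cmapK.
  have dN := dble_N t' cp.
  rewrite (dv_comp _ (dble_rhoF cp cr) _ dN); last by rewrite rhoFE // r0.
  by rewrite dv_rhoF_act // r0.
by rewrite -!key (dv_schwarz _ _ oO Oh (rhoF_smooth act sc sc 2%N)).
Qed.

(** Links derivatives of [rhoF] to [tangent_map], through which the invariance of omega and J is
    stated. *)
Lemma dv_rhoF_tangent h p v : cdom c p -> cdom c (rho h p) ->
  dv (row_mx 0 v) F (row_mx h (c p)) =
  v *m tr c (chart_at p) p *m tangent_map (rho h) p *m tr (chart_at (rho h p)) c (rho h p).
Proof.
move=> cp cr; rewrite dv_rhoF_snd.
set r := rho h p; pose b := chart_at p; pose b' := chart_at r.
have bp : cdom b p := mem_chart_at p; have b'r : cdom b' r := mem_chart_at r.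
have sb : smooth_chart b by exact: smooth_chart_at.
have sb' : smooth_chart b' by exact: smooth_chart_at.
pose G y := rhoF rho b b' (row_mx h y).
have drow e x : dble e (row_mx h x) -> dble (fun y => e (row_mx h y : 'rV[R]_(n + d)) : 'rV[R]_d) x.
  move=> de.
  have dr : dble (fun y => row_mx h y : 'rV[R]_(n + d)) x.
    by apply: (Ck_dble (k := 0) (U := setT)) => //; apply: Ck_row_mx;
      [exact: openT|exact: Ck_cst|exact: Ck_id].
  by apply: (dble_comp dr (erefl _)).
have dG : dble G (b p) by apply: drow; apply: rhoF_dble.
have Gp : G (b p) = b' r by rewrite /G /rhoF row_mxKl row_mxKr cmapK.
have GE : jac G (b p) = tangent_map (rho h) p.
  rewrite /tangent_map /diff_at jac.unlock; congr ('J _ (b p)).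
  by apply/funext => y; rewrite /G /rhoF row_mxKl row_mxKr.
have dT1 := differentiable_transition sc sb cp bp.
have dT2 := differentiable_transition sb' sc b'r cr.
have dFh : dble (fun y => F (row_mx h y)) (c p) by apply: drow; exact: dble_rhoF.
have E1 : (b \o cinv c) (c p) = b p by rewrite /= cmapK.
have dG1 := dble_comp dT1 E1 dG.
have E2 : (G \o (b \o cinv c)) (c p) = b' r by rewrite /= cmapK.
rewrite dv_jac //.
rewrite (jac_comp (g := G \o (b \o cinv c)) (f := c \o cinv b') (y := b' r)) //; last first.
  have nO : \forall x \near c p, O (row_mx h x) /\ (rhoO rho c (cdom b) (cdom b') (row_mx h x)).
    have oO : open (O `&` rhoO rho c (cdom b) (cdom b')).
      by apply: openI; [exact: open_rhoO'|exact: (open_rhoO act (cdom_open b) (cdom_open b'))].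
    have crow : {for (c p), continuous (fun y => row_mx h y : 'rV[R]_(n + d))}.
      apply: (Ck_continuous (k := 0) (U := setT)) => //; apply: Ck_row_mx;
      [exact: openT|exact: Ck_cst|exact: Ck_id].
    apply: (crow (O `&` rhoO rho c (cdom b) (cdom b'))); apply: open_nbhs_nbhs; split=> //.
    split; first exact: rhoO_in.
    by rewrite /rhoO /= row_mxKl row_mxKr cmapK //; split=> //; exists p.
  apply: filterS nO => x [_ [[q [bq cq] E]]].
  rewrite row_mxKr in E; rewrite row_mxKl row_mxKr -E cmapK // => b'q.
  by rewrite /= /G /rhoF !row_mxKl !row_mxKr !cmapK.
have E3 : jac (G \o (b \o cinv c)) (c p) = jac (b \o cinv c) (c p) *m jac G (b p).
  by apply: (jac_comp dT1 E1 dG); near=> x.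
rewrite E3.
by rewrite GE tr.unlock !mulmxA.
Unshelve. all: by end_near. Qed.

(** Takes the place of uniqueness for differential equations: the velocity of the orbit curve at
    time [s] is the image, under the differential of [rho (s *: th)], of the velocity at time 0,
    hence zero. *)
Lemma fundamental0_fix p th : cdom c p -> th *m N p = 0 -> forall t : R, rho (t *: th) p = p.
Proof.
move=> cp th0.
have /nbhs_ballP[e /= e0 He] := rho_near0 act th cp.
have He' t : `|t| < e -> cdom c (rho (t *: th) p).
  by move=> te; apply: He; rewrite /ball /= sub0r normrN.
have small t : `|t| < e -> rho (t *: th) p = p.
  move=> te; have r0 : rho 0 p = p by exact: torus_act0.
  have ct := He' _ te; rewrite -(cmapK ct) -[RHS](cmapK cp); congr (cinv c _).
  pose g (s : R) := F (row_mx 0 (c p) + s *: row_mx th 0).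
  have gE s : g s = c (rho (s *: th) p).
    by rewrite /g row_mx_line add0r scaler0 addr0 rhoFE.
  rewrite -gE -[in RHS]r0 -(scale0r th) -gE -[t]add0r.
  apply: dv0_const => s /andP[s0 s1].
  have cst : cdom c (rho ((0 + s *: t) *: th) p).
    apply: He'; rewrite add0r normrM; apply: le_lt_trans te.
    by rewrite ger0_norm // ler_piMl.
  have dF : dble F (row_mx 0 (c p) + (0 + s *: t) *: row_mx th 0).
    rewrite row_mx_line add0r scaler0 addr0; exact: dble_rhoF.
  split; first exact: dble_line.
  have dg : dble g (0 + s *: t) by exact: dble_line.
  rewrite -[t in dv t]mulr1 -[t * 1]/(t *: (1 : R)) dv_dirZ // dv_line.
  have E := dv_rhoF_fund th cp cst; rewrite th0 row_mx0 dv_dir0 in E.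
  rewrite row_mx_line add0r scaler0 addr0.
  by rewrite (dv_rhoF_act th cp cst) -E scaler0.
(* The chart controls the orbit for short times only; the group law extends the result to all
   multiples, hence to every [t = k.+1 * (t / k.+1)]. *)
have iterk k s : `|s| < e -> rho ((k%:R * s) *: th) p = p.
  move=> se; elim: k => [|k IH]; first by rewrite mul0r scale0r torus_act0.
  by rewrite -natr1 mulrDl mul1r scalerDl (torus_actD act) small.
move=> t; have [k kt] : exists k : nat, `|t| < k.+1%:R * e.
  exists (Num.bound (`|t| / e)); rewrite -ltr_pdivrMr //.
  have : 0 <= `|t| / e by rewrite divr_ge0 // ltW.
  by move=> /archi_boundP/lt_trans; apply; rewrite ltr_nat.
have := iterk k.+1 (t / k.+1%:R).
rewrite (mulrC k.+1%:R) divfK ?pnatr_eq0 //; apply.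
by rewrite normrM normfV (ger0_norm (ler0n R k.+1)) ltr_pdivrMr ?ltr0n // mulrC.
Qed.

Lemma fix_fundamental0 p th : cdom c p -> (forall t : R, rho (t *: th) p = p) -> th *m N p = 0.
Proof.
move=> cp fx; have r0 : rho 0 p = p by exact: torus_act0.
rewrite (coord_Nf act) // -[X in dv _ _ X]addr0 -(scale0r (row_mx th 0)) -dv_line.
rewrite -[RHS](dv_cst (c p) (0 : R) (1 : R)); congr (dv _ _ _); apply/funext => t.
by rewrite row_mx_line add0r scaler0 addr0 rhoFE // fx.
Qed.

End Flow.

(** * Fundamental fields with zero 1-jet *)

Section Rigidity.
Variables (R : realType) (d n : nat) (M : manifold R d) (rho : 'rV[R]_n -> M -> M).
Hypothesis act : torus_action rho.
Variable c : chart R d M.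
Hypothesis sc : smooth_chart c.
Implicit Types (p q : M) (h th : 'rV[R]_n) (x v w : 'rV[R]_d).

Local Notation F := (rhoF rho c c).
Local Notation O := (rhoO rho c setT (cdom c)).
Local Notation N := (coord c (Nf rho)).

(** The first [n] rows of the Jacobian concern the group variable; those kept here form the
    differential of [rho h] in the chart. *)
Definition fderiv (u : 'rV[R]_(n + d)) : 'M[R]_d := dsubmx (jac F u).

Lemma fderivE u v : O u -> dv (row_mx 0 v) F u = v *m fderiv u.
Proof.
move=> Ou; have dF : dble F u by exact: Ck_dble (rhoF_smooth act sc sc 1%N) Ou.
by rewrite dv_jac // -[jac F u in LHS]vsubmxK mul_row_col mul0mx add0r.
Qed.

Lemma fderiv_continuous u : O u -> {for u, continuous fderiv}.
Proof.
move=> Ou; have oO : open O by exact: open_rhoO'.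
have cJ := Ck_jac oO (rhoF_smooth act sc sc 1%N).
have cE : Ck 0 O fderiv.
  apply: Ck_mx => // i j.
  apply: (Ck_eq oO _ (Ck_entry (rshift n i) j oO cJ)) => y _.
  by rewrite /fderiv mxE.
exact: (Ck_continuous cE).
Qed.

(** A compact set that meets every class of R^n modulo Z^n; it stands for the torus. *)
Definition unit_cube : set 'rV[R]_n := [set h | forall i, `[0%R, 1%R]%classic (h ord0 i)].

Lemma compact_unit_cube : compact unit_cube.
Proof.
apply: (@rV_compact R n (fun=> `[0%R, 1%R]%classic)) => i.
exact: segment_compact.
Qed.

Lemma rho_unit_cube h : exists h', unit_cube h' /\ forall q, rho h q = rho h' q.
Proof.
pose z : 'rV[int]_n := \row_i Num.floor (h 0 i).
exists (h - map_mx intr z); split=> [i|q].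
  rewrite !mxE ord1 /= in_itv /=; have := floor_itv (h 0 i).
  rewrite subr_ge0 intrD => /andP[-> /ltW hf] /=.
  by rewrite lerBlDl.
transitivity (rho (h - map_mx intr z + map_mx intr z) q); first by rewrite subrK.
by rewrite (torus_actD act) (torus_act_int act).
Qed.

Lemma norm_mulmx a b e (A : 'M[R]_(a, b)) (B : 'M[R]_(b, e)) : `|A *m B| <= b%:R * (`|A| * `|B|).
Proof.
apply: mx_norm_leP => [|i j]; first by rewrite !mulr_ge0.
rewrite mxE; apply: le_trans (ler_norm_sum _ _ _) _.
rewrite -[b in b%:R]card_ord -sum1_card natr_sum mulr_suml; apply: ler_sum => k _.
by rewrite mul1r normrM ler_pM // mx_norm_ge.
Qed.

(** At [p], the map [rho h] has the same 1-jet as the identity. *)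
Definition stationary p h := rho h p = p /\ fderiv (row_mx h (c p)) = 1%:M.

(** A tube argument over the compact cube: continuity of [fderiv] gives a neighbourhood of [c p] for
    each [h0], and finitely many suffice. Periodicity then covers all [h]. *)
Lemma stationary_tube p (e : R) : cdom c p -> 0 < e ->
  \forall x \near c p, forall h, stationary p h ->
    (c @` cdom c) x /\ O (row_mx h x) /\ `|fderiv (row_mx h x) - 1%:M| <= e.
Proof.
move=> cp e0.
pose P x h := stationary p h ->
  [/\ (c @` cdom c) x , O (row_mx h x) & `|fderiv (row_mx h x) - 1%:M| <= e].
have crow (h : 'rV[R]_n) x : {for (h, x), continuous (fun u : 'rV[R]_n * 'rV[R]_d => row_mx u.1 u.2)}.
  move=> B /nbhs_ballP[r /= r0 Br]; apply/nbhs_ballP; exists r => //= -[h' x'] [bh bx].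
  apply: Br; split=> // i j; rewrite -(splitK j); case: (fintype.split j) => k /=.
    by rewrite !row_mxEl; exact: (bh.2 i k).
  by rewrite !row_mxEr; exact: (bx.2 i k).
have cov : \forall x \near c p, unit_cube `<=` P x.
  have NC := (compact_near_coveringP _).1 compact_unit_cube.
  apply: (NC _ (nbhs (c p)) P) => h0 _.
  (* If [h0] is not stationary, no [h] close to it is: the condition [rho h p <> p] is open since M
     is Hausdorff, and so is having a differential other than 1. The claim is then void near
     [h0]. *)
  have [[r0 f1]|nst] := pselect (stationary p h0); last first.
    have [r0|r0] := pselect (rho h0 p = p); last first.
      have ch : {for h0, continuous (fun h => rho h p)}.
        have ci : {for h0, continuous (fun h => h)} by exact: cvg_id.
        have cpair : {for h0, continuous (fun h => (h, p))} by exact: (cvg_pair ci (cvg_cst p)).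
        exact: (continuous_comp cpair (@rho_cont _ _ _ _ _ act h0 p)).
      have op : open (~` [set p]).
        by apply: closed_openC; apply/accessible_closed_set1/hausdorff_accessible/manifold_hausdorff.
      have nr : nbhs (rho h0 p) (~` [set p]) by exact: open_nbhs_nbhs.
      exists (fun h => rho h p <> p, setT) => /=; first by split; [exact: (ch _ nr)|exact: filterT].
      by move=> [h x] /= [nrh _] [/nrh].
    have f1 : 0 < `|fderiv (row_mx h0 (c p)) - 1%:M|.
      by rewrite normr_gt0 subr_eq0; apply/eqP => f1; exact: nst.
    have Oh : O (row_mx h0 (c p)) by apply: rhoO_in; rewrite ?r0.
    have nf : \forall u \near row_mx h0 (c p), `|fderiv (row_mx h0 (c p)) - fderiv u| <
        `|fderiv (row_mx h0 (c p)) - 1%:M|.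
      exact: ((cvgrPdist_lt _ _).1 (fderiv_continuous Oh) _ f1).
    have [[A B] /= [hA hB] sub] := crow h0 (c p) _ nf.
    exists (A, setT) => /=; first by split; [exact: hA|exact: filterT].
    move=> [h x] /= [Ah _] [_ fh].
    have := sub (h, c p) (conj Ah (nbhs_singleton hB)).
    by rewrite /= fh ltxx.
  have Oh : O (row_mx h0 (c p)) by apply: rhoO_in; rewrite ?r0.
  have nO : \forall u \near row_mx h0 (c p), O u /\ `|fderiv u - 1%:M| <= e.
    have oO : open O by exact: open_rhoO'.
    have n1 := open_nbhs_nbhs (conj oO Oh).
    have n2 : \forall u \near row_mx h0 (c p), `|fderiv (row_mx h0 (c p)) - fderiv u| <= e.
      exact: ((cvgrPdist_le _ _).1 (fderiv_continuous Oh) _ e0).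
    rewrite f1 in n2; by apply: filterS2 n1 n2 => u Ou; rewrite distrC.
  have [[A B] /= [hA hB] sub] := crow h0 (c p) _ nO.
  exists (A, B) => [|[h x] /= AB _]; first by split.
  have /= [Ohx fx] := sub (h, x) AB; split=> //.
  by move: Ohx => [[q [_ cq] E] _]; rewrite row_mxKr in E; exists q.
apply: filterS cov => x Px h st.
(* [h] and its representative in the cube act by the same map, so they share [rhoF], its domain and
   its space derivative. *)
have [h' [Kh' E]] := rho_unit_cube h.
have FE y : F (row_mx h y) = F (row_mx h' y) by rewrite /rhoF !row_mxKl !row_mxKr E.
have OE y : O (row_mx h y) <-> O (row_mx h' y) by rewrite /rhoO /= !row_mxKl !row_mxKr E.
have fE y : O (row_mx h y) -> fderiv (row_mx h y) = fderiv (row_mx h' y).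
  move=> Oy; apply/row_matrixP => i; rewrite !rowE -!fderivE //; last exact/OE.
  by rewrite !dv_rhoF_snd //; congr (dv _ _ _); apply/funext => z.
have st' : stationary p h'.
  have [r f] := st; split; first by rewrite -E.
  by rewrite -fE //; apply: rhoO_in; rewrite ?r.
have [px Ox fx] := Px _ Kh' st'; split=> //.
by have Ohx := (OE x).2 Ox; split=> //; rewrite fE.
Qed.

(* The flow of k N fixes p with differential 1 there, hence by compactness stays
   C^1-close to the identity on one neighbourhood of p for all times and all
   such k; iterating it then shows that it is the identity there. *)
Lemma fundamental_rigid p : cdom c p -> exists V, [/\ open V, V p, V `<=` cdom c &
  forall k : 'rV[R]_n, k *m N p = 0 ->
   (forall v, dv v (fun x => k *m N (cinv c x)) (c p) = 0) ->
   forall q, V q -> k *m N q = 0].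
Proof.
move=> cp.
(* Multiplying a row by a matrix costs a factor [d] in this norm; the tolerance makes the space
   derivative of the displacement at most 1/2, and the successor keeps it positive if [d = 0]. *)
have d0 : 0 < (2 * d.+1%:R)^-1 :> R by rewrite invr_gt0 mulr_gt0 ?ltr0n.
have /nbhs_ballP[r /= r0 Br] := stationary_tube cp d0.
(* Half the radius leaves room for a displacement of at most [r / 4], so images under the flow stay
   in the ball where the estimates hold. *)
pose V := cdom c `&` c @^-1` ball (c p) (r / 2).
exists V.
have oV : open V.
  rewrite openE => q [cq bq]; apply: filterI.
    exact: (open_nbhs_nbhs (conj (cdom_open c) cq)).
  by apply: (cmap_continuous cq); apply: open_nbhs_nbhs; split=> //; exact: ball_open.
split=> //.
- by split=> //; apply: ballxx; rewrite divr_gt0.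
- by move=> q [].
move=> k k0 dk q [cq bq].
have fixp := fundamental0_fix act sc cp k0.
have cfix t : cdom c (rho (t *: k) p) by rewrite fixp.
(* By the variational equation, the differential of the flow at the fixed point [p] has derivative
   zero in time, because [k N] has zero 1-jet there. *)
have st t : stationary p (t *: k).
  split=> //; apply/row_matrixP => i; rewrite !rowE -fderivE; last exact: rhoO_in.
  rewrite mulmx1; set v := delta_mx 0 i.
  pose g (s : R) := dv (row_mx 0 v) F (row_mx 0 (c p) + s *: row_mx k 0).
  have gE s : g s = dv (row_mx 0 v) F (row_mx (s *: k) (c p)).
    by rewrite /g row_mx_line add0r scaler0 addr0.
  rewrite -gE -[t]add0r.
  rewrite (_ : g (0 + t) = g 0); first by rewrite gE scale0r dv_rhoF0.
  have dd s : dble (dv (row_mx 0 v) F) (row_mx 0 (c p) + s *: row_mx k 0).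
    rewrite row_mx_line add0r scaler0 addr0.
    by apply: (Ck_dble (Ck_dv _ (rhoF_smooth act sc sc 2%N))); exact: rhoO_in.
  apply: dv0_const => s _; split; first exact/dble_line/dd.
  rewrite -[t in dv t]mulr1 -[t * 1]/(t *: (1 : R)) dv_dirZ; last exact/dble_line/dd.
  rewrite dv_line row_mx_line !add0r scaler0 addr0.
  have := dv_rhoF_mixed act sc k v cp (cfix (s *: t)).
  by rewrite fixp dk => ->; rewrite scaler0.
have tube t x : ball (c p) r x ->
   O (row_mx (t *: k) x) /\ forall v, `|dv v (fun y => F (row_mx (t *: k) y) - y) x| <= `|v| / 2.
  move=> /Br/(_ _ (st t))[_ [Ox fx]]; split=> // v.
  have dF : dble F (row_mx (t *: k) x) by exact: Ck_dble (rhoF_smooth act sc sc 1%N) Ox.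
  have dr : dble (fun y => row_mx (t *: k) y : 'rV[R]_(n + d)) x.
    by apply: (Ck_dble (k := 0) (U := setT)) => //; apply: Ck_row_mx;
      [exact: openT|exact: Ck_cst|exact: Ck_id].
  have dFr : dble (fun y => F (row_mx (t *: k) y)) x by exact: (dble_comp dr (erefl _) dF).
  rewrite dvB //; last exact: dble_id.
  rewrite dv_id -dv_rhoF_snd fderivE // (_ : _ - v = v *m (fderiv (row_mx (t *: k) x) - 1%:M)); last first.
    by rewrite mulmxBr mulmx1.
  apply: le_trans (norm_mulmx _ _) _; rewrite mulrCA ler_wpM2l //.
  apply: le_trans (ler_wpM2l (ler0n R d) fx) _.
  rewrite invfM mulrCA ler_piMr ?invr_ge0 // ler_pdivrMr ?ltr0n // mul1r ler_nat.
  exact: leqnSn.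
pose G t y := F (row_mx (t *: k) y).
(* The displacement [G t - id] has Lipschitz constant 1/2 on the ball, uniformly in the time [t]. *)
have contr t x y : ball (c p) r x -> ball (c p) r y ->
    `|(G t y - y) - (G t x - x)| <= `|y - x| / 2.
  move=> bx by_; rewrite -{1 2}(subrK x y) (addrC _ x).
  apply: (@mean_value_inequality _ _ _ _ (fun y => G t y - y)) => s /andP[s0 s1].
  have bs : ball (c p) r (x + s *: (y - x)).
    move: bx by_; rewrite -!ball_normE /= => bx by_.
    pose m := Num.max `|c p - x| `|c p - y|.
    have mr : m < r by rewrite /m gt_max bx by_.
    rewrite (_ : _ - _ = (1 - s) *: (c p - x) + s *: (c p - y)); last first.
      by apply/rowP => i; rewrite !mxE; ring.
    apply: le_lt_trans (ler_normD _ _) _; rewrite !normrZ ger0_norm ?subr_ge0 // ger0_norm //.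
    apply: le_lt_trans mr; rewrite (_ : m = (1 - s) * m + s * m); last first.
      by rewrite -mulrDl subrK mul1r.
    by apply: lerD; rewrite ler_wpM2l ?subr_ge0 // /m le_max lexx ?orbT.
  have [Os +] := tube t _ bs; split; last by [].
  apply: dbleB; last exact: dble_id.
  have dF : dble F (row_mx (t *: k) (x + s *: (y - x))) by exact: Ck_dble (rhoF_smooth act sc sc 1%N) Os.
  have dr : dble (fun y => row_mx (t *: k) y : 'rV[R]_(n + d)) (x + s *: (y - x)).
    by apply: (Ck_dble (k := 0) (U := setT)) => //; apply: Ck_row_mx;
      [exact: openT|exact: Ck_cst|exact: Ck_id].
  exact: (dble_comp dr (erefl _) dF).
have bp : ball (c p) r (c p) by exact: ballxx.
have Gp t : G t (c p) = c p by rewrite /G rhoFE // fixp.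
have r20 : r / 2 < r by rewrite ltr_pdivrMr // ltr_pMr // ltr1n.
have bq' : ball (c p) r (c q) by apply: le_ball bq; exact: ltW.
have Gx t : `|G t (c q) - c q| <= `|c q - c p| / 2.
  by have := contr t _ _ bp bq'; rewrite Gp subrr subr0.
have dq : `|c q - c p| < r / 2 by move: bq; rewrite /= -ball_normE /= distrC.
have cr t : cdom c (rho (t *: k) q).
  by have [[_ +] _] := tube t _ bq'; rewrite row_mxKl row_mxKr cmapK.
have GE t : G t (c q) = c (rho (t *: k) q) by rewrite /G rhoFE.
have Gb t : ball (c p) r (G t (c q)).
  rewrite -ball_normE /= distrC -(subrK (c q) (G t (c q))) -addrA.
  apply: le_lt_trans (ler_normD _ _) _; rewrite [r]splitr; apply: ler_ltD => //.
  apply: le_trans (Gx t) _; rewrite ler_pM2r //; apply: ltW.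
  by apply: lt_trans r20.
have Gfix t : G t (c q) = c q.
  apply/eqP; rewrite -subr_eq0 -normr_le0; set v := G t (c q) - c q.
  (* Each further step repeats the displacement [v] up to an error of [|v| / 2], so after [j] steps
     the point has moved by at least [j |v| / 2]. Total displacements stay below [r], which forces
     [v = 0]. *)
  have ind (j : nat) : `|G (j%:R * t) (c q) - c q - j%:R *: v| <= j%:R * (`|v| / 2).
    elim: j => [|j IH].
      by rewrite !mul0r scale0r subr0 GE scale0r torus_act0 // subrr normr0.
    have step := contr (j%:R * t) _ _ bq' (Gb t).
    have E : G (j%:R * t) (G t (c q)) = G (j.+1%:R * t) (c q).
      rewrite (GE t) (GE (j.+1%:R * t)) /G rhoFE // -(torus_actD act).
      by rewrite -scalerDl -natr1 mulrDl mul1r.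
    rewrite E in step; set aG := G (j.+1%:R * t) (c q) in step *.
    rewrite -natr1 mulrDl mul1r scalerDl scale1r.
    apply: (le_trans _ (le_trans (ler_normD _ _) (lerD IH step))).
    rewrite le_eqVlt; apply/orP; left; apply/eqP; congr `|_|; rewrite /v.
    clear -aG; move: aG (G (j%:R * t) (c q)) (G t (c q)) (c q) => a b e f.
    by apply/rowP => i; rewrite !mxE; ring.
  rewrite leNgt; apply/negP => v0.
  have [j jr] : exists j : nat, r < j%:R * (`|v| / 2).
    have v2 : 0 < `|v| / 2 by rewrite divr_gt0.
    exists (Num.bound (r / (`|v| / 2))); rewrite -ltr_pdivrMr //.
    by apply: archi_boundP; rewrite divr_ge0 // ltW.
  have := ind j; rewrite leNgt => /negP; apply.
  set w := G (j%:R * t) (c q) - c q.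
  have H1 : j%:R * `|v| <= `|w - j%:R *: v| + `|w|.
    rewrite -{1}(ger0_norm (ler0n R j)) -normrZ [leRHS]addrC.
    apply: le_trans (ler_normB w (w - j%:R *: v)).
    by rewrite opprB addrC subrK.
  have H2 : `|w| < r.
    by apply: le_lt_trans (Gx _) _; move: dq r0 => ? ?; lra.
  move: H1 H2 jr; set Y := j%:R * (`|v| / 2).
  have -> : j%:R * `|v| = Y + Y by rewrite /Y -mulrDr -splitr.
  by move=> *; lra.
apply: (fix_fundamental0 act sc cq) => t.
by have := Gfix t; rewrite GE => /(congr1 (cinv c)); rewrite !cmapK.
Qed.

End Rigidity.

(** * The local theorem *)

Section SymplecticAlgebra.
Variables (R : realType) (d : nat) (w J : 'M[R]_d).
Hypothesis w_skew : w^T = - w.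
Hypothesis JJ : J *m J = - 1%:M.
Hypothesis Jw : J *m w *m J^T = w.
Hypothesis g_pos : forall v : 'rV[R]_d, v != 0 -> 0 < (v *m (w *m J^T) *m v^T) 0 0.

Lemma g_eq0 (v : 'rV[R]_d) : v *m (w *m J^T) *m v^T = 0 -> v = 0.
Proof.
move=> E; apply/eqP; apply: contraT => /g_pos; rewrite E mxE ltxx //.
Qed.

Lemma tr_form a b (A : 'M[R]_(a, d)) (B : 'M[R]_(b, d)) : (A *m w *m B^T)^T = - (B *m w *m A^T).
Proof. by rewrite !trmx_mul trmxK w_skew mulmxA mulmxN mulNmx. Qed.

(** Isotropic subspaces are totally real: if [r X J = - l X], then [v = r X] is orthogonal to [v J]
    for omega, that is, g(v, v) = 0. *)
Lemma isotropic_J_free a (X : 'M[R]_(a, d)) : X *m w *m X^T = 0 -> row_free X ->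
  row_free (col_mx X (X *m J)).
Proof.
move=> iX fX; rewrite -kermx_eq0; apply/eqP/row_matrixP => i; rewrite row0.
set r := row i _; have : r *m col_mx X (X *m J) = 0.
  by apply/sub_kermxP; exact: row_sub.
rewrite -[r]hsubmxK mul_row_col mulmxA => E.
have v0 : rsubmx r *m X = 0.
  apply: g_eq0; set v := rsubmx r *m X.
  have : v *m w *m (lsubmx r *m X)^T = 0.
    by rewrite /v trmx_mul !mulmxA -2!(mulmxA (rsubmx r)) iX mulmx0 mul0mx.
  have -> : lsubmx r *m X = - (v *m J) by apply/eqP; rewrite -addr_eq0; apply/eqP.
  rewrite linearN /= mulmxN trmx_mul !mulmxA => /eqP; rewrite oppr_eq0 => /eqP E'.
  by rewrite -!mulmxA in E' *.
have r0 : rsubmx r = 0.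
  by apply: (row_free_inj fX); rewrite v0 mul0mx.
have l0 : lsubmx r = 0.
  apply: (row_free_inj fX); rewrite mul0mx.
  by move: E; rewrite v0 mul0mx addr0.
by rewrite l0 r0 row_mx0.
Qed.

Lemma J_form (u v : 'rV[R]_d) : u *m J *m w *m v^T = - (u *m w *m (v *m J)^T).
Proof.
rewrite -{1}Jw trmx_mul !mulmxA -(mulmxA u J J) JJ mulmxN mulmx1 !mulNmx.
by [].
Qed.

End SymplecticAlgebra.

(** * Commuting skew endomorphisms and generic points *)

Section CommutingSkew.
Variables (R : realType) (d l : nat) (g : 'M[R]_d) (A : 'I_l -> 'M[R]_d).
Hypothesis g_pos : forall v : 'rV[R]_d, v != 0 -> 0 < (v *m g *m v^T) 0 0.
Hypothesis A_comm : forall a b, A a *m A b = A b *m A a.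
Hypothesis A_skew : forall a, A a *m g = - (g *m (A a)^T).

(** The orbit directions at [q] of the linear action generated by the [A a]. *)
Definition orbit_mx (q : 'rV[R]_d) : 'M[R]_(l, d) := \matrix_a (q *m A a).

Lemma mul_orbit_mx (k : 'rV[R]_l) q : k *m orbit_mx q = q *m \sum_a k 0 a *: A a.
Proof.
rewrite mulmx_sum_row mulmx_sumr; apply: eq_bigr => a _.
by rewrite rowK scalemxAr.
Qed.

Let Ak (k : 'rV[R]_l) := \sum_a k 0 a *: A a.

Lemma Ak_comm k k' : Ak k *m Ak k' = Ak k' *m Ak k.
Proof.
rewrite /Ak mulmx_suml mulmx_sumr; apply: eq_bigr => a _.
rewrite mulmx_sumr mulmx_suml; apply: eq_bigr => b _.
by rewrite -!scalemxAl -!scalemxAr A_comm scalerA mulrC -scalerA.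
Qed.

Lemma Ak_skew k : Ak k *m g = - (g *m (Ak k)^T).
Proof.
have -> : (Ak k)^T = \sum_a k 0 a *: (A a)^T.
  by apply/matrixP => i j; rewrite mxE !summxE; apply: eq_bigr => a _; rewrite !mxE.
rewrite /Ak mulmx_suml mulmx_sumr -sumrN; apply: eq_bigr => a _.
by rewrite -scalemxAl A_skew scalerN -scalemxAr.
Qed.

(** Skewness turns g(v A, v A) into - g(v A A, v), which vanishes; here [A] is [Ak k]. *)
Lemma Ak_sq0 k (v : 'rV[R]_d) : v *m Ak k *m Ak k = 0 -> v *m Ak k = 0.
Proof.
move=> E; apply/eqP; apply: contraT => /g_pos.
rewrite trmx_mul !mulmxA -(mulmxA (v *m Ak k) g).
have -> : g *m (Ak k)^T = - (Ak k *m g) by rewrite Ak_skew opprK.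
by rewrite mulmxN mulmxA E mul0mx oppr0 mul0mx mxE ltxx.
Qed.

(* A point q with orbit_mx q of maximal rank: if A_k killed q but not v, then
   q + v A_k would have a smaller stabiliser. *)
Lemma generic_point : exists q, forall k : 'rV[R]_l, k *m orbit_mx q = 0 ->
  forall v, k *m orbit_mx v = 0.
Proof.
have [q qmax] : exists q, forall q', (\rank (orbit_mx q') <= \rank (orbit_mx q))%N.
  pose P r := `[< exists q, \rank (orbit_mx q) = r >].
  have P0 : exists r, P r by exists (\rank (orbit_mx 0)); apply/asboolP; exists 0.
  have Pd r : P r -> (r <= d)%N by move=> /asboolP[q <-]; exact: rank_leq_col.
  case: (ex_maxnP P0 Pd) => r /asboolP[q rq] rmax; exists q => q'.
  by rewrite rq; apply: rmax; apply/asboolP; exists q'.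
exists q => k kq v; rewrite mul_orbit_mx -/(Ak k).
have qk : q *m Ak k = 0 by rewrite -mul_orbit_mx.
apply: Ak_sq0; set z := v *m Ak k.
suff : k *m orbit_mx z = 0 by rewrite mul_orbit_mx.
have kE k' q' : k' *m orbit_mx q' = q' *m Ak k' by exact: mul_orbit_mx.
(* Multiplying [(q + z) A_k' = 0] by [A_k], which commutes with [A_k'] and kills [q], gives
   [z A_k' A_k = 0]. As [z A_k' = v A_k' A_k], this is a square applied to [v A_k'], so
   [z A_k' = 0]. *)
have split_stab (k' : 'rV[R]_l) : k' *m orbit_mx (q + z) = 0 -> k' *m orbit_mx q = 0 /\ k' *m orbit_mx z = 0.
  rewrite !kE mulmxDl => E.
  have zz : z *m Ak k' = 0.
    have E1 : z *m Ak k' *m Ak k = 0.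
      have : (q *m Ak k' + z *m Ak k') *m Ak k = 0 by rewrite E mul0mx.
      by rewrite mulmxDl -(mulmxA q) Ak_comm mulmxA qk mul0mx add0r.
    have ze : z *m Ak k' = v *m Ak k' *m Ak k by rewrite /z -!mulmxA Ak_comm.
    by rewrite ze; apply: Ak_sq0; rewrite -ze.
  by split=> //; move: E; rewrite zz addr0.
have sub : (kermx (orbit_mx (q + z)) <= kermx (orbit_mx q))%MS.
  apply/row_subP => i; apply/sub_kermxP; apply: (split_stab _ _).1.
  by apply/sub_kermxP; exact: row_sub.
(* Maximality of the rank at [q] turns the inclusion of kernels into an equality, so [k], which
   kills [q], also kills [q + z]. *)
have : (kermx (orbit_mx q) <= kermx (orbit_mx (q + z)))%MS.
  rewrite -(geq_leqif (mxrank_leqif_sup sub)) !mxrank_ker.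
  by apply: leq_sub2l; exact: qmax.
move=> sub'; apply: (split_stab k _).2.
by apply/sub_kermxP; apply: submx_trans sub'; apply/sub_kermxP.
Qed.

End CommutingSkew.

(** * Limits of spans *)

Section LimitSpan.
Variable R : realType.

(* If B C = 1, Cramer's rule turns v <= B(t) into the polynomial identity
   det (B(t) C) v = v C adj (B(t) C) B(t), which passes to the limit. *)
Lemma limit_submx a d (A : R -> 'M[R]_(a + 1, d)) (A0 : 'M[R]_(a + 1, d)) :
  A @ (0 : R)^' --> A0 -> row_free (usubmx A0) ->
  (\forall t \near (0 : R)^', (dsubmx (A t) <= usubmx (A t))%MS) ->
  (dsubmx A0 <= usubmx A0)%MS.
Proof.
move=> cA /row_freeP[C BC] nA.
pose Phi (X : 'M[R]_(a + 1, d)) : 'rV[R]_d := \det (usubmx X *m C) *: dsubmx X -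
  dsubmx X *m C *m \adj (usubmx X *m C) *m usubmx X.
have cPhi : Ck 0 setT Phi.
  have oT : open [set: 'M[R]_(a + 1, d)] by exact: openT.
  have cu : Ck 0 setT (fun X : 'M[R]_(a + 1, d) => usubmx X).
    apply: Ck_mx => // i j.
    apply: (Ck_eq oT _ (Ck_entry (lshift 1 i) j oT (Ck_id 0 setT))).
    by move=> v _; rewrite mxE.
  have cd : Ck 0 setT (fun X : 'M[R]_(a + 1, d) => dsubmx X).
    apply: Ck_mx => // i j.
    apply: (Ck_eq oT _ (Ck_entry (rshift a i) j oT (Ck_id 0 setT))).
    by move=> v _; rewrite mxE.
  have cC e f (D : 'M[R]_(e, f)) : Ck 0 [set: 'M[R]_(a + 1, d)] (fun=> D) by exact: Ck_cst.
  have cuC := Ck_mulmx oT cu (cC _ _ C).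
  have c1 := Ck_scalemx oT (Ck_det oT cuC) cd.
  have c2 := Ck_mulmx oT cd (cC _ _ C).
  have c3 := Ck_mulmx oT c2 (Ck_adj oT cuC).
  have c4 := Ck_mulmx oT c3 cu.
  exact: (CkB oT c1 c4).
have Phi0 : Phi A0 = 0.
  have c1 : Phi \o A @ (0 : R)^' --> Phi A0.
    by apply: cvg_comp cA _; exact: (cPhi A0 I).
  have c2 : Phi \o A @ (0 : R)^' --> (0 : 'rV[R]_d).
    have E : \forall t \near (0 : R)^', 0 = (Phi \o A) t.
      apply: filterS nA => t /submxP[D E] /=; rewrite /Phi E.
      rewrite -!mulmxA (mulmxA (usubmx _) C) (mulmxA _ (\adj _)) mul_mx_adj.
      by rewrite mul_scalar_mx scalemxAr subrr.
    by apply: cvg_trans (near_eq_cvg E) _; exact: cvg_cst.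
  exact: (cvg_unique (@norm_hausdorff _ _) c1 c2).
move/eqP: Phi0; rewrite /Phi BC det1 scale1r subr_eq0 => /eqP ->.
exact: submxMl.
Qed.

End LimitSpan.

Section Cvg.
Variable R : realType.

Lemma cvg_mulmxr_cst (T : Type) (F : set_system T) {FF : Filter F} a b c (D : 'M[R]_(a, b))
    (f : T -> 'M[R]_(b, c)) (l : 'M[R]_(b, c)) :
  f @ F --> l -> (fun t => D *m f t) @ F --> D *m l.
Proof.
move=> cf; have oT : open [set: 'M[R]_(b, c)] by exact: openT.
have cc : Ck 0 [set: 'M[R]_(b, c)] (fun=> D) by exact: Ck_cst.
have cD := Ck_mulmx oT cc (Ck_id 0 setT).
exact: (cvg_comp _ _ cf (cD l I)).
Qed.

Lemma cvg_mulmxl_cst (T : Type) (F : set_system T) {FF : Filter F} a b c (D : 'M[R]_(b, c))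
    (f : T -> 'M[R]_(a, b)) (l : 'M[R]_(a, b)) :
  f @ F --> l -> (fun t => f t *m D) @ F --> l *m D.
Proof.
move=> cf; have oT : open [set: 'M[R]_(a, b)] by exact: openT.
have cc : Ck 0 [set: 'M[R]_(a, b)] (fun=> D) by exact: Ck_cst.
have cD := Ck_mulmx oT (Ck_id 0 setT) cc.
exact: (cvg_comp _ _ cf (cD l I)).
Qed.

Lemma cvg_col_mx (T : Type) (F : set_system T) {FF : Filter F} a b c
    (f : T -> 'M[R]_(a, c)) (g : T -> 'M[R]_(b, c)) (k : 'M[R]_(a, c)) (l : 'M[R]_(b, c)) :
  f @ F --> k -> g @ F --> l -> (fun t => col_mx (f t) (g t)) @ F --> col_mx k l.
Proof.
move=> cf cg.
have E (x : 'M[R]_(a, c)) (y : 'M[R]_(b, c)) : col_mx x y = col_mx 1%:M 0 *m x + col_mx 0 1%:M *m y.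
  by rewrite !mul_col_mx !mul1mx !mul0mx add_col_mx addr0 add0r.
rewrite E (_ : (fun _ => _) = fun t => col_mx 1%:M 0 *m f t + col_mx 0 1%:M *m g t); last first.
  by apply/funext => t; exact: E.
by apply: cvgD; exact: cvg_mulmxr_cst.
Qed.

Lemma dv_cvg (V W : normedModType R) (f : V -> W) x v : dble f x ->
  (fun h : R => h^-1 *: (f (x + h *: v) - f x)) @ (0 : R)^' --> dv v f x.
Proof.
rewrite dble.unlock dv.unlock => /diff_derivable df; rewrite /derive.
suff -> : (fun h : R => h^-1 *: (f (x + h *: v) - f x)) =
  (fun h : R => h^-1 *: ((f \o shift x) (h *: v) - f x)) by exact: df.
by apply/funext => h /=; rewrite (addrC x).
Qed.

Lemma line_cvg (V W : normedModType R) (f : V -> W) x v : dble f x ->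
  (fun h : R => f (x + h *: v)) @ (0 : R)^' --> f x.
Proof.
move=> df; have c0 : {for (0 : R), continuous (fun h : R => f (x + h *: v))}.
  by apply: dble_continuous; apply: dble_line; rewrite scale0r addr0.
have := c0; rewrite /prop_for /continuous_at scale0r addr0 => c1.
exact: cvg_trans (cvg_app _ (cvg_within _)) c1.
Qed.

End Cvg.

(** * Involutivity at one point, in a holomorphic chart *)

Section Local.
Variables (R : realType) (d n : nat) (x0 : 'rV[R]_d) (O : set 'rV[R]_d).
Variables (N : 'rV[R]_d -> 'M[R]_(n, d)) (w : 'rV[R]_d -> 'M[R]_d) (J : 'M[R]_d).
Hypothesis oO : open O.
Hypothesis Ox0 : O x0.
Hypothesis cN : forall k, Ck k O N.
Hypothesis cw : forall k, Ck k O w.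
Hypothesis w_skew : (w x0)^T = - w x0.
Hypothesis JJ : J *m J = - 1%:M.
Hypothesis Jw : forall x, O x -> J *m w x *m J^T = w x.
Hypothesis g_pos : forall v : 'rV[R]_d, v != 0 -> 0 < (v *m (w x0 *m J^T) *m v^T) 0 0.
Hypothesis NwN : N x0 *m w x0 *m (N x0)^T = 0.
(** Holomorphy of the fundamental fields. *)
Hypothesis NJ : forall x q, O x -> dv (q *m J) N x = dv q N x *m J.
Hypothesis N_comm : forall x (th th' : 'rV[R]_n), O x ->
  th' *m dv (th *m N x) N x = th *m dv (th' *m N x) N x.
(** The Lie derivative of [w] along [th N] at a zero of that field, where the term containing the
    derivative of [w] disappears. *)
Hypothesis N_symp : forall th : 'rV[R]_n, th *m N x0 = 0 -> forall u v : 'rV[R]_d,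
  th *m dv u N x0 *m w x0 *m v^T + u *m w x0 *m (th *m dv v N x0)^T = 0.
Hypothesis N_rigid : exists V, [/\ open V, V x0 & forall k : 'rV[R]_n, k *m N x0 = 0 ->
  (forall v, k *m dv v N x0 = 0) -> forall x, V x -> k *m N x = 0].

Let dN x : O x -> dble N x. Proof. exact: Ck_dble (cN 1). Qed.
Let dw x : O x -> dble w x. Proof. exact: Ck_dble (cw 1). Qed.

Let Jw' x : O x -> J *m w x = - (w x *m J^T).
Proof.
move=> Ox; rewrite -{2}(Jw Ox) -!mulmxA -trmx_mul JJ linearN /= trmx1.
by rewrite !mulmxN mulmx1 opprK.
Qed.

Lemma w_inj (v : 'rV[R]_d) : v *m w x0 = 0 -> v = 0.
Proof. by move=> E; apply: (g_eq0 g_pos); rewrite !mulmxA E !mul0mx. Qed.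

(** The linearisation of [th N] is skew for [w], so the orthogonal of its image is contained in its
    kernel by nondegeneracy. *)
Lemma ker_symp (v : 'rV[R]_d) (th : 'rV[R]_n) : th *m N x0 = 0 ->
  (forall q, v *m w x0 *m (th *m dv q N x0)^T = 0) -> th *m dv v N x0 = 0.
Proof.
move=> th0 H; apply: w_inj; apply/rowP => i; rewrite [RHS]mxE.
have := N_symp th0 v (delta_mx 0 i); rewrite H addr0 => /matrixP/(_ 0 0).
by rewrite trmx_delta -colE !mxE.
Qed.

Definition in_span (x v : 'rV[R]_d) := (v <= col_mx (N x) (N x *m J))%MS.

Lemma in_spanP x v : in_span x v <-> exists a b : 'rV[R]_n, v = a *m N x + b *m N x *m J.
Proof.
split=> [/submxP[D ->]|[a [b ->]]].
  exists (lsubmx D), (rsubmx D).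
  by rewrite -[D in LHS]hsubmxK mul_row_col mulmxA.
apply/submxP; exists (row_mx a b); by rewrite mul_row_col mulmxA.
Qed.

(* Along the fixed locus of the stabiliser of x0, a section of the kernel of
   d mu differentiates, to first order, to a vector tangent to that locus. *)
Lemma second_order (Y : 'rV[R]_d -> 'rV[R]_d) (th : 'rV[R]_n) (u q : 'rV[R]_d) :
  (forall k, Ck k O Y) -> (forall x, O x -> Y x *m w x *m (N x)^T = 0) ->
  th *m N x0 = 0 -> th *m dv u N x0 = 0 ->
  (dv u Y x0 *m w x0 + Y x0 *m dv u w x0) *m (th *m dv q N x0)^T +
    Y x0 *m w x0 *m (th *m dv u (dv q N) x0)^T = 0.
Proof.
move=> cY YN th0 thu.
have dY x : O x -> dble Y x by exact: Ck_dble (cY 1%N).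
pose P x := Y x *m w x.
have cP k : Ck k O P by exact: Ck_mulmx.
have dP x : O x -> dble P x by exact: Ck_dble (cP 1%N).
pose e x := (th *m N x)^T.
have ce k : Ck k O e by apply: Ck_tr => //; apply: Ck_mulmx => //; exact: Ck_cst.
have de x : O x -> dble e x by exact: Ck_dble (ce 1%N).
have dve v x : O x -> dv v e x = (th *m dv v N x)^T.
  move=> Ox; rewrite dv_tr; last by apply: dble_mulmxr; exact: dN.
  by rewrite dv_mulmxr //; exact: dN.
have E0 x : O x -> P x *m e x = 0.
  by move=> Ox; rewrite /P /e trmx_mul mulmxA YN // mul0mx.
have E1 x : O x -> dv q P x *m e x + P x *m dv q e x = 0.
  move=> Ox; rewrite -(dv_mulmx q (dP _ Ox) (de _ Ox)).
  rewrite -(dv_cst (0 : 'M[R]_(1, 1)) x q); apply: near_eq_dv; exact: eq_open_near oO E0 Ox.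
have dqP : dble (dv q P) x0 by exact: Ck_dble (Ck_dv q (cP 2%N)) Ox0.
have dqe : dble (dv q e) x0 by exact: Ck_dble (Ck_dv q (ce 2%N)) Ox0.
have E2 : dv u (fun x => dv q P x *m e x + P x *m dv q e x) x0 = 0.
  rewrite -(dv_cst (0 : 'M[R]_(1, 1)) x0 u); apply: near_eq_dv; exact: eq_open_near oO E1 Ox0.
move: E2; rewrite dvD; last 2 first.
- exact: dble_mulmx dqP (de _ Ox0).
- exact: dble_mulmx (dP _ Ox0) dqe.
rewrite (dv_mulmx u dqP (de _ Ox0)) (dv_mulmx u (dP _ Ox0) dqe).
(* Of the four Leibniz terms two disappear, since [th N] vanishes at [x0] together with its
   derivative along [u]. *)
rewrite {1}/e th0 trmx0 mulmx0 add0r dve // thu trmx0 mulmx0 add0r dve //.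
rewrite (dv_mulmx u (dY _ Ox0) (dw Ox0)).
move=> E; apply: etrans E; congr (_ + _ *m _).
have -> : dv u (dv q e) x0 = dv u (fun x => (th *m dv q N x)^T) x0.
  by apply: near_eq_dv; apply: eq_open_near oO _ Ox0 => x Ox; exact: dve.
have dqN : dble (dv q N) x0 by exact: Ck_dble (Ck_dv q (cN 2)) Ox0.
by rewrite dv_tr ?dv_mulmxr //; exact: dble_mulmxr.
Qed.

Section Sections.
Variables (Y1 Y2 : 'rV[R]_d -> 'rV[R]_d).
Hypothesis cY1 : forall k, Ck k O Y1.
Hypothesis cY2 : forall k, Ck k O Y2.
Hypothesis Y1N : forall x, O x -> Y1 x *m w x *m (N x)^T = 0.
Hypothesis Y2N : forall x, O x -> Y2 x *m w x *m (N x)^T = 0.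
Let y x := Y1 x + Y2 x *m J.
Hypothesis y_span : forall x, O x -> in_span x (y x).
Hypothesis y0 : y x0 = 0.

(** Subtract the second-order relation of [Y2] in the direction [q J] from that of [Y1] in the
    direction [q]. As [Y1 = - Y2 J] at [x0] and [N] is holomorphic, the second derivatives of [N]
    and the derivatives of [w] cancel. *)
Lemma tangent_symp (u q : 'rV[R]_d) (th : 'rV[R]_n) : th *m N x0 = 0 -> th *m dv u N x0 = 0 ->
  dv u y x0 *m w x0 *m (th *m dv q N x0)^T = 0.
Proof.
move=> th0 thu.
have dY1 : dble Y1 x0 by exact: Ck_dble (cY1 1%N) Ox0.
have dY2 : dble Y2 x0 by exact: Ck_dble (cY2 1%N) Ox0.
have E1 := second_order q cY1 Y1N th0 thu.
have E2 := second_order (q *m J) cY2 Y2N th0 thu.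
have Y1E : Y1 x0 = - (Y2 x0 *m J) by apply/eqP; rewrite -addr_eq0; apply/eqP.
have Jdw : J *m dv u w x0 = - (dv u w x0 *m J^T).
  rewrite -dv_mulmxr; last exact: dw.
  rewrite -dv_mulmxl; last exact: dw.
  rewrite -dvN; last by apply: dble_mulmxl; exact: dw.
  by apply: near_eq_dv; apply: eq_open_near oO _ Ox0 => x; exact: Jw'.
have DJ : dv u (dv (q *m J) N) x0 = dv u (dv q N) x0 *m J.
  rewrite -dv_mulmxl; last by exact: Ck_dble (Ck_dv q (cN 2)) Ox0.
  by apply: near_eq_dv; apply: eq_open_near oO _ Ox0 => x Ox; exact: NJ.
rewrite /y dvD //; last exact: dble_mulmxl.
rewrite dv_mulmxl // [in LHS]mulmxDl mulmxDl -(mulmxA _ J) Jw' // mulmxN mulNmx.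
move: E1 E2; rewrite Y1E NJ // DJ !mulmxA !trmx_mul !mulmxDl !mulNmx -!(mulmxA (Y2 x0) J) Jdw Jw' //.
rewrite !mulmxN !mulNmx !opprK !mulmxA => E1 E2.
have := etrans E1 (esym E2); rewrite -!addrA => /addIr ->.
by rewrite subrr.
Qed.

End Sections.

Let N0 := N x0.
(* locked: kermx unfolds to a product, which would confuse mulmxA *)
Let K := locked (kermx N0).
Let KN0 : K *m N0 = 0. Proof. by rewrite /K -lock mulmx_ker. Qed.
Let K_sub (th : 'rV[R]_n) : th *m N0 = 0 -> (th <= K)%MS.
Proof. by move=> th0; rewrite /K -lock; apply/sub_kermxP. Qed.
Let DN q := dv q N x0.
(** The linear isotropy representation at [x0]. The rows of [K] generate the stabiliser algebra but
    may be dependent. *)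
Let A (a : 'I_n) : 'M[R]_d := jac (fun x => row a K *m N x) x0.

Let DN_add q q' : DN (q + q') = DN q + DN q'.
Proof. exact/dv_dirD/dN. Qed.

Let rowK0 a : row a K *m N0 = 0.
Proof. by rewrite -row_mul KN0 row0. Qed.

Let A_E a q : q *m A a = row a K *m DN q.
Proof.
by rewrite -dv_jac; [rewrite dv_mulmxr //; exact: dN|apply: dble_mulmxr; exact: dN].
Qed.

Let orbitE q : orbit_mx A q = K *m DN q.
Proof. by apply/row_matrixP => a; rewrite rowK (row_mul a K) A_E. Qed.

(** Linearise at a common zero the relation saying that the fields [row a K *m N] and [row b K *m N]
    commute. *)
Let A_comm a b : A a *m A b = A b *m A a.
Proof.
have H (q : 'rV[R]_d) : q *m A a *m A b = q *m A b *m A a.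
  pose f (a : 'I_n) x := row a K *m N x.
  have cf c : forall k, Ck k O (f c) by move=> k; apply: Ck_mulmx => //; exact: Ck_cst.
  have df c x : O x -> dble (f c) x by exact: Ck_dble (cf c 1%N).
  have djf c : dble (jac (f c)) x0 by exact: Ck_dble (Ck_jac oO (cf c 2%N)) Ox0.
  have E c c' : dv q (fun x => f c x *m jac (f c') x) x0 = q *m A c *m A c'.
    rewrite dv_mulmx //; last exact: df.
    have f0 : f c x0 = 0 by exact: rowK0.
    by rewrite f0 mul0mx addr0 dv_jac //; exact: df.
  rewrite -!E; apply: near_eq_dv; apply: eq_open_near oO _ Ox0 => x Ox.
  rewrite -!dv_jac; [|exact: df|exact: df].
  by rewrite !dv_mulmxr; [exact: N_comm|exact: dN|exact: dN].
apply/row_matrixP => i; rewrite !rowE !mulmxA; exact: H.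
Qed.

(** [N_symp] with second argument [v J]: by holomorphy, invariance of [w] becomes invariance of the
    metric. *)
Let A_skew a : A a *m (w x0 *m J^T) = - (w x0 *m J^T *m (A a)^T).
Proof.
apply/matrixP => i j.
have E (B : 'M[R]_d) : B i j = (delta_mx 0 i *m B *m (delta_mx 0 j)^T : 'M[R]_1) 0 0.
  by rewrite -rowE trmx_delta -colE !mxE.
rewrite !E mulmxN mulNmx [RHS]mxE.
have H := N_symp (rowK0 a) (delta_mx 0 i) (delta_mx 0 j *m J).
move/eqP: H; rewrite addr_eq0 => /eqP; rewrite NJ // -/(DN _) -/(DN _) mulmxA -!A_E !trmx_mul !mulmxA => ->.
have AT : (DN (delta_mx 0 j))^T *m (row a K)^T = (A a)^T *m (delta_mx 0 j)^T.
  by rewrite -!trmx_mul A_E.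
by rewrite mxE -(mulmxA _ (DN _)^T) AT mulmxA.
Qed.

Let symp_ker (th : 'rV[R]_n) v q : th *m N0 = 0 -> th *m DN v = 0 ->
  v *m w x0 *m (th *m DN q)^T = 0.
Proof.
move=> th0 thv; have := N_symp th0 v q.
by rewrite -/(DN v) thv !mul0mx add0r.
Qed.

(** By commutativity the derivative can be exchanged for one along [th N0 = 0]: orbit directions are
    fixed by the linear isotropy action. *)
Let N0_ker (th k : 'rV[R]_n) : th *m N0 = 0 -> th *m DN (k *m N0) = 0.
Proof. by move=> th0; rewrite /DN -N_comm // -/N0 th0 dv_dir0 mulmx0. Qed.

Let form_entry e f (X : 'M[R]_(e, d)) (W : 'M[R]_d) (Z : 'M[R]_(f, d)) a b :
  (X *m W *m Z^T) a b = (row a X *m W *m (row b Z)^T) 0 0.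
Proof. by rewrite -row_mul !mxE; apply: eq_bigr => k _; rewrite !mxE. Qed.

(** The pairing of [q A_a] and [q A_b] is symmetric in [a] and [b] because the [A] commute, and
    antisymmetric because [w] is. *)
Let KDN_isotropic q : K *m DN q *m w x0 *m (K *m DN q)^T = 0.
Proof.
apply/matrixP => a b; rewrite [RHS]mxE form_entry (row_mul a K) (row_mul b K).
have E c c' : row c K *m DN q *m w x0 *m (row c' K *m DN q)^T = - (q *m A c *m A c' *m w x0 *m q^T).
  rewrite -!A_E; apply/eqP; rewrite -addr_eq0 addrC; apply/eqP.
  by have := N_symp (rowK0 c') (q *m A c) q; rewrite -/(DN _) -/(DN _) -!A_E.
have S : row a K *m DN q *m w x0 *m (row b K *m DN q)^T = 0.
  set s := LHS; have s1 : s = row b K *m DN q *m w x0 *m (row a K *m DN q)^T.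
    by rewrite /s !E -(mulmxA q) A_comm mulmxA.
  have s2 : s^T = - s by rewrite /s (tr_form w_skew) -s1.
  have s3 : s^T = s by apply/matrixP => i j; rewrite mxE !ord1.
  move: s2; rewrite s3 => /eqP; rewrite -addr_eq0 -mulr2n -scaler_nat scaler_eq0 pnatr_eq0 /=.
  by move/eqP.
by rewrite S mxE.
Qed.

Let N0_KDN q : N0 *m w x0 *m (K *m DN q)^T = 0.
Proof.
apply/matrixP => a b; rewrite [RHS]mxE form_entry (row_mul b K).
have := symp_ker q (rowK0 b) (N0_ker (delta_mx 0 a) (rowK0 b)).
by rewrite -rowE => ->; rewrite mxE.
Qed.

Section Transverse.
Variables (Y1 Y2 : 'rV[R]_d -> 'rV[R]_d).
Hypothesis cY1 : forall k, Ck k O Y1.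
Hypothesis cY2 : forall k, Ck k O Y2.
Hypothesis Y1N : forall x, O x -> Y1 x *m w x *m (N x)^T = 0.
Hypothesis Y2N : forall x, O x -> Y2 x *m w x *m (N x)^T = 0.
Let y x := Y1 x + Y2 x *m J.
Hypothesis y_span : forall x, O x -> in_span x (y x).
Hypothesis y0 : y x0 = 0.

Lemma derivative_in_span (u : 'rV[R]_d) :
  (forall th : 'rV[R]_n, th *m N0 = 0 -> th *m DN u = 0) -> in_span x0 (dv u y x0).
Proof.
move=> uV.
have cy k : Ck k O y by apply: CkD => //; apply: Ck_mulmx => //; exact: Ck_cst.
have dy : dble y x0 by exact: Ck_dble (cy 1%N) Ox0.
have [q gq] := generic_point g_pos A_comm A_skew.
have KDNu : K *m DN u = 0.
  by apply/row_matrixP => a; rewrite (row_mul a K) row0; apply: uV.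
pose X2 := K *m DN q.
have [C CE] : exists C, row_base N0 = C *m N0.
  by have /submxP[C CE] : (row_base N0 <= N0)%MS; [rewrite eq_row_base|exists C].
have [E EE] : exists E, row_base X2 = E *m X2.
  by have /submxP[E EE] : (row_base X2 <= X2)%MS; [rewrite eq_row_base|exists E].
have [V [oV Vx0 HV]] := N_rigid.
pose B0 := col_mx (row_base N0) (row_base X2).
(* Every fundamental field is a combination of the chosen ones up to some [k N] with zero 1-jet;
   genericity of [q] is what extends [k DN q = 0] to all directions. *)
have decomp (th : 'rV[R]_n) : exists c e (k : 'rV[R]_n),
   [/\ th = c *m C + e *m E *m K + k, k *m N0 = 0 & forall v, k *m DN v = 0].
  have /submxP[c cE] : (th *m N0 <= row_base N0)%MS by rewrite eq_row_base submxMl.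
  have thc : (th - c *m C) *m N0 = 0 by rewrite mulmxBl cE CE mulmxA subrr.
  have /submxP[k kE] := K_sub thc.
  have /submxP[e eE] : (k *m X2 <= row_base X2)%MS by rewrite eq_row_base submxMl.
  exists c, e, ((k - e *m E) *m K); split.
  - by rewrite mulmxBl -kE -(addrA th) -opprD [RHS]addrC subrK.
  - by rewrite -mulmxA KN0 mulmx0.
  - move=> v; rewrite -mulmxA -orbitE; apply: gq.
    by rewrite orbitE mulmxBl eE EE mulmxA subrr.
(* On [V] the remainder [k N] is zero. The rows of [E K N] vanish at [x0], and dividing them by [t]
   does not change the span but gives it a limit of full rank. *)
have span_t q' t : t != 0 -> V (x0 + t *: q') -> O (x0 + t *: q') ->
    (t^-1 *: (y (x0 + t *: q') - y x0) <=
     col_mx (col_mx (C *m N (x0 + t *: q')) (E *m K *m (t^-1 *: (N (x0 + t *: q') - N x0))))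
            (col_mx (C *m N (x0 + t *: q')) (E *m K *m (t^-1 *: (N (x0 + t *: q') - N x0))) *m J))%MS.
  move=> t0 Vx Ox; rewrite y0 subr0 scalemx_sub //.
  set x := x0 + t *: q' in Vx Ox *.
  have [a [b ->]] := (in_spanP _ _).1 (y_span Ox).
  have EK : E *m K *m (t^-1 *: (N x - N x0)) = t^-1 *: (E *m K *m N x).
    by rewrite -scalemxAr mulmxBr -(mulmxA E K (N x0)) KN0 mulmx0 subr0.
  rewrite EK; set Bx := col_mx (C *m N x) _.
  have sub (th : 'rV[R]_n) : (th *m N x <= Bx)%MS.
    have [c [e [k [-> kN kD]]]] := decomp th.
    rewrite !mulmxDl (HV k kN kD _ Vx) addr0 addmx_sub //.
      by rewrite -mulmxA; apply: submx_trans (submxMl _ _) _; rewrite /Bx -addsmxE addsmxSl.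
    rewrite -!mulmxA; apply: submx_trans (submxMl _ _) _.
    rewrite /Bx -addsmxE; apply: submx_trans (addsmxSr _ _).
    by rewrite mulmxA (eqmx_scale _ (invr_neq0 t0)).
  rewrite -addsmxE addmx_sub_adds //; exact: submxMr.
have DNJ q' : DN q' *m J = DN (q' *m J) by rewrite /DN NJ.
have N0X b (e : 'M[R]_(b, n)) q' : row_base N0 *m w x0 *m (e *m (K *m DN q'))^T = 0.
  have -> : row_base N0 *m w x0 *m (e *m (K *m DN q'))^T =
      C *m (N0 *m w x0 *m (K *m DN q')^T) *m e^T by rewrite CE (trmx_mul e) !mulmxA.
  by rewrite N0_KDN mulmx0 mul0mx.
have N0X2 : row_base N0 *m w x0 *m (row_base X2)^T = 0 by rewrite EE N0X.
(* Isotropy of [B0], with its independence proved next, makes the rows of [B0] and [B0 J]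
   independent, as the passage to the limit requires. *)
have B0iso : B0 *m w x0 *m B0^T = 0.
  rewrite /B0 mul_col_mx tr_col_mx mul_col_row N0X2.
  rewrite -[row_base X2 *m _ *m _]opprK -tr_form // N0X2 trmx0 oppr0.
  have -> : row_base N0 *m w x0 *m (row_base N0)^T = C *m (N0 *m w x0 *m N0^T) *m C^T.
    by rewrite CE (trmx_mul C) !mulmxA.
  have -> : row_base X2 *m w x0 *m (row_base X2)^T =
      E *m (K *m DN q *m w x0 *m (K *m DN q)^T) *m E^T by rewrite EE (trmx_mul E) !mulmxA.
  by rewrite KDN_isotropic NwN !mulmx0 !mul0mx -/(block_mx _ _ _ _) block_mx0.
have B0free : row_free B0.
  rewrite -kermx_eq0; apply/eqP/row_matrixP => i; rewrite row0.
  set r := row i _; have : r *m B0 = 0 by apply/sub_kermxP; exact: row_sub.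
  rewrite -[r]hsubmxK mul_row_col => rE.
  have u2 : rsubmx r *m row_base X2 = 0.
    apply: (g_eq0 g_pos); set v := rsubmx r *m row_base X2.
    have vE : v = - (lsubmx r *m row_base N0) by apply/eqP; rewrite -addr_eq0 addrC; apply/eqP.
    have vJ : v *m J = rsubmx r *m E *m (K *m DN (q *m J)) by rewrite /v EE -DNJ !mulmxA.
    have key : lsubmx r *m row_base N0 *m (w x0 *m J^T) *m v^T =
        lsubmx r *m (row_base N0 *m w x0 *m (v *m J)^T) by rewrite (trmx_mul v) !mulmxA.
    by rewrite {1}vE !mulNmx key vJ N0X mulmx0 oppr0.
  have r2 : rsubmx r = 0 by apply: (row_free_inj (row_base_free _)); rewrite u2 mul0mx.
  have r1 : lsubmx r = 0.
    by apply: (row_free_inj (row_base_free _)); move: rE; rewrite u2 addr0 mul0mx.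
  by rewrite r1 r2 row_mx0.
(* The limit space depends on [q'] only through [K *m DN q'], which is the same for [q] and
   [u + q]. *)
have DN2 q' : K *m DN q' = X2 -> (dv q' y x0 <= col_mx B0 (B0 *m J))%MS.
  move=> q'E.
  pose At t := col_mx (col_mx (col_mx (C *m N (x0 + t *: q')) (E *m K *m (t^-1 *: (N (x0 + t *: q') - N x0))))
            (col_mx (C *m N (x0 + t *: q')) (E *m K *m (t^-1 *: (N (x0 + t *: q') - N x0))) *m J))
     (t^-1 *: (y (x0 + t *: q') - y x0)).
  have cA : At t @[t --> (0 : R)^'] --> col_mx (col_mx B0 (B0 *m J)) (dv q' y x0).
    have c1 : (fun t : R => C *m N (x0 + t *: q')) @ (0 : R)^' --> row_base N0.
      by rewrite CE; apply: cvg_mulmxr_cst; apply: line_cvg; exact: dN.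
    have c2 : (fun t : R => E *m K *m (t^-1 *: (N (x0 + t *: q') - N x0))) @ (0 : R)^' --> row_base X2.
      have -> : row_base X2 = E *m K *m DN q' by rewrite EE -(mulmxA E) q'E.
      apply: cvg_mulmxr_cst; apply: dv_cvg; exact: dN.
    have c3 : (fun t : R => col_mx (C *m N (x0 + t *: q'))
        (E *m K *m (t^-1 *: (N (x0 + t *: q') - N x0)))) @ (0 : R)^' --> B0 by exact: cvg_col_mx.
    by apply: cvg_col_mx; [apply: cvg_col_mx => //; exact: cvg_mulmxl_cst|exact: dv_cvg].
  have := limit_submx cA; rewrite !col_mxKu !col_mxKd; apply.
    exact: (isotropic_J_free g_pos).
  have cl : {for (0 : R), continuous (fun t : R => x0 + t *: q')}.
    by apply: dble_continuous; apply: (dble_line (f := id)); exact: dble_id.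
  have nVO : \forall t \near (0 : R)^', V (x0 + t *: q') /\ O (x0 + t *: q').
    apply: nbhs_dnbhs; apply: (cl (V `&` O)); apply: open_nbhs_nbhs.
    by split; [exact: openI|rewrite scale0r addr0].
  have n0 : \forall t \near (0 : R)^', t != 0 by exact: nbhs_dnbhs_neq.
  apply: filterS2 nVO n0 => t [Vt Ot] t0; rewrite /At col_mxKd col_mxKu.
  exact: span_t.
have Lq := DN2 q erefl.
have Luq : (dv (u + q)%R y x0 <= col_mx B0 (B0 *m J))%MS.
  by apply: DN2; rewrite DN_add mulmxDr KDNu add0r.
have L : (dv u y x0 <= col_mx B0 (B0 *m J))%MS.
  by rewrite -[dv u y x0](addrK (dv q y x0)) -dv_dirD // addmx_sub // eqmx_opp.
have /submxP[D DE] := L.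
pose f := lsubmx D; pose f' := rsubmx D.
(* [s] lies in the span at [x0]; [z] is the excess to be eliminated. *)
pose s := lsubmx f *m row_base N0 + lsubmx f' *m row_base N0 *m J.
pose z := rsubmx f *m row_base X2 + rsubmx f' *m row_base X2 *m J.
have Lsz : dv u y x0 = s + z.
  rewrite DE -[D]hsubmxK mul_row_col -/f -/f' -[in LHS](hsubmxK f) -[in LHS](hsubmxK f') mulmxA.
  by rewrite !mul_row_col mulmxDl addrACA.
have Jform (v v' : 'rV[R]_d) : v *m J *m w x0 *m v'^T = - (v *m w x0 *m (v' *m J)^T).
  exact: (J_form JJ (Jw Ox0)).
have sperp (k : 'rV[R]_n) q' : k *m N0 = 0 -> s *m w x0 *m (k *m DN q')^T = 0.
  move=> k0; rewrite /s CE !mulmxA !mulmxDl Jform -(mulmxA k) DNJ.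
  by rewrite !symp_ker ?oppr0 ?addr0 // N0_ker.
have zperp (k : 'rV[R]_n) q' : k *m N0 = 0 -> z *m w x0 *m (k *m DN q')^T = 0.
  move=> k0; have : (s + z) *m w x0 *m (k *m DN q')^T = 0.
    by rewrite -Lsz; exact: (tangent_symp cY1 cY2 Y1N Y2N y0 q' k0 (uV _ k0)).
  by rewrite 2!mulmxDl sperp // add0r.
(* [z J] is again a combination of images of the linearised isotropy fields, to all of which [z] is
   orthogonal; hence g(z, z) = 0. *)
have z0 : z = 0.
  apply: (g_eq0 g_pos); rewrite mulmxA -(mulmxA _ J^T) -trmx_mul.
  pose k1 := rsubmx f *m E *m K; pose k2 := rsubmx f' *m E *m K.
  have kN (c : 'rV[R]_(\rank X2)) : c *m E *m K *m N0 = 0 by rewrite -mulmxA KN0 mulmx0.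
  have -> : z *m J = k1 *m DN (q *m J) + k2 *m DN (q *m J *m J).
    by rewrite /z EE mulmxDl -!DNJ !mulmxA.
  by rewrite linearD /= mulmxDr !zperp ?addr0 //; exact: kN.
apply/in_spanP; exists (lsubmx f *m C), (lsubmx f' *m C).
by rewrite Lsz z0 addr0 /s CE !mulmxA.
Qed.

End Transverse.

Lemma in_spanD v v' : in_span x0 v -> in_span x0 v' -> in_span x0 (v + v').
Proof. exact: addmx_sub. Qed.

Lemma in_spanN v : in_span x0 v -> in_span x0 (- v).
Proof. by rewrite /in_span eqmx_opp. Qed.

Lemma in_spanJ v : in_span x0 v -> in_span x0 (v *m J).
Proof.
move/in_spanP=> [a [b ->]]; apply/in_spanP; exists (- b), a.
by rewrite mulmxDl -(mulmxA _ J J) JJ mulmxN mulmx1 mulNmx addrC.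
Qed.

(** Differentiating [X w (th N)^T = 0] where [th N = 0] makes [X x0] orthogonal to the image of the
    linearisation, and [ker_symp] applies. *)
Lemma section_stab (X : 'rV[R]_d -> 'rV[R]_d) (th : 'rV[R]_n) : (forall k, Ck k O X) ->
  (forall x, O x -> X x *m w x *m (N x)^T = 0) -> th *m N0 = 0 -> th *m DN (X x0) = 0.
Proof.
move=> cX XN th0; apply: ker_symp => // q.
have dX : dble X x0 by exact: Ck_dble (cX 1%N) Ox0.
have dXw : dble (fun x => X x *m w x) x0 by apply: dble_mulmx => //; exact: dw.
have dthN : dble (fun x => th *m N x) x0 by apply: dble_mulmxr; exact: dN.
have E : dv q (fun x => X x *m w x *m (th *m N x)^T) x0 = 0.
  rewrite -(dv_cst (0 : 'M[R]_(1, 1)) x0 q); apply: near_eq_dv.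
  by apply: (eq_open_near oO _ Ox0) => x Ox; rewrite trmx_mul mulmxA XN // mul0mx.
move: E; rewrite (dv_mulmx q dXw (dble_tr dthN)) -/N0 th0 trmx0 mulmx0 add0r.
by rewrite dv_tr // dv_mulmxr //; exact: dN.
Qed.

(** Reduction to [y0]: subtracting [a N] and [b N] with constant coefficients preserves the
    orthogonality to the orbits because these are isotropic. *)
Lemma section_derivative (Y1 Y2 : 'rV[R]_d -> 'rV[R]_d) :
  (forall k, Ck k O Y1) -> (forall k, Ck k O Y2) ->
  (forall x, O x -> Y1 x *m w x *m (N x)^T = 0) ->
  (forall x, O x -> Y2 x *m w x *m (N x)^T = 0) ->
  (forall x, O x -> N x *m w x *m (N x)^T = 0) ->
  (forall x, O x -> in_span x (Y1 x + Y2 x *m J)) ->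
  exists a b : 'rV[R]_n, Y1 x0 + Y2 x0 *m J = a *m N0 + b *m N0 *m J /\
   forall u, (forall th : 'rV[R]_n, th *m N0 = 0 -> th *m DN u = 0) ->
     in_span x0 (dv u Y1 x0 + dv u Y2 x0 *m J - (a *m DN u + b *m DN u *m J)).
Proof.
move=> cY1 cY2 Y1N Y2N NN ys.
have [a [b E]] := (in_spanP _ _).1 (ys _ Ox0).
exists a, b; split=> // u uV.
pose Z1 x := Y1 x - a *m N x; pose Z2 x := Y2 x - b *m N x.
have caN (e : 'rV[R]_n) k : Ck k O (fun x => e *m N x).
  by apply: Ck_mulmx => //; exact: Ck_cst.
have cZ1 k : Ck k O Z1 by apply: CkB.
have cZ2 k : Ck k O Z2 by apply: CkB.
have Z1N x : O x -> Z1 x *m w x *m (N x)^T = 0.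
  by move=> Ox; rewrite /Z1 !mulmxBl Y1N // -!mulmxA (mulmxA (N x)) NN // mulmx0 subr0.
have Z2N x : O x -> Z2 x *m w x *m (N x)^T = 0.
  by move=> Ox; rewrite /Z2 !mulmxBl Y2N // -!mulmxA (mulmxA (N x)) NN // mulmx0 subr0.
have ZE x : Z1 x + Z2 x *m J = Y1 x + Y2 x *m J - (a *m N x + b *m N x *m J).
  by rewrite /Z1 /Z2 mulmxBl opprD addrACA.
have zs x : O x -> in_span x (Z1 x + Z2 x *m J).
  move=> Ox; rewrite ZE; have [c [e ->]] := (in_spanP _ _).1 (ys _ Ox).
  apply/in_spanP; exists (c - a), (e - b).
  by rewrite !mulmxBl opprD addrACA.
have z0 : Z1 x0 + Z2 x0 *m J = 0 by rewrite ZE E subrr.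
have := derivative_in_span cZ1 cZ2 Z1N Z2N zs z0 uV.
have dY1 : dble Y1 x0 by exact: Ck_dble (cY1 1%N) Ox0.
have dY2 : dble Y2 x0 by exact: Ck_dble (cY2 1%N) Ox0.
have dNx := dN Ox0.
have dZ2 : dble Z2 x0 by exact: Ck_dble (cZ2 1%N) Ox0.
have dZ1 : dble Z1 x0 by exact: Ck_dble (cZ1 1%N) Ox0.
rewrite dvD //; last exact: dble_mulmxl.
rewrite dv_mulmxl // /Z1 /Z2 !dvB //; try exact: dble_mulmxr.
by rewrite !dv_mulmxr // mulmxBl opprD addrACA.
Qed.

Definition lbr (U V : 'rV[R]_d -> 'rV[R]_d) := dv (U x0) V x0 - dv (V x0) U x0.

(** The expression splits into derivatives of Y along X minus derivatives of X along Y. Each lies in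
    the span up to a correction by [section_derivative], and the corrections cancel. *)
Theorem bracket_in_span (X1 X2 Y1 Y2 : 'rV[R]_d -> 'rV[R]_d) :
  (forall x, O x -> N x *m w x *m (N x)^T = 0) ->
  (forall k, Ck k O X1) -> (forall k, Ck k O X2) ->
  (forall x, O x -> X1 x *m w x *m (N x)^T = 0) ->
  (forall x, O x -> X2 x *m w x *m (N x)^T = 0) ->
  (forall x, O x -> in_span x (X1 x + X2 x *m J)) ->
  (forall k, Ck k O Y1) -> (forall k, Ck k O Y2) ->
  (forall x, O x -> Y1 x *m w x *m (N x)^T = 0) ->
  (forall x, O x -> Y2 x *m w x *m (N x)^T = 0) ->
  (forall x, O x -> in_span x (Y1 x + Y2 x *m J)) ->
  in_span x0 (lbr X1 Y1 - lbr X2 Y2 + (lbr X1 Y2 + lbr X2 Y1) *m J).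
Proof.
move=> NN cX1 cX2 X1N X2N xs cY1 cY2 Y1N Y2N ys.
have [a [b [yE Hy]]] := section_derivative cY1 cY2 Y1N Y2N NN ys.
have [a' [b' [xE Hx]]] := section_derivative cX1 cX2 X1N X2N NN xs.
have P1 := Hy _ (fun th => section_stab (th := th) cX1 X1N).
have P2 := in_spanJ (Hy _ (fun th => section_stab (th := th) cX2 X2N)).
have Q1 := Hx _ (fun th => section_stab (th := th) cY1 Y1N).
have Q2 := in_spanJ (Hx _ (fun th => section_stab (th := th) cY2 Y2N)).
have DNJ q' : DN (q' *m J) = DN q' *m J by rewrite /DN NJ.
have JJ' e (v : 'M[R]_(e, d)) : v *m J *m J = - v by rewrite -mulmxA JJ mulmxN mulmx1.
pose T (c e : 'rV[R]_n) u u' := c *m DN u + e *m DN u *m J + (c *m DN u' + e *m DN u' *m J) *m J.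
have TE c e u u' : T c e u u' = c *m DN (u + u' *m J) + e *m DN (u + u' *m J) *m J.
  rewrite /T DN_add DNJ !mulmxDr !mulmxA !mulmxDl addrACA.
  by [].
(* Both corrections are derivatives of fundamental fields, or their J-images, along such directions;
   commutativity exchanges the field and the direction. *)
have TT : T a b (X1 x0) (X2 x0) = T a' b' (Y1 x0) (Y2 x0).
  rewrite !TE xE yE !DN_add !DNJ !mulmxDr !mulmxA !mulmxDl !JJ'.
  have C (c e : 'rV[R]_n) : c *m DN (e *m N0) = e *m DN (c *m N0) by exact: N_comm.
  rewrite (C a a') (C a b') (C b a') (C b b').
  by rewrite -!addrA; congr (_ + _); rewrite addrCA.
have -> : lbr X1 Y1 - lbr X2 Y2 + (lbr X1 Y2 + lbr X2 Y1) *m J =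
  (dv (X1 x0) Y1 x0 + dv (X1 x0) Y2 x0 *m J - (a *m DN (X1 x0) + b *m DN (X1 x0) *m J)) +
  (dv (X2 x0) Y1 x0 + dv (X2 x0) Y2 x0 *m J - (a *m DN (X2 x0) + b *m DN (X2 x0) *m J)) *m J -
 ((dv (Y1 x0) X1 x0 + dv (Y1 x0) X2 x0 *m J - (a' *m DN (Y1 x0) + b' *m DN (Y1 x0) *m J)) +
  (dv (Y2 x0) X1 x0 + dv (Y2 x0) X2 x0 *m J - (a' *m DN (Y2 x0) + b' *m DN (Y2 x0) *m J)) *m J).
  rewrite !(mulmxBl _ _ J) /T in TT *.
  have AB (s t s' t' : 'rV[R]_d) : s - t + (s' - t') = (s + s') - (t + t').
    by rewrite opprD addrACA.
  rewrite !AB TT /lbr.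
  rewrite !mulmxDl !mulNmx !JJ'.
  rewrite (mulmxDl (dv (Y2 x0) X1 x0)).
  set T2 := a' *m DN (Y1 x0) + _ + (_ - b' *m DN (Y2 x0)).
  move: T2 (dv (X1 x0) Y2 x0 *m J) (dv (X2 x0) Y1 x0 *m J) (dv (Y2 x0) X1 x0 *m J)
    (dv (Y1 x0) X2 x0 *m J) (dv (X1 x0) Y1 x0) (dv (Y1 x0) X1 x0) (dv (X2 x0) Y2 x0)
    (dv (Y2 x0) X2 x0) => t r s r' s' p p' q q'.
  by apply/rowP => i; rewrite !mxE; ring.
by apply: in_spanD; [exact: in_spanD|apply: in_spanN; exact: in_spanD].
Qed.

End Local.

(** * The mixed polarization *)

Section BracketField.
Variables (R : realType) (d : nat) (M : manifold R d).
Implicit Types (c : chart R d M) (U V : set M) (q p : M).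

Lemma smoothF_chart_diff c k (F : M -> 'rV[R]_k) U : open U -> smooth_chart c ->
  smoothF U F -> smoothF (U `&` cdom c) (chart_diff F c).
Proof.
move=> oU sc sF; apply: smoothF_local => p [Up cp]; exists c, U; split=> // j.
have oc := open_chart_image (c:=c) oU.
apply: (Ck_eq oc _ (Ck_jac oc (sF c sc j.+1))).
by move=> _ [q [Uq cq] <-]; rewrite /= /chart_diff cmapK.
Qed.

Lemma smoothF_br c (X Y : M -> 'rV[R]_d) : smooth_chart c -> rsmooth setT X -> rsmooth setT Y ->
  smoothF (cdom c) (br c X Y).
Proof.
move=> sc sX sY; have oc := cdom_open c.
have h (Z : M -> 'rV[R]_d) : rsmooth setT Z -> smoothF (cdom c) (coord c Z).
  by move=> sZ; apply: smoothF_sub (sZ c sc) => q.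
have h' (Z : M -> 'rV[R]_d) : rsmooth setT Z -> smoothF (cdom c) (chart_diff (coord c Z) c).
  move=> sZ; apply: smoothF_sub (smoothF_chart_diff oc sc (h Z sZ)) => q cq; by split.
by apply: smoothF_sub_mx => //; apply: smoothF_mulmx => //; [exact: h|exact: h'|exact: h|exact: h'].
Qed.

Lemma lie_bracket_smooth (X Y : M -> 'rV[R[i]]_d) : smooth_field setT X -> smooth_field setT Y ->
  smooth_field setT (lie_bracket X Y).
Proof.
move=> /(smooth_fieldP _ openT)[sX1 sX2] /(smooth_fieldP _ openT)[sY1 sY2].
apply/(smooth_fieldP _ openT).
have br_at (U V : M -> 'rV[R]_d) c q : rsmooth setT U -> rsmooth setT V -> smooth_chart c -> cdom c q ->
    br (chart_at q) U V q *m tr (chart_at q) c q = br c U V q.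
  move=> sU sV sc cq; apply/esym/(br_tr openT) => //.
    exact: smooth_chart_at.
  exact: mem_chart_at.
split; apply: rsmooth_local => p _; exists (chart_at p), (cdom (chart_at p));
  have sb := @smooth_chart_at _ _ M p; have bp := mem_chart_at p; have ob := cdom_open (chart_at p);
  split=> //.
- apply: (smoothF_eq ob (F := fun q => br (chart_at p) (fun q => ReM (X q)) (fun q => ReM (Y q)) q -
       br (chart_at p) (fun q => ImM (X q)) (fun q => ImM (Y q)) q)).
    move=> q bq; rewrite /coord ReM_lie_bracket mulmxBl !br_at //.
  by apply: smoothF_sub_mx => //; exact: smoothF_br.
- apply: (smoothF_eq ob (F := fun q => br (chart_at p) (fun q => ReM (X q)) (fun q => ImM (Y q)) q +
       br (chart_at p) (fun q => ImM (X q)) (fun q => ReM (Y q)) q)).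
    move=> q bq; rewrite /coord ImM_lie_bracket mulmxDl !br_at //.
  by apply: smoothF_add => //; exact: smoothF_br.
Qed.

Lemma coord_chart_diff c k (F : M -> 'rV[R]_k) (X : M -> 'rV[R]_d) q : smooth_chart c -> cdom c q ->
  smoothF setT F -> coord c X q *m chart_diff F c q = X q *m diff_at F q.
Proof.
move=> sc cq sF; have bq := mem_chart_at q; have sb := @smooth_chart_at _ _ M q.
rewrite (chart_diffE openT _ sF sc sb cq bq) // /coord diff_atE -mulmxA.
by rewrite (mulmxA (tr _ _ _)) trK // mul1mx.
Qed.

(** [X, Y] F = X (Y F) - Y (X F) = 0: each half yields a second derivative of [F] along [X] and [Y],
    and these cancel by symmetry. *)
Lemma br_ker k (F : M -> 'rV[R]_k) (X Y : M -> 'rV[R]_d) p : smoothF setT F ->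
  rsmooth setT X -> rsmooth setT Y ->
  (forall q, X q *m diff_at F q = 0) -> (forall q, Y q *m diff_at F q = 0) ->
  br (chart_at p) X Y p *m diff_at F p = 0.
Proof.
move=> sF sX sY XF YF; pose b := chart_at p; have sb := @smooth_chart_at _ _ M p.
have bp : cdom b p := mem_chart_at p.
pose O := b @` cdom b; have oO : open O by exact: cimage_open.
have Op : O (b p) by exists p.
pose f := F \o cinv b.
have cf j : Ck j O f by apply: Ck_sub (sF b sb j) => _ [q bq <-]; exists q.
have key (Z W : M -> 'rV[R]_d) : rsmooth setT Z -> (forall q, Z q *m diff_at F q = 0) ->
    coord b W p *m chart_diff (coord b Z) b p *m jac f (b p) =
    - dv (coord b W p) (dv (coord b Z p) f) (b p).
  move=> sZ ZF; pose z := coord b Z \o cinv b.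
  have dz : dble z (b p) by apply: (Ck_dble (sZ b sb b sb 1%N)); exists p.
  have dj : dble (jac f) (b p) by exact: Ck_dble (Ck_jac oO (cf 2%N)) Op.
  have z0 y : O y -> z y *m jac f y = 0.
    move=> [q bq <-]; rewrite /z /= cmapK // -[jac f _]/(chart_diff F b q).
    by rewrite (coord_chart_diff _ sb bq sF).
  have E : dv (coord b W p) (fun y => z y *m jac f y) (b p) = 0.
    rewrite -(dv_cst (0 : 'rV[R]_k) (b p) (coord b W p)); apply: near_eq_dv.
    exact: (eq_open_near oO z0 Op).
  move: E; rewrite dv_mulmx // (dv_jac _ dz) {2}/z /= cmapK // => /eqP; rewrite addr_eq0 => /eqP ->.
  congr (- _); rewrite -dv_mulmxr //; apply: near_eq_dv.
  apply: (eq_open_near oO _ Op) => y Oy; rewrite dv_jac //.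
  exact: Ck_dble (cf 1%N) Oy.
rewrite diff_atE -/b -[chart_diff F b p]/(jac f (b p)) /br mulmxBl (key Y X) // (key X Y) //.
rewrite (dv_schwarz (coord b Y p) (coord b X p) oO Op (cf 2%N)).
by rewrite subrr.
Qed.

End BracketField.

(** * The action on a Kähler manifold, in holomorphic charts *)

Section Kaehler.
Variables (R : realType) (m n : nat) (M : manifold R (m + m)).
Variables (omega J : M -> 'M[R]_(m + m)) (rho : 'rV[R]_n -> M -> M) (mu : M -> 'rV[R]_n).
Hypothesis HK : kahler omega J.
Hypothesis act : torus_action rho.
Hypothesis Homega : forall x, preserves_form (rho x) omega.
Hypothesis HJ : forall x, preserves_endo (rho x) J.
Hypothesis Hmu : moment_map omega rho mu.
Implicit Types (c : chart R (m + m) M) (p q : M).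

Let d := (m + m)%N.
Local Notation N := (Nf rho).

Lemma smoothF_mu : smoothF setT mu.
Proof. exact/(smooth_map_smoothF mu openT)/(moment_smooth Hmu). Qed.

Lemma omega_skew p : (omega p)^T = - omega p.
Proof. exact: (symplectic_skew (kahler_symplectic HK)). Qed.

Lemma J_sq p : J p *m J p = - 1%:M.
Proof. exact: (complex_square (kahler_complex HK)). Qed.

(** For a skew omega and J of square -1, symmetry of the metric amounts to invariance of omega under
    J. *)
Lemma J_omega p : J p *m omega p *m (J p)^T = omega p.
Proof.
have := kahler_metric_symmetric HK p; rewrite /metric trmx_mul trmxK omega_skew => E.
have -> : J p *m omega p = - (omega p *m (J p)^T) by rewrite -E mulmxN opprK.
by rewrite mulNmx -mulmxA -trmx_mul J_sq linearN /= trmx1 mulmxN mulmx1 opprK.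
Qed.

Lemma g_pos p (v : 'rV[R]_d) : v != 0 -> 0 < (v *m (omega p *m (J p)^T) *m v^T) 0 0.
Proof. exact: (kahler_metric_positive HK). Qed.

Lemma dble_mu_chart c p : smooth_chart c -> cdom c p -> dble (mu \o cinv c) (c p).
Proof.
move=> sc cp; apply: (Ck_dble (smoothF_mu sc 1%N)); by exists p.
Qed.

(** The moment map equation tested on basis vectors; it identifies ker (d mu) with the orthogonal of
    the orbit directions. *)
Lemma omega_N p : omega p *m (N p)^T = diff_at mu p.
Proof.
have sb := @smooth_chart_at _ _ M p; have bp := mem_chart_at p.
have dm := dble_mu_chart sb bp.
have E (xi : 'rV[R]_n) (v : 'rV[R]_d) :
    v *m omega p *m (xi *m N p)^T = v *m diff_at mu p *m xi^T.
  rewrite -(fundamental_Nf act) (moment_hamiltonian Hmu) !diff_atE /chart_diff.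
  have dme : dble (mu_comp mu xi \o cinv (chart_at p)) (chart_at p p) by exact: (dble_mulmxl xi^T dm).
  by rewrite -(dv_jac _ dme) -(dv_jac _ dm) -(dv_mulmxl _ _ dm).
apply/matrixP => i j.
have := E (delta_mx 0 j) (delta_mx 0 i); rewrite trmx_mul mulmxA -!rowE !trmx_delta -!colE.
by rewrite -row_mul => /matrixP/(_ 0 0); rewrite !mxE.
Qed.

(** Differentiate the invariance of [mu] along an orbit. Together with [omega_N] this says that
    orbits are isotropic. *)
Lemma N_dmu p : N p *m diff_at mu p = 0.
Proof.
have sb := @smooth_chart_at _ _ M p; have bp := mem_chart_at p.
have dm := dble_mu_chart sb bp.
apply/row_matrixP => i; rewrite row0 row_mul rowE -(fundamental_Nf act).
set th := delta_mx 0 i; set b := chart_at p in sb bp dm *.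
have r0 : rho 0 p = p by exact: torus_act0.
pose g (t : R) := rhoF rho b b (row_mx 0 (b p) + t *: row_mx th 0).
have gE t : g t = b (rho (t *: th) p).
  by rewrite /g row_mx_line add0r scaler0 addr0 (rhoFE _ _ bp).
have dg : dble g 0.
  apply: dble_line; rewrite scale0r addr0; apply: (rhoF_dble act) => //.
  by rewrite r0.
have g0 : g 0 = b p by rewrite gE scale0r r0.
have -> : fundamental rho th p = dv (1 : R) g 0.
  by rewrite (fundamental_dv rho) dv_line scale0r addr0.
rewrite diff_atE -/b -(dv_jac _ dm) -(dv_comp _ dg g0 dm).
rewrite -(dv_cst (mu p) (0 : R) (1 : R)); apply: near_eq_dv.
apply: filterS (rho_near0 act th bp) => t bt.
by rewrite /= gE cmapK // (moment_invariant Hmu).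
Qed.

Definition wF c q := tr c (chart_at q) q *m omega q *m (tr c (chart_at q) q)^T.

Lemma form_in_chartE c x : form_in_chart c omega x = wF c (cinv c x).
Proof. by rewrite /form_in_chart coord_frameE. Qed.

Lemma wF_tr c c' q : smooth_chart c -> smooth_chart c' -> cdom c q -> cdom c' q ->
  wF c q = tr c c' q *m wF c' q *m (tr c c' q)^T.
Proof.
move=> sc sc' cq c'q; rewrite /wF (tr_comp sc sc' (@smooth_chart_at _ _ M q) cq c'q (mem_chart_at q)).
by rewrite trmx_mul !mulmxA.
Qed.

Lemma smoothF_wF c : smooth_chart c -> smoothF (cdom c) (wF c).
Proof.
move=> sc; apply: smoothF_pointwise => p cp; pose b := chart_at p.
have sb := @smooth_chart_at _ _ M p; have bp := mem_chart_at p; rewrite -/b in sb bp.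
pose V := cdom c `&` cdom b; have oV : open V by apply: openI; exact: cdom_open.
exists V; split=> //.
have sw : smoothF V (wF b).
  apply: smoothF_local => q [cq bq]; exists b, (cdom b); split=> //; first exact: cdom_open.
  rewrite setIid => k; apply: Ck_eq (symplectic_smooth (kahler_symplectic HK) p k).
    exact: cimage_open.
  by move=> x _; rewrite form_in_chartE.
apply: (smoothF_eq oV (F := fun q => tr c b q *m wF b q *m (tr c b q)^T)).
  by move=> q [cq bq]; rewrite -wF_tr.
have sT := smoothF_tr sc sb.
apply: smoothF_mulmx => //; first exact: smoothF_mulmx.
by move=> e se k; apply: (Ck_tr (open_chart_image oV) (sT e se k)).
Qed.

Section Holomorphic.
Variable c : chart R (m + m) M.
Hypothesis hc : holomorphic_chart J c.
Let sc : smooth_chart c. Proof. by case: hc. Qed.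
Local Notation J0 := (J_std R m).
Local Notation t q := (tr (chart_at q) c q).
Local Notation t' q := (tr c (chart_at q) q).

Lemma hol_J q : cdom c q -> J q *m t q = t q *m J0.
Proof. by case: hc => _ H cq; rewrite -diff_at_chart; exact: H. Qed.

Let tt' q : cdom c q -> t q *m t' q = 1%:M.
Proof.
move=> cq; apply: trK => //; [exact: smooth_chart_at|exact: mem_chart_at].
Qed.

Let t't q : cdom c q -> t' q *m t q = 1%:M.
Proof.
move=> cq; apply: trK => //; [exact: smooth_chart_at|exact: mem_chart_at].
Qed.

Lemma hol_J' q : cdom c q -> t' q *m J q = J0 *m t' q.
Proof.
move=> cq; rewrite -[LHS]mulmx1 -(tt' cq) -mulmxA (mulmxA (J q)) hol_J //.
by rewrite !mulmxA t't // mul1mx.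
Qed.

Lemma J0_sq : J0 *m J0 = - 1%:M.
Proof.
rewrite /J_std mulmx_block !mul0mx !mulmx0 !addr0 !add0r mul1mx mulmx1.
by rewrite scalar_mx_block opp_block_mx oppr0.
Qed.

Lemma wF_J q : cdom c q -> J0 *m wF c q *m J0^T = wF c q.
Proof.
move=> cq; rewrite /wF !mulmxA -hol_J' // -[LHS]mulmxA -trmx_mul -hol_J' // trmx_mul !mulmxA.
by rewrite -(mulmxA (t' q) (J q)) -(mulmxA (t' q) _ (J q)^T) J_omega.
Qed.

Lemma wF_skew q : (wF c q)^T = - wF c q.
Proof. by rewrite /wF !trmx_mul trmxK omega_skew mulNmx mulmxN mulmxA. Qed.

Lemma wF_pos q (v : 'rV[R]_d) : cdom c q -> v != 0 ->
  0 < (v *m (wF c q *m J0^T) *m v^T) 0 0.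
Proof.
move=> cq v0.
have vt : v *m t' q != 0.
  apply: contra v0 => /eqP E; rewrite -[v]mulmx1 -(t't cq) mulmxA E mul0mx //.
have := g_pos q vt; rewrite trmx_mul.
have -> : v *m t' q *m (omega q *m (J q)^T) *m ((t' q)^T *m v^T) =
  v *m (t' q *m omega q *m (t' q *m J q)^T) *m v^T by rewrite (trmx_mul (t' q)) !mulmxA.
by rewrite hol_J' // trmx_mul /wF !mulmxA.
Qed.

(** Translates the condition d mu = 0 into the orthogonality to [N] used by the local theorem. *)
Lemma coord_wF a (X : M -> 'M[R]_(a, d)) q : cdom c q ->
  coord c X q *m wF c q *m (coord c N q)^T = X q *m diff_at mu q.
Proof.
move=> cq; rewrite /coord /wF -omega_N (trmx_mul (N q)).
have -> : X q *m t q *m (t' q *m omega q *m (t' q)^T) *m ((t q)^T *m (N q)^T) =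
  X q *m (t q *m t' q) *m omega q *m (t q *m t' q)^T *m (N q)^T.
  by rewrite (trmx_mul (t q)) !mulmxA.
by rewrite tt' // trmx1 !mulmx1 mulmxA.
Qed.

Local Notation F := (rhoF rho c c).
Local Notation O := (rhoO rho c setT (cdom c)).
Local Notation Nc := (fun x => coord c N (cinv c x)).

Let dNc q : cdom c q -> dble Nc (c q).
Proof.
move=> cq; apply: (Ck_dble (rsmooth_Nf act sc sc 1%N)); by exists q.
Qed.

Lemma dv_rhoF_J h q v : cdom c q -> cdom c (rho h q) ->
  dv (row_mx 0 (v *m J0)) F (row_mx h (c q)) = dv (row_mx 0 v) F (row_mx h (c q)) *m J0.
Proof.
move=> cq cr; rewrite !(dv_rhoF_tangent act) //.
rewrite -(mulmxA v) -hol_J' // -!mulmxA -hol_J // !mulmxA; congr (_ *m _).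
by rewrite -!mulmxA HJ.
Qed.

(** The maps [rho h] are holomorphic, and differentiating in [h] at the identity passes this to the
    fundamental fields. *)
Lemma dv_N_J q v : cdom c q -> dv (v *m J0) Nc (c q) = dv v Nc (c q) *m J0.
Proof.
move=> cq; have r0 : rho 0 q = q by exact: torus_act0.
have cr : cdom c (rho 0 q) by rewrite r0.
apply/row_matrixP => i; rewrite row_mul !rowE; set th := delta_mx 0 i.
have mix u : th *m dv u Nc (c q) = dv (row_mx th 0) (dv (row_mx 0 u) F) (row_mx 0 (c q)).
  by rewrite (dv_rhoF_mixed act) // (dv_rhoF0 act) // r0 dv_mulmxr //; exact: dNc.
rewrite !mix.
have Oh : O (row_mx 0 (c q)) by apply: rhoO_in.
have oO : open O by exact: open_rhoO'.
rewrite -dv_mulmxl; last by exact: Ck_dble (Ck_dv _ (rhoF_smooth act sc sc 2%N)) Oh.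
apply: near_eq_dv; apply: (eq_open_near oO _ Oh) => _ /rhoO_elim[h' [q' [cq' cu ->]]].
exact: dv_rhoF_J.
Qed.

Lemma dv_N_comm q (th th' : 'rV[R]_n) : cdom c q ->
  th' *m dv (th *m Nc (c q)) Nc (c q) = th *m dv (th' *m Nc (c q)) Nc (c q).
Proof.
move=> cq; have := fundamental_commute act sc th th' cq.
by rewrite !dv_mulmxr ?cmapK //; exact: dNc.
Qed.

Lemma rhoF_form h q (u v : 'rV[R]_d) : cdom c q -> cdom c (rho h q) ->
  dv (row_mx 0 u) F (row_mx h (c q)) *m wF c (rho h q) *m (dv (row_mx 0 v) F (row_mx h (c q)))^T =
  u *m wF c q *m v^T.
Proof.
move=> cq cr; rewrite !(dv_rhoF_tangent act) // /wF; set r := rho h q.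
set T := tangent_map _ _.
have -> : u *m t' q *m T *m t r *m (t' r *m omega r *m (t' r)^T) *m (v *m t' q *m T *m t r)^T =
  u *m t' q *m (T *m (t r *m t' r) *m omega r *m (T *m (t r *m t' r))^T) *m (v *m t' q)^T.
  by rewrite !trmx_mul !mulmxA.
by rewrite tt' // mulmx1 Homega trmx_mul !mulmxA.
Qed.

(** Differentiate [rhoF_form] in the group direction [th] at the identity; the derivative of omega
    drops out because [th N] is zero at [q]. *)
Lemma dv_N_symp q (th : 'rV[R]_n) : cdom c q -> th *m Nc (c q) = 0 -> forall u v : 'rV[R]_d,
  th *m dv u Nc (c q) *m wF c q *m v^T + u *m wF c q *m (th *m dv v Nc (c q))^T = 0.
Proof.
move=> cq th0 u v; have r0 : rho 0 q = q by exact: torus_act0.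
have cr : cdom c (rho 0 q) by rewrite r0.
have Oh : O (row_mx 0 (c q)) by apply: rhoO_in.
have oO : open O by exact: open_rhoO'.
pose D e := dv (row_mx 0 e) F.
have dD e : dble (D e) (row_mx 0 (c q)).
  exact: Ck_dble (Ck_dv _ (rhoF_smooth act sc sc 2%N)) Oh.
have mix e : dv (row_mx th 0) (D e) (row_mx 0 (c q)) = th *m dv e Nc (c q).
  by rewrite /D (dv_rhoF_mixed act) // (dv_rhoF0 act) // r0 dv_mulmxr //; exact: dNc.
have dF : dble F (row_mx 0 (c q)) by exact: (dble_rhoF act).
have Fq : F (row_mx 0 (c q)) = c q by rewrite (rhoFE _ _ cq) r0.
have dw : dble (wF c \o cinv c) (c q).
  by apply: (Ck_dble (smoothF_wF sc sc 1%N)); exists q.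
pose W := (wF c \o cinv c) \o F.
have dW : dble W (row_mx 0 (c q)) by exact: (dble_comp dF Fq dw).
have W0 : dv (row_mx th 0) W (row_mx 0 (c q)) = 0.
  rewrite (dv_comp _ dF Fq dw) (dv_rhoF_act act) // r0.
  by move: th0; rewrite /= cmapK // => ->; rewrite dv_dir0.
have E : dv (row_mx th 0) (fun y => D u y *m W y *m (D v y)^T) (row_mx 0 (c q)) = 0.
  transitivity (dv (row_mx th 0) (fun y => u *m wF c (cinv c (rsubmx y)) *m v^T) (row_mx 0 (c q))).
    apply: near_eq_dv; apply: (eq_open_near oO _ Oh) => _ /rhoO_elim[h' [q' [cq' cu ->]]].
    rewrite /W /= (rhoFE _ _ cq') (cmapK cu) row_mxKr (cmapK cq'); exact: rhoF_form.
  rewrite -[X in dv _ _ X]addr0 -(scale0r (row_mx th 0)) -dv_line.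
  rewrite -[RHS](dv_cst (u *m wF c q *m v^T) (0 : R) (1 : R)); congr (dv _ _ _); apply/funext => s.
  by rewrite row_mx_line scaler0 addr0 row_mxKr cmapK.
have dDW : dble (fun y => D u y *m W y) (row_mx 0 (c q)) by exact: (dble_mulmx (dD u) dW).
move: E; rewrite (dv_mulmx _ dDW (dble_tr (dD v))) (dv_mulmx _ (dD u) dW) W0 mulmx0 addr0.
rewrite dv_tr // !mix /D !(dv_rhoF0 act) // /W /= Fq cmapK //.
Qed.

End Holomorphic.
End Kaehler.

(** * Involutivity of the mixed polarization *)

Section Involutive.
Variables (R : realType) (m n : nat) (M : manifold R (m + m)).
Variables (omega J : M -> 'M[R]_(m + m)) (rho : 'rV[R]_n -> M -> M) (mu : M -> 'rV[R]_n).
Hypothesis HK : kahler omega J.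
Hypothesis act : torus_action rho.
Hypothesis Homega : forall x, preserves_form (rho x) omega.
Hypothesis HJ : forall x, preserves_endo (rho x) J.
Hypothesis Hmu : moment_map omega rho mu.
Implicit Types (c : chart R (m + m) M) (p q : M).

Let d := (m + m)%N.
Local Notation N := (Nf rho).

Lemma IRP p (v : 'rV[R]_d) : IR rho p v <-> exists a, v = a *m N p.
Proof.
split=> [[a _ <-]|[a ->]]; first by exists a; rewrite (fundamental_Nf act).
by exists a => //; rewrite (fundamental_Nf act).
Qed.

(** The eigenvector equation has two real components; multiplying one by J gives the other. *)
Lemma PJP p (v : 'rV[R[i]]_d) : PJ J p v <-> ReM v + ImM v *m J p = 0.
Proof.
rewrite /PJ /=; split=> [E|E].
  have := congr1 (@ImM R 1 d) E; rewrite ImM_mulr scaleNr ImM_N ImM_i => ->.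
  by rewrite subrr.
have E1 : ImM v *m J p = - ReM v by apply/eqP; rewrite -addr_eq0 addrC; apply/eqP.
apply: ReIm_inj; rewrite ?ReM_mulr ?ImM_mulr scaleNr ?ReM_N ?ImM_N ?ReM_i ?ImM_i ?opprK //.
have : (ReM v + ImM v *m J p) *m J p = 0 by rewrite E mul0mx.
by rewrite mulmxDl -mulmxA (J_sq HK) mulmxN mulmx1 => /eqP; rewrite subr_eq0 => /eqP.
Qed.

(* Re v + (Im v) J is, up to a factor, the (1,0)-part of v; membership in the
   mixed polarization only constrains this part and d mu. *)
Lemma PmixP p (v : 'rV[R[i]]_d) : Pmix J rho mu p v <->
  [/\ ReM v *m diff_at mu p = 0, ImM v *m diff_at mu p = 0 &
      exists a b : 'rV[R]_n, ReM v + ImM v *m J p = a *m N p + b *m N p *m J p].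
Proof.
have ND (a : 'rV[R]_n) : a *m N p *m diff_at mu p = 0.
  by rewrite -mulmxA (N_dmu act Hmu) mulmx0.
split=> [[x [/PJP xJ /complexifyP[x1 x2]] [y /complexifyP[/IRP[a aE] /IRP[b bE]] <-]]|[v1 v2 [a [b E]]]].
  rewrite !ReM_D !ImM_D aE bE; split.
  - by rewrite mulmxDl ND addr0.
  - by rewrite mulmxDl ND addr0.
  - by exists a, b; rewrite mulmxDl addrACA xJ add0r.
pose y := toC (a *m N p) + 'i%C *: toC (b *m N p).
have y1 : ReM y = a *m N p by rewrite ReM_D ReM_i ReM_toC ImM_toC oppr0 addr0.
have y2 : ImM y = b *m N p by rewrite ImM_D ImM_i ReM_toC ImM_toC add0r.
exists (v - y); last first.
  exists y; last by rewrite subrK.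
  by apply/complexifyP; rewrite y1 y2; split; apply/IRP; [exists a|exists b].
split.
  apply/PJP; rewrite !ReM_D !ImM_D ReM_N ImM_N y1 y2 mulmxBl addrACA E.
  by rewrite -opprD subrr.
apply/complexifyP; rewrite ReM_D ReM_N ImM_D ImM_N y1 y2 /DR /= !mulmxBl !ND v1 v2.
by rewrite subrr.
Qed.

(** The two d mu conditions come from [br_ker]. The span condition is [bracket_in_span] read in a
    holomorphic chart, where J is the constant [J_std], and carried back by the invertible
    transition matrix. *)
Lemma Pmix_involutive : involutive (Pmix J rho mu).
Proof.
move=> X Y [sX PX] [sY PY]; split; first exact: lie_bracket_smooth.
have [sX1 sX2] := (smooth_fieldP X openT).1 sX.
have [sY1 sY2] := (smooth_fieldP Y openT).1 sY.
move=> p _.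
pose X1 q := ReM (X q); pose X2 q := ImM (X q).
pose Y1 q := ReM (Y q); pose Y2 q := ImM (Y q).
have HX q := (PmixP q (X q)).1 (PX q I).
have HY q := (PmixP q (Y q)).1 (PY q I).
have X1m q : X1 q *m diff_at mu q = 0 by case: (HX q).
have X2m q : X2 q *m diff_at mu q = 0 by case: (HX q).
have Y1m q : Y1 q *m diff_at mu q = 0 by case: (HY q).
have Y2m q : Y2 q *m diff_at mu q = 0 by case: (HY q).
have smu := smoothF_mu Hmu.
apply/PmixP; rewrite ReM_lie_bracket ImM_lie_bracket; split.
- by rewrite mulmxBl !(br_ker _ smu) // subrr.
- by rewrite mulmxDl !(br_ker _ smu) // addr0.
have [c [hc cp]] := complex_integrable (kahler_complex HK) p.
have sc : smooth_chart c by case: hc.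
pose O := c @` cdom c; have oO : open O by exact: cimage_open.
have Op : O (c p) by exists p.
pose e a (Z : M -> 'M[R]_(a, d)) x := coord c Z (cinv c x).
have ce a (Z : M -> 'M[R]_(a, d)) : rsmooth setT Z -> forall k, Ck k O (e a Z).
  by move=> sZ k; apply: Ck_sub (sZ c sc c sc k) => _ [q cq <-]; exists q.
have cN := ce _ _ (rsmooth_Nf act).
pose w x := wF omega c (cinv c x).
have cw k : Ck k O w.
  by apply: Ck_sub (smoothF_wF HK sc sc k) => _ [q cq <-]; exists q.
have ker a (Z : M -> 'M[R]_(a, d)) : (forall q, Z q *m diff_at mu q = 0) ->
    forall x, O x -> e a Z x *m w x *m (e n N x)^T = 0.
  by move=> Zm _ [q cq <-]; rewrite /e /w cmapK // (coord_wF act Hmu hc Z cq).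
have NN := ker _ N (N_dmu act Hmu).
have span (Z1 Z2 : M -> 'rV[R]_d) :
    (forall q, exists a b : 'rV[R]_n, Z1 q + Z2 q *m J q = a *m N q + b *m N q *m J q) ->
    forall x, O x -> in_span (e n N) (J_std R m) x (e 1%N Z1 x + e 1%N Z2 x *m J_std R m).
  move=> HZ _ [q cq <-]; have [a [b E]] := HZ q; apply/in_spanP; exists a, b.
  rewrite /e cmapK // /coord !mulmxA -2!(mulmxA _ (tr _ _ _) (J_std R m)) -(hol_J hc cq).
  by rewrite !mulmxA -!mulmxDl E.
have HX3 q : exists a b : 'rV[R]_n, X1 q + X2 q *m J q = a *m N q + b *m N q *m J q by case: (HX q).
have HY3 q : exists a b : 'rV[R]_n, Y1 q + Y2 q *m J q = a *m N q + b *m N q *m J q by case: (HY q).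
have w_skew : (w (c p))^T = - w (c p) by exact: (wF_skew HK).
have Jw x : O x -> J_std R m *m w x *m (J_std R m)^T = w x.
  by move=> [q cq <-]; rewrite /w cmapK //; exact: (wF_J HK hc).
have gpos (v : 'rV[R]_d) : v != 0 -> 0 < (v *m (w (c p) *m (J_std R m)^T) *m v^T) 0 0.
  by rewrite /w cmapK //; exact: (wF_pos HK hc).
have NJ x (q : 'rV[R]_d) : O x -> dv (q *m J_std R m) (e n N) x = dv q (e n N) x *m J_std R m.
  by move=> [r cr <-]; exact: (dv_N_J act HJ hc).
have Ncomm x (th th' : 'rV[R]_n) : O x ->
    th' *m dv (th *m e n N x) (e n N) x = th *m dv (th' *m e n N x) (e n N) x.
  by move=> [r cr <-]; exact: (dv_N_comm act hc).
have Nsymp (th : 'rV[R]_n) : th *m e n N (c p) = 0 -> forall u v : 'rV[R]_d,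
    th *m dv u (e n N) (c p) *m w (c p) *m v^T + u *m w (c p) *m (th *m dv v (e n N) (c p))^T = 0.
  by move=> th0 u v; rewrite /w cmapK //; exact: (dv_N_symp HK act Homega hc cp th0).
have Nrigid : exists V, [/\ open V, V (c p) & forall k : 'rV[R]_n, k *m e n N (c p) = 0 ->
    (forall v, k *m dv v (e n N) (c p) = 0) -> forall x, V x -> k *m e n N x = 0].
  have [V [oV Vp Vc HV]] := fundamental_rigid act sc cp.
  exists (c @` (V `&` cdom c)); split; first exact: open_chart_image; first by exists p.
  move=> k k0 dk _ [q [Vq cq] <-]; rewrite /e cmapK //; apply: HV => //.
    by move: k0; rewrite /e cmapK.
  move=> v; rewrite dv_mulmxr; first exact: dk.
  exact: (Ck_dble (cN 1%N)).
have := bracket_in_span oO Op cN cw w_skew (J0_sq R m) Jw gpos (NN _ Op) NJ Ncomm Nsymp Nrigid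
  NN (ce _ _ sX1) (ce _ _ sX2) (ker _ _ X1m) (ker _ _ X2m) (span _ _ HX3)
  (ce _ _ sY1) (ce _ _ sY2) (ker _ _ Y1m) (ker _ _ Y2m) (span _ _ HY3).
have lbrE (U V : M -> 'rV[R]_d) : rsmooth setT U -> rsmooth setT V ->
    lbr (c p) (e 1%N U) (e 1%N V) = br (chart_at p) U V p *m tr (chart_at p) c p.
  move=> sU sV; rewrite -(br_tr openT I sU sV (@smooth_chart_at _ _ M p) sc (mem_chart_at p) cp).
  have de (Z : M -> 'rV[R]_d) : rsmooth setT Z -> dble (coord c Z \o cinv c) (c p).
    by move=> sZ; exact: (Ck_dble (ce _ _ sZ 1%N)).
  rewrite /lbr /br -(dv_jac _ (de _ sU)) -(dv_jac _ (de _ sV)) /e cmapK //.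
rewrite !lbrE // => /in_spanP[a [b]]; rewrite /e cmapK // /coord => E.
exists a, b; set t := tr (chart_at p) c p in E *.
have t_inj (u v : 'rV[R]_d) : u *m t = v *m t -> u = v.
  move=> /(congr1 (mulmx^~ (tr c (chart_at p) p))); rewrite -!mulmxA trK ?mulmx1 //.
    exact: smooth_chart_at.
  exact: mem_chart_at.
have tJ (u v : 'rV[R]_d) : (u + v *m J p) *m t = u *m t + v *m t *m J_std R m.
  by rewrite mulmxDl -2!(mulmxA v) (hol_J hc cp).
by apply: t_inj; rewrite tJ mulmxBl (mulmxDl (br _ _ _ _) (br _ _ _ _)) E tJ !mulmxA.
Qed.

End Involutive.

Section ComplexScale.
Variable R : realType.

Lemma ReM_Z a b (x : R[i]) (A : 'M[R[i]]_(a, b)) :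
  ReM (x *: A) = complex.Re x *: ReM A - complex.Im x *: ImM A.
Proof. by apply/matrixP => i j; rewrite !mxE; case: x; case: (A i j). Qed.

Lemma ImM_Z a b (x : R[i]) (A : 'M[R[i]]_(a, b)) :
  ImM (x *: A) = complex.Re x *: ImM A + complex.Im x *: ReM A.
Proof. by apply/matrixP => i j; rewrite !mxE; case: x; case: (A i j). Qed.

End ComplexScale.

(** * Linear algebra of the fibres: direct sum, real part, Lagrangian property *)

Section Pointwise.
Variables (R : realType) (m n : nat) (M : manifold R (m + m)).
Variables (omega J : M -> 'M[R]_(m + m)) (rho : 'rV[R]_n -> M -> M) (mu : M -> 'rV[R]_n).
Hypothesis HK : kahler omega J.
Hypothesis act : torus_action rho.
Hypothesis Hmu : moment_map omega rho mu.
Implicit Types (c : chart R (m + m) M) (p q : M).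

Let d := (m + m)%N.
Local Notation N := (Nf rho).
Local Notation T p := (diff_at mu p).

Let J_omega' p : J p *m omega p = - (omega p *m (J p)^T).
Proof.
rewrite -{2}(J_omega HK p) -!mulmxA -trmx_mul (J_sq HK) linearN /= trmx1.
by rewrite !mulmxN mulmx1 opprK.
Qed.

Let JJ' p e (v : 'M[R]_(e, d)) : v *m J p *m J p = - v.
Proof. by rewrite -mulmxA (J_sq HK) mulmxN mulmx1. Qed.

Let NT p e (v : 'M[R]_(e, n)) : v *m N p *m T p = 0.
Proof. by rewrite -mulmxA (N_dmu act Hmu) mulmx0. Qed.

(** By [omega_N], pairing the hypothesis with [b] gives g(b N, b N) = 0 up to sign. *)
Lemma fundamental_J_ker p (b : 'rV[R]_n) : b *m N p *m J p *m T p = 0 -> b *m N p = 0.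
Proof.
move=> E; apply: (g_eq0 (@g_pos _ _ _ _ _ HK p)).
have : b *m N p *m J p *m (omega p *m (N p)^T) *m b^T = 0 by rewrite (omega_N act Hmu) E mul0mx.
rewrite !mulmxA -(mulmxA (b *m N p) (J p)) J_omega' mulmxN !mulNmx => /eqP.
by rewrite oppr_eq0 => /eqP E2; rewrite (trmx_mul b) mulmxA -[RHS]E2 !mulmxA.
Qed.

(** For [v] in both summands, [Re v = - (Im v) J] with [Im v] tangent to the orbit and [(Im v) J] in
    ker (d mu), so [fundamental_J_ker] gives [Im v = 0]. *)
Lemma Pmix_direct p :
  (PJ J p `&` complexify (DR mu p)) `&` complexify (IR rho p) = [set 0].
Proof.
apply/seteqP; split=> v /=; last first.
  move=> ->; have R0 : ReM (0 : 'rV[R[i]]_d) = 0 by apply/matrixP => i j; rewrite !mxE.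
  have I0 : ImM (0 : 'rV[R[i]]_d) = 0 by apply/matrixP => i j; rewrite !mxE.
  split; last by apply/complexifyP; rewrite R0 I0; split; apply/(IRP act); exists 0; rewrite mul0mx.
  split; first by apply/(PJP HK); rewrite R0 I0 mul0mx addr0.
  by apply/complexifyP; rewrite R0 I0 /DR /= mul0mx.
move=> [[/(PJP HK) vJ /complexifyP[D1 D2]] /complexifyP[/(IRP act)[a aE] /(IRP act)[b bE]]].
have r : ReM v = - (ImM v *m J p) by apply/eqP; rewrite -addr_eq0; apply/eqP.
have i0 : ImM v = 0.
  rewrite bE; apply: fundamental_J_ker; rewrite -bE.
  by move: D1; rewrite /DR /= r mulNmx => /eqP; rewrite oppr_eq0 => /eqP.
have Z0 (f : R[i] -> R) : f 0 = 0 -> 0 = map_mx f (0 : 'rV[R[i]]_d).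
  by move=> f0; apply/matrixP => i j; rewrite !mxE f0.
by apply: ReIm_inj; [rewrite r i0 mul0mx oppr0|rewrite i0]; exact: Z0.
Qed.

(** Multiplying [v] by the scalar x + i y applies x + y J to [Re v + (Im v) J], which preserves the
    span of [N] and [N J]. *)
Lemma Pmix_subspace p : subspace (Pmix J rho mu p).
Proof.
split.
  apply/(PmixP HK act Hmu).
  have -> : ReM (0 : 'rV[R[i]]_d) = 0 by apply/matrixP => i j; rewrite !mxE.
  have -> : ImM (0 : 'rV[R[i]]_d) = 0 by apply/matrixP => i j; rewrite !mxE.
  by rewrite !mul0mx; split=> //; exists 0, 0; rewrite !mul0mx.
move=> x u v /(PmixP HK act Hmu)[u1 u2 [a [b uE]]] /(PmixP HK act Hmu)[v1 v2 [a' [b' vE]]].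
apply/(PmixP HK act Hmu); rewrite ReM_D ImM_D ReM_Z ImM_Z; split.
- by rewrite !mulmxDl mulNmx -!scalemxAl u1 u2 v1 !scaler0 oppr0 !addr0.
- by rewrite !mulmxDl -!scalemxAl u1 u2 v2 !scaler0 !addr0.
case: x => x y /=.
exists (x *: a - y *: b + a'), (x *: b + y *: a + b').
have -> : x *: ReM u - y *: ImM u + ReM v + (x *: ImM u + y *: ReM u + ImM v) *m J p =
   x *: (ReM u + ImM u *m J p) + y *: ((ReM u + ImM u *m J p) *m J p) + (ReM v + ImM v *m J p).
  rewrite !mulmxDl JJ' -!scalemxAl; move: (ReM u *m J p) (ImM u *m J p) (ImM v *m J p) => r s t.
  by apply/rowP => i; rewrite !mxE; ring.
rewrite uE vE !mulmxDl !mulNmx -!scalemxAl JJ'.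
move: (a *m N p) (b *m N p) (a *m N p *m J p) (b *m N p *m J p) => r s r' s'.
move: (a' *m N p) (b' *m N p *m J p) => t t'.
by apply/rowP => i; rewrite !mxE; ring.
Qed.

(** A real [v] of the fibre is [a N + b N J], and killing it by d mu leaves [b N J] in ker (d mu),
    hence [b N = 0]. *)
Lemma Pmix_real_part p : real_part (Pmix J rho mu p) = [set v | (v <= N p)%MS].
Proof.
have conjC (v : 'rV[R]_d) : map_mx (@conjc R) (toC v) = toC v.
  by apply/matrixP => i j; rewrite !mxE /= oppr0.
apply/seteqP; split=> v /=.
  move=> [/(PmixP HK act Hmu)[vT _ [a [b E]]] _].
  rewrite ReM_toC in vT; rewrite ReM_toC ImM_toC mul0mx addr0 in E.
  have : b *m N p = 0.
    by apply: fundamental_J_ker; move: vT; rewrite E mulmxDl NT add0r.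
  by move=> b0; rewrite E b0 mul0mx addr0 submxMl.
move=> /submxP[a E].
have Pv : Pmix J rho mu p (toC v).
  apply/(PmixP HK act Hmu); rewrite ReM_toC ImM_toC mul0mx E NT; split=> //.
  by exists a, 0; rewrite !mul0mx !addr0.
by split=> //; exists (toC v) => //; exact: conjC.
Qed.

Lemma regular_row_free p : regular_points rho p <-> row_free (N p).
Proof.
have cp := mem_chart_at p; have sb := @smooth_chart_at _ _ M p.
split=> [[B [_ BE]]|Nfree].
  rewrite -kermx_eq0; apply/eqP/row_matrixP => i; rewrite row0; set th := row i _.
  have th0 : th *m N p = 0 by apply/sub_kermxP; exact: row_sub.
  have : stabilizer_lie rho p th.
    by move=> t; apply: (fundamental0_fix act sb cp); rewrite coord_at.
  by rewrite BE /= => /submxP[D ->]; rewrite [D]thinmx0 mul0mx.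
exists 0; split; first by rewrite /row_free mxrank0.
apply/seteqP; split=> th /=.
  move=> fx; have := fix_fundamental0 act sb cp fx; rewrite coord_at => th0.
  by rewrite (row_free_inj Nfree (_ : th *m N p = 0 *m N p)) ?sub0mx // th0 mul0mx.
by move=> /submxP[D ->]; rewrite mulmx0 => t; rewrite scaler0 (torus_act0 act).
Qed.

Lemma real_rank_Pmix : real_rank_on (regular_points rho) (Pmix J rho mu) n.
Proof. by move=> p /regular_row_free Nfree; exists (N p); rewrite Pmix_real_part. Qed.

(** Equal to [N J omega N^T] by [omega_N], hence minus the Gram matrix of the fundamental fields for
    g. *)
Definition gram p := N p *m J p *m T p.

(** Turns regularity into invertibility of a matrix that is smooth in charts, an open condition; the
    inverse enters the projector. *)
Lemma gram_unit p : regular_points rho p <-> gram p \in unitmx.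
Proof.
split=> [/regular_row_free Nfree|gu].
  rewrite -row_free_unit -kermx_eq0; apply/eqP/row_matrixP => i; rewrite row0; set th := row i _.
  have : th *m gram p = 0 by apply/sub_kermxP; exact: row_sub.
  rewrite /gram !mulmxA => /fundamental_J_ker E.
  by apply: (row_free_inj Nfree); rewrite E mul0mx.
apply/regular_row_free; rewrite -kermx_eq0; apply/eqP/row_matrixP => i; rewrite row0; set th := row i _.
have th0 : th *m N p = 0 by apply/sub_kermxP; exact: row_sub.
by rewrite -[th](mulmxK gu) /gram !mulmxA th0 !mul0mx.
Qed.

Let toC_T p : toC (T p) = toC (omega p) *m (toC (N p))^T.
Proof. by rewrite -(omega_N act Hmu) toC_M; congr (_ *m _); apply/matrixP => i j; rewrite !mxE. Qed.

Lemma complexify_DRP p (x : 'rV[R[i]]_d) : complexify (DR mu p) x <-> x *m toC (T p) = 0.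
Proof.
have Z0 (f : R[i] -> R) : f 0 = 0 -> map_mx f (0 : 'rV[R[i]]_n) = 0.
  by move=> f0; apply/matrixP => i j; rewrite !mxE f0.
split=> [/complexifyP[x1 x2]|E].
  by apply: ReIm_inj; rewrite ?ReM_mulr ?ImM_mulr [RHS]Z0.
apply/complexifyP; split; rewrite /DR /=.
  by rewrite -ReM_mulr E; exact: Z0.
by rewrite -ImM_mulr E; exact: Z0.
Qed.

Lemma complexify_IRP p (y : 'rV[R[i]]_d) :
  complexify (IR rho p) y <-> exists k, y = k *m toC (N p).
Proof.
split=> [/complexifyP[/(IRP act)[a aE] /(IRP act)[b bE]]|[k ->]].
  exists (toC a + 'i%C *: toC b).
  by rewrite [y]ReIm aE bE !toC_M mulmxDl -scalemxAl.
apply/complexifyP; rewrite ReM_mulr ImM_mulr.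
by split; apply/(IRP act); [exists (ReM k)|exists (ImM k)].
Qed.

(** T^{0,1} is isotropic because invariance under J multiplies the pairing by (-i)^2 = -1; ker (d
    mu) is orthogonal to the orbit directions, which it contains. *)
Lemma Pmix_isotropic p v u : Pmix J rho mu p v -> Pmix J rho mu p u ->
  v *m toC (omega p) *m u^T = 0.
Proof.
have DC (x : 'rV[R[i]]_d) : complexify (DR mu p) x -> x *m toC (T p) = 0.
  by move/complexify_DRP.
have IC (y : 'rV[R[i]]_d) : complexify (IR rho p) y -> exists k, y = k *m toC (N p).
  by move/complexify_IRP.
have DI x y : x *m toC (T p) = 0 -> complexify (IR rho p) y -> x *m toC (omega p) *m y^T = 0.
  by move=> xT /IC[k ->]; rewrite trmx_mul mulmxA -(mulmxA x) -toC_T xT mul0mx.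
have omT : (toC (omega p))^T = - toC (omega p).
  by rewrite -toC_N -(omega_skew HK); apply/matrixP => i j; rewrite !mxE.
have swap (x y : 'rV[R[i]]_d) : y *m toC (omega p) *m x^T = - (x *m toC (omega p) *m y^T)^T.
  by rewrite !trmx_mul trmxK omT mulNmx mulmxN opprK mulmxA.
have PP x y : PJ J p x -> PJ J p y -> x *m toC (omega p) *m y^T = 0.
  rewrite /PJ /= => xJ yJ; set s := LHS.
  have : s = - s.
    rewrite {1}/s -(J_omega HK p) !toC_M !mulmxA xJ.
    have -> : toC (J p)^T = (toC (J p))^T by apply/matrixP => i j; rewrite !mxE.
    have trZ (z : R[i]) (A : 'rV[R[i]]_d) : (z *: A)^T = z *: A^T by apply/matrixP => i j; rewrite !mxE.
    rewrite -(mulmxA _ (toC (J p))^T) -trmx_mul yJ trZ -!scalemxAl -scalemxAr scalerA mulrNN.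
    have -> : 'i%C * 'i%C = -1 :> R[i] by rewrite -expr2 sqr_i.
    by rewrite scaleN1r.
  move=> /eqP; rewrite -addr_eq0 -mulr2n -scaler_nat scaler_eq0 pnatr_eq0 /= => /eqP.
  by [].
move=> [x [xJ xD] [y yI <-]] [x' [x'J x'D] [y' y'I <-]].
have yT z : complexify (IR rho p) z -> z *m toC (T p) = 0.
  by move=> /IC[k ->]; rewrite -mulmxA -toC_M (N_dmu act Hmu) [toC 0]map_mx0 mulmx0.
have -> : (x' + y')^T = x'^T + y'^T by apply/matrixP => i j; rewrite !mxE.
rewrite !mulmxDl !mulmxDr (PP _ _ xJ x'J) (DI _ _ _ (DC _ xD) y'I) (DI _ _ _ (yT _ yI) y'I).
by rewrite (swap x' y) (DI _ _ _ (DC _ x'D) yI) trmx0 oppr0 !addr0.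
Qed.

(** The orthogonal of [N] and [N J] for g is cut out by [z T = 0] and [z J T = 0], so the part [z]
    of [y] left by the orthogonal projection satisfies g(z, z) = 0. *)
Lemma g_ortho_span p (y : 'rV[R]_d) : regular_points rho p ->
  (forall z : 'rV[R]_d, z *m T p = 0 -> z *m J p *m T p = 0 ->
     y *m omega p *m (J p)^T *m z^T = 0) ->
  exists a b : 'rV[R]_n, y = a *m N p + b *m N p *m J p.
Proof.
move=> /gram_unit gu H.
(* These coefficients solve the two equations that put [z] in the kernels of [T] and [J T]. *)
pose b := y *m T p *m invmx (gram p).
pose a := y *m J p *m T p *m invmx (gram p).
pose z := y - (a *m N p + b *m N p *m J p).
have gE (x : 'rV[R]_n) : x *m N p *m J p *m T p = x *m gram p by rewrite /gram !mulmxA.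
have zT : z *m T p = 0.
  by rewrite /z mulmxBl mulmxDl NT add0r gE /b mulmxKV // subrr.
have zJT : z *m J p *m T p = 0.
  by rewrite /z !mulmxBl !mulmxDl JJ' mulNmx NT oppr0 addr0 gE /a mulmxKV // subrr.
have Nz : N p *m omega p *m z^T = 0.
  rewrite -[LHS]trmxK -[X in _ = X]trmxK; congr (_^T).
  by rewrite (tr_form (omega_skew HK p)) -mulmxA (omega_N act Hmu) zT oppr0 trmx0.
have NJz : N p *m omega p *m (J p)^T *m z^T = 0.
  rewrite -mulmxA -trmx_mul -[LHS]trmxK -[X in _ = X]trmxK; congr (_^T).
  by rewrite (tr_form (omega_skew HK p)) -mulmxA (omega_N act Hmu) zJT oppr0 trmx0.
exists a, b; apply/eqP; rewrite -subr_eq0; apply/eqP; rewrite -/z.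
apply: (g_eq0 (@g_pos _ _ _ _ _ HK p)); rewrite mulmxA {1}/z !mulmxBl (H z zT zJT) sub0r !mulmxDl.
have -> : a *m N p *m omega p *m (J p)^T *m z^T = a *m (N p *m omega p *m (J p)^T *m z^T).
  by rewrite !mulmxA.
have -> : b *m N p *m J p *m omega p *m (J p)^T *m z^T =
    b *m (N p *m (J p *m omega p *m (J p)^T) *m z^T) by rewrite !mulmxA.
by rewrite (J_omega HK) Nz NJz !mulmx0 addr0 oppr0.
Qed.

(** For maximality, testing [v] against orbit vectors gives the d mu conditions, and testing it
    against the (0,1)-vectors of ker (d mu) makes [Re v + (Im v) J] orthogonal for g to the
    complement of the span of [N] and [N J]. *)
Lemma Pmix_lagrangian p : regular_points rho p -> lagrangian (omega p) (Pmix J rho mu p).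
Proof.
move=> reg; apply/seteqP; split=> v /=.
  by move=> Pv u Pu; exact: Pmix_isotropic.
move=> H; apply/(PmixP HK act Hmu).
have conj1 x y (u : 'rV[R]_d) (z : 'rV[R]_d) : v *m toC (omega p) *m (toC u + 'i%C *: toC z)^T = 0 ->
  x = ReM v -> y = ImM v ->
  x *m omega p *m u^T - y *m omega p *m z^T = 0 /\ x *m omega p *m z^T + y *m omega p *m u^T = 0.
  move=> E -> ->.
  have trE : (toC u + 'i%C *: toC z)^T = toC u^T + 'i%C *: toC z^T by apply/matrixP => i j; rewrite !mxE.
  rewrite trE in E.
  have := congr1 (@ReM R 1 1) E; have := congr1 (@ImM R 1 1) E.
  rewrite ReM_mul ImM_mul !ReM_mulr !ImM_mulr !ReM_D !ImM_D !ReM_i !ImM_i !ReM_toC !ImM_toC.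
  rewrite oppr0 addr0 add0r => i0 r0; split.
    by rewrite r0; apply/matrixP => i j; rewrite !mxE.
  by rewrite i0; apply/matrixP => i j; rewrite !mxE.
have PI (a : 'rV[R]_n) : Pmix J rho mu p (toC (a *m N p) + 'i%C *: toC 0).
  apply/(PmixP HK act Hmu); rewrite !ReM_D !ImM_D !ReM_i !ImM_i !ReM_toC !ImM_toC oppr0 addr0 add0r.
  by rewrite NT !mul0mx; split=> //; exists a, 0; rewrite !mul0mx.
have vN (a : 'rV[R]_n) : ReM v *m T p *m a^T = 0 /\ ImM v *m T p *m a^T = 0.
  have [] := conj1 _ _ _ _ (H _ (PI a)) erefl erefl.
  rewrite trmx0 !mulmx0 subr0 add0r (trmx_mul a) !mulmxA => r i.
  by rewrite -(omega_N act Hmu) !mulmxA.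
have vT (x : 'rV[R]_n) : (forall a : 'rV[R]_n, x *m a^T = 0) -> x = 0.
  move=> E; apply/rowP => i; have := E (delta_mx 0 i).
  by rewrite trmx_delta -colE => /matrixP/(_ 0 0); rewrite !mxE.
split; [by apply: vT => a; case: (vN a)|by apply: vT => a; case: (vN a)|].
apply: g_ortho_span => // z zT zJT.
(* The vector with imaginary part [z] and real part [- z J] is of type (0,1), and both parts are
   killed by d mu. *)
have Pz : Pmix J rho mu p (toC (- (z *m J p)) + 'i%C *: toC z).
  apply/(PmixP HK act Hmu); rewrite !ReM_D !ImM_D !ReM_i !ImM_i !ReM_toC !ImM_toC oppr0 addr0 add0r.
  by rewrite mulNmx zT zJT oppr0 addNr; split=> //; exists 0, 0; rewrite !mul0mx addr0.
have [E _] := conj1 _ _ _ _ (H _ Pz) erefl erefl.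
rewrite !mulmxDl -(mulmxA (ImM v) (J p)) -(mulmxA (ImM v) _ (J p)^T) (J_omega HK).
move/eqP: E; rewrite linearN /= mulmxN -opprD oppr_eq0 trmx_mul mulmxA => /eqP; apply.
Qed.

End Pointwise.

(** * Smooth complex matrices *)

Section ComplexSmooth.
Variables (R : realType) (d : nat) (M : manifold R d).
Implicit Types (U V : set M).

Definition csmooth a b U (F : M -> 'M[R[i]]_(a, b)) :=
  smoothF U (fun q => ReM (F q)) /\ smoothF U (fun q => ImM (F q)).

Lemma csmooth_toC a b U (F : M -> 'M[R]_(a, b)) : open U -> smoothF U F ->
  csmooth U (fun q => toC (F q)).
Proof.
move=> oU sF; split.
  by apply: (smoothF_eq oU _ sF) => q _; rewrite ReM_toC.
by apply: (smoothF_eq oU _ (smoothF_cst U 0)) => q _; rewrite ImM_toC.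
Qed.

Lemma csmooth_cst a b U (A : 'M[R[i]]_(a, b)) : csmooth U (fun=> A).
Proof. by split; exact: smoothF_cst. Qed.

Lemma csmooth_add a b U (F G : M -> 'M[R[i]]_(a, b)) : open U -> csmooth U F -> csmooth U G ->
  csmooth U (fun q => F q + G q).
Proof.
move=> oU [F1 F2] [G1 G2]; split.
  by apply: (smoothF_eq oU _ (smoothF_add oU F1 G1)) => q _; rewrite ReM_D.
by apply: (smoothF_eq oU _ (smoothF_add oU F2 G2)) => q _; rewrite ImM_D.
Qed.

Lemma csmooth_opp a b U (F : M -> 'M[R[i]]_(a, b)) : open U -> csmooth U F ->
  csmooth U (fun q => - F q).
Proof.
move=> oU [F1 F2]; split.
  by apply: (smoothF_eq oU _ (smoothF_opp oU F1)) => q _; rewrite ReM_N.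
by apply: (smoothF_eq oU _ (smoothF_opp oU F2)) => q _; rewrite ImM_N.
Qed.

Lemma csmooth_scale a b U x (F : M -> 'M[R[i]]_(a, b)) : open U -> csmooth U F ->
  csmooth U (fun q => x *: F q).
Proof.
move=> oU [F1 F2]; split.
  have := smoothF_sub_mx oU (smoothF_scale (complex.Re x) oU F1) (smoothF_scale (complex.Im x) oU F2).
  by apply: smoothF_eq => // q _; rewrite ReM_Z.
have := smoothF_add oU (smoothF_scale (complex.Re x) oU F2) (smoothF_scale (complex.Im x) oU F1).
by apply: smoothF_eq => // q _; rewrite ImM_Z.
Qed.

Lemma csmooth_mul a b e U (F : M -> 'M[R[i]]_(a, b)) (G : M -> 'M[R[i]]_(b, e)) : open U ->
  csmooth U F -> csmooth U G -> csmooth U (fun q => F q *m G q).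
Proof.
move=> oU [F1 F2] [G1 G2]; split.
  apply: (smoothF_eq oU _ (smoothF_sub_mx oU (smoothF_mulmx oU F1 G1) (smoothF_mulmx oU F2 G2))).
  by move=> q _; rewrite ReM_mul.
apply: (smoothF_eq oU _ (smoothF_add oU (smoothF_mulmx oU F1 G2) (smoothF_mulmx oU F2 G1))).
by move=> q _; rewrite ImM_mul.
Qed.

Lemma open_unitmx k U (F : M -> 'M[R]_k) : open U -> smoothF U F ->
  open (U `&` [set q | F q \in unitmx]).
Proof.
move=> oU sF; rewrite openE => q [Uq uq]; apply: filterI.
  exact: (open_nbhs_nbhs (conj oU Uq)).
have cF := smoothF_continuous oU Uq sF.
have oT : open [set: 'M[R]_k] by exact: openT.
have cd : {for F q, continuous (fun A : 'M[R]_k => \det A)}.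
  exact: (Ck_continuous (Ck_det oT (Ck_id 0 setT))).
have cc := continuous_comp cF cd.
have d0 : \det (F q) != 0 by rewrite -unitfE -unitmxE.
have H : nbhs q (fun r : M => \det (F r) != 0) by exact: (cvgr_neq0 _ cc d0).
apply: filterS H => r /= r0.
by rewrite unitmxE unitfE.
Qed.

(** Right multiplication by [X] on pairs (real part, imaginary part); it reduces invertibility to a
    real smooth matrix. *)
Definition realblock k (X : 'M[R[i]]_k) : 'M[R]_(k + k) :=
  block_mx (ReM X) (ImM X) (- ImM X) (ReM X).

Lemma realblock_unit k (X : 'M[R[i]]_k) : realblock X \in unitmx -> X \in unitmx.
Proof.
move=> uX; rewrite -row_free_unit -kermx_eq0; apply/eqP/row_matrixP => i; rewrite row0.
set r := row i _; have : r *m X = 0 by apply/sub_kermxP; exact: row_sub.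
have Z0 (f : R[i] -> R) : f 0 = 0 -> map_mx f (0 : 'rV[R[i]]_k) = 0.
  by move=> f0; apply/matrixP => i' j; rewrite !mxE f0.
move=> E; have E1 := congr1 (@ReM R 1 k) E; have E2 := congr1 (@ImM R 1 k) E.
rewrite ReM_mul [RHS]Z0 // in E1; rewrite ImM_mul [RHS]Z0 // in E2.
have : row_mx (ReM r) (ImM r) *m realblock X = 0.
  by rewrite mul_row_block mulmxN E1 E2 row_mx0.
move=> /(congr1 (mulmx^~ (invmx (realblock X)))); rewrite mulmxK // mul0mx.
rewrite -row_mx0 => /eq_row_mx[r1 r2].
by apply: ReIm_inj; rewrite ?r1 ?r2 [RHS]Z0.
Qed.

Lemma smoothF_block a b e f U (A : M -> 'M[R]_(a, b)) (B : M -> 'M[R]_(a, e))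
   (C : M -> 'M[R]_(f, b)) (D : M -> 'M[R]_(f, e)) : open U ->
   smoothF U A -> smoothF U B -> smoothF U C -> smoothF U D ->
   smoothF U (fun q => block_mx (A q) (B q) (C q) (D q)).
Proof.
move=> oU sA sB sC sD c sc k; have o := open_chart_image (c:=c) oU.
apply: Ck_mx => // i j.
case: (splitP i) => i' iE; case: (splitP j) => j' jE.
- apply: (Ck_eq o _ (Ck_entry i' j' o (sA c sc k))) => y _.
  have -> : i = lshift _ i' by exact: val_inj. have -> : j = lshift _ j' by exact: val_inj.
  by rewrite /= block_mxEul.
- apply: (Ck_eq o _ (Ck_entry i' j' o (sB c sc k))) => y _.
  have -> : i = lshift _ i' by exact: val_inj. have -> : j = rshift _ j' by exact: val_inj.
  by rewrite /= block_mxEur.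
- apply: (Ck_eq o _ (Ck_entry i' j' o (sC c sc k))) => y _.
  have -> : i = rshift _ i' by exact: val_inj. have -> : j = lshift _ j' by exact: val_inj.
  by rewrite /= block_mxEdl.
- apply: (Ck_eq o _ (Ck_entry i' j' o (sD c sc k))) => y _.
  have -> : i = rshift _ i' by exact: val_inj. have -> : j = rshift _ j' by exact: val_inj.
  by rewrite /= block_mxEdr.
Qed.

End ComplexSmooth.

(** * The explicit projector onto a fibre *)

Section Projector.
Variables (R : realType) (d n : nat).
Implicit Types (N : 'M[R]_(n, d)) (J : 'M[R]_d) (T : 'M[R]_(d, n)).

(** The projector onto the (-i)-eigenspace of [J] along the i-eigenspace. *)
Definition pi01 J : 'M[R[i]]_d := 2^-1 *: (1%:M + 'i%C *: toC J).

(** The factor J + i kills T^{0,1}; on [k N] only [k N J T] survives since [N T = 0], and the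
    inverse recovers [k]. *)
Definition icoef N J T : 'M[R[i]]_(d, n) :=
  (toC J + 'i%C *: 1%:M) *m toC T *m toC (invmx (N *m J *m T)).

(* Projector onto (P_J /\ D_C) + I_C: v *m icoef is the coefficient vector of
   the I_C-component, and the last factor removes the d mu-part of the
   remaining (0,1)-vector along the (0,1)-parts of the fundamental fields. *)
Definition projP N J T : 'M[R[i]]_d :=
  icoef N J T *m toC N + (1%:M - icoef N J T *m toC N) *m pi01 J *m
    (1%:M + (2 * 'i%C) *: (toC T *m toC (invmx (N *m J *m T)) *m toC N *m pi01 J)).

(** The projector is natural under changes of frame, so its matrix in a chart is built from the
    smooth chart expressions of [N], J and d mu. *)
Lemma projP_conj N J T (t t' : 'M[R]_d) : t *m t' = 1%:M -> t' *m t = 1%:M ->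
  projP (N *m t) (t' *m J *m t) (t' *m T) = toC t' *m projP N J T *m toC t.
Proof.
move=> tt' t't.
have SE : N *m t *m (t' *m J *m t) *m (t' *m T) = N *m J *m T.
  have -> : N *m t *m (t' *m J *m t) *m (t' *m T) = N *m (t *m t') *m J *m (t *m t') *m T.
    by rewrite !mulmxA.
  by rewrite tt' !mulmx1.
have one : toC (1%:M : 'M[R]_d) = 1%:M by exact: map_mx1.
have ttC : toC t *m toC t' = 1%:M by rewrite -toC_M tt'.
have ttC' : toC t' *m toC t = 1%:M by rewrite -toC_M t't.
pose f (X : 'M[R[i]]_d) := toC t' *m X *m toC t.
have fM X Y : f X *m f Y = f (X *m Y).
  by rewrite /f !mulmxA -(mulmxA _ (toC t)) ttC mulmx1.
have fD X Y : f X + f Y = f (X + Y) by rewrite /f mulmxDr mulmxDl.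
have fN X : - f X = f (- X) by rewrite /f mulmxN mulNmx.
have fZ x X : x *: f X = f (x *: X) by rewrite /f -scalemxAr -scalemxAl.
have f1 : 1%:M = f 1%:M by rewrite /f mulmx1 ttC'.
have fJ : toC (t' *m J *m t) = f (toC J) by rewrite !toC_M.
have pE : pi01 (t' *m J *m t) = f (pi01 J).
  by rewrite /pi01 fJ {1}f1 fZ fD fZ.
have cE : icoef (N *m t) (t' *m J *m t) (t' *m T) = toC t' *m icoef N J T.
  rewrite /icoef SE fJ {1}f1 fZ fD /f (toC_M t' T); move: (toC J + _) (toC (invmx _)) => X S.
  by rewrite !mulmxA -(mulmxA (_ *m X)) ttC mulmx1.
have cNE : icoef (N *m t) (t' *m J *m t) (t' *m T) *m toC (N *m t) = f (icoef N J T *m toC N).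
  by rewrite cE toC_M /f !mulmxA.
have TNE : toC (t' *m T) *m toC (invmx (N *m J *m T)) *m toC (N *m t) =
    f (toC T *m toC (invmx (N *m J *m T)) *m toC N).
  by rewrite !toC_M /f !mulmxA.
by rewrite /projP SE cNE TNE pE {1 2}f1 fM fZ fN !fD !fM fD.
Qed.

Section Fixed.
Variables (N : 'M[R]_(n, d)) (J : 'M[R]_d) (T : 'M[R]_(d, n)).
Hypotheses (JJ : J *m J = - 1%:M) (NT : N *m T = 0) (uS : N *m J *m T \in unitmx).

Let toC0 a b : toC (0 : 'M[R]_(a, b)) = 0. Proof. exact: map_mx0. Qed.
Let toC1 a : toC (1%:M : 'M[R]_a) = 1%:M. Proof. exact: map_mx1. Qed.
Let ii : 'i%C * 'i%C = -1 :> R[i]. Proof. by rewrite -expr2 sqr_i. Qed.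

Lemma projP_id (x : 'rV[R[i]]_d) (k : 'rV[R[i]]_n) :
  x *m toC J = - 'i%C *: x -> x *m toC T = 0 ->
  (x + k *m toC N) *m projP N J T = x + k *m toC N.
Proof.
move=> xJ xT.
have xC : x *m icoef N J T = 0.
  by rewrite /icoef !mulmxA mulmxDr xJ -scalemxAr mulmx1 scaleNr addNr !mul0mx.
have kC : k *m toC N *m icoef N J T = k.
  rewrite /icoef !mulmxA mulmxDr mulmxDl -scalemxAr mulmx1 -scalemxAl.
  rewrite -!(mulmxA k) -!toC_M NT toC0 mulmx0 scaler0 addr0 -mulmxA -toC_M mulmxV //.
  by rewrite toC1 mulmx1.
have xp : x *m pi01 J = x.
  rewrite /pi01 -scalemxAr mulmxDr mulmx1 -scalemxAr xJ scalerA mulrN ii opprK scale1r.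
  by rewrite -mulr2n -(scaler_nat 2 x) scalerA mulVf ?scale1r // pnatr_eq0.
have vC : (x + k *m toC N) *m (icoef N J T *m toC N) = k *m toC N.
  by rewrite mulmxA mulmxDl xC kC add0r.
rewrite /projP mulmxDr vC !mulmxA mulmxBr mulmx1 vC addrK xp mulmxDr mulmx1 -scalemxAr.
by rewrite !mulmxA xT !mul0mx scaler0 addr0 addrC.
Qed.

Lemma projP_in (v : 'rV[R[i]]_d) : exists (x : 'rV[R[i]]_d) (k : 'rV[R[i]]_n),
  [/\ x *m toC J = - 'i%C *: x, x *m toC T = 0 & v *m projP N J T = x + k *m toC N].
Proof.
pose u := v *m (1%:M - icoef N J T *m toC N) *m pi01 J.
pose x := u + (2 * 'i%C) *: (u *m (toC T *m toC (invmx (N *m J *m T)) *m toC N) *m pi01 J).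
exists x, (v *m icoef N J T).
have pJ a (w : 'M[R[i]]_(a, d)) : w *m pi01 J *m toC J = - 'i%C *: (w *m pi01 J).
  rewrite -mulmxA scalemxAr; congr (_ *m _).
  rewrite /pi01 -scalemxAl mulmxDl mul1mx -scalemxAl -toC_M JJ toC_N toC1.
  rewrite scalerA mulrC -scalerA; congr (_ *: _).
  rewrite (scalerDr (- 'i%C)) (scalerA (- 'i%C)) mulNr ii opprK scale1r addrC.
  by rewrite scalerN scaleNr.
(* The (0,1)-parts of the fundamental fields pair with d mu to (i/2) [N J T]; the constant 2i in
   [projP] turns this into -1 after inversion. *)
have NpT : toC N *m pi01 J *m toC T = (2^-1 * 'i%C) *: toC (N *m J *m T).
  rewrite /pi01 -scalemxAr -scalemxAl -scalerA mulmxDr mulmxDl mulmx1 -toC_M NT toC0 add0r.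
  by rewrite -scalemxAr -scalemxAl -!toC_M.
have key (w : 'rV[R[i]]_d) :
    (w + (2 * 'i%C) *: (w *m (toC T *m toC (invmx (N *m J *m T)) *m toC N) *m pi01 J)) *m toC T = 0.
  move: NpT uS; set S := N *m J *m T; move: S (pi01 J) => S q qE uS'.
  rewrite mulmxDl -scalemxAl -!mulmxA (mulmxA (toC N)) qE -!scalemxAr -(toC_M (invmx S)).
  rewrite mulVmx // toC1 mulmx1 scalerA mulrACA divff ?pnatr_eq0 // mul1r ii scaleN1r.
  by rewrite subrr.
split; [by rewrite /x mulmxDl -scalemxAl !pJ scalerDr !scalerA (mulrC (- _))|exact: key|].
rewrite /projP mulmxDr (mulmxA v (icoef _ _ _)) addrC; congr (_ + _).
by rewrite (mulmxA v) (mulmxA v) -/u mulmxDr mulmx1 -scalemxAr /x -(mulmxA u _ (pi01 J)).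
Qed.

End Fixed.
End Projector.

(** The row space of [A] is the kernel of [toC w *m A^T], whose rank is that of [A] as [w] is
    invertible; then rank-nullity. *)
Lemma lagrangian_rank (R : realType) (d a : nat) (w : 'M[R]_d) (A : 'M[R[i]]_(a, d)) :
  w \in unitmx -> lagrangian w [set v | (v <= A)%MS] -> (\rank A + \rank A = d)%N.
Proof.
move=> uw L; pose K := kermx (toC w *m A^T).
have AK : (A :=: K)%MS.
  apply/eqmxP/andP; split; apply/row_subP => i.
    have : [set v | (v <= A)%MS] (row i A) by exact: row_sub.
    rewrite L /= => H; apply/sub_kermxP; apply/trmx_inj/row_matrixP => j.
    rewrite mulmxA trmx_mul trmxK row_mul trmx0 row0.
    have := H (row j A) (row_sub j A); move=> /(congr1 trmx); rewrite trmx_mul trmxK trmx0.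
    by [].
  have : [set v | (v <= A)%MS] (row i K); last by [].
  rewrite L /= => u /submxP[D ->].
  have : row i K *m (toC w *m A^T) = 0 by apply/sub_kermxP; exact: row_sub.
  by rewrite trmx_mul !mulmxA => ->; rewrite mul0mx.
have uC : row_full (toC w) by rewrite row_full_unit map_unitmx.
have := mxrank_ker (toC w *m A^T); rewrite -/K -AK => r.
have rk : \rank (toC w *m A^T) = \rank A by rewrite (eqmxMfull _ uC) mxrank_tr.
have le := rank_leq_row (toC w *m A^T).
by rewrite {1}r rk subnK // -rk.
Qed.

(** * Local frames of the mixed polarization *)

Section Frame.
Variables (R : realType) (m n : nat) (M : manifold R (m + m)).
Variables (omega J : M -> 'M[R]_(m + m)) (rho : 'rV[R]_n -> M -> M) (mu : M -> 'rV[R]_n).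
Hypothesis HK : kahler omega J.
Hypothesis act : torus_action rho.
Hypothesis Hmu : moment_map omega rho mu.
Implicit Types (c : chart R (m + m) M) (p q : M).

Let d := (m + m)%N.
Local Notation N := (Nf rho).
Local Notation T p := (diff_at mu p).
Local Notation P := (Pmix J rho mu).
Local Notation reg := (regular_points rho).

Definition proj_mix p := projP (N p) (J p) (T p).

Lemma Pmix_proj p : reg p -> P p = [set v | (v <= proj_mix p)%MS].
Proof.
move=> /(gram_unit HK act Hmu) gu; apply/seteqP; split=> v /=.
  move=> [x [xJ /complexify_DRP xT] [_ /(complexify_IRP act)[k ->] <-]].
  apply/submxP; exists (x + k *m toC (N p)).
  by rewrite projP_id // (N_dmu act Hmu).
move=> /submxP[u ->].
have [x [k [xJ xT ->]]] := projP_in (J_sq HK p) (N_dmu act Hmu p) gu u.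
exists x; first by split=> //; apply/complexify_DRP.
by exists (k *m toC (N p)) => //; apply/(complexify_IRP act); exists k.
Qed.

Lemma proj_mix_id p (v : 'rV[R[i]]_d) : reg p -> (v <= proj_mix p)%MS -> v *m proj_mix p = v.
Proof.
move=> rp; have : [set v | (v <= proj_mix p)%MS] v = ((v <= proj_mix p)%MS : Prop) by [].
rewrite -(Pmix_proj rp) => <-; move: rp => /(gram_unit HK act Hmu) gu.
move=> [x [xJ /complexify_DRP xT] [_ /(complexify_IRP act)[k ->] <-]].
by rewrite projP_id // (N_dmu act Hmu).
Qed.

Lemma rank_proj_mix p : reg p -> (\rank (proj_mix p) + \rank (proj_mix p) = d)%N.
Proof.
move=> rp; apply: (lagrangian_rank (w := omega p)).
  exact: (symplectic_nondegenerate (kahler_symplectic HK)).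
rewrite -Pmix_proj //; exact: Pmix_lagrangian.
Qed.

Section Chart.
Variable b : chart R (m + m) M.
Hypothesis sb : smooth_chart b.
Local Notation t q := (tr (chart_at q) b q).
Local Notation t' q := (tr b (chart_at q) q).

Definition JF q := t' q *m J q *m t q.
Definition projF q := projP (coord b N q) (JF q) (chart_diff mu b q).
Definition gramF q := coord b N q *m JF q *m chart_diff mu b q.

Let tt' q : cdom b q -> t q *m t' q = 1%:M.
Proof. by move=> bq; apply: trK => //; [exact: smooth_chart_at|exact: mem_chart_at]. Qed.

Let t't q : cdom b q -> t' q *m t q = 1%:M.
Proof. by move=> bq; apply: trK => //; [exact: smooth_chart_at|exact: mem_chart_at]. Qed.

Lemma chart_diff_mu q : cdom b q -> chart_diff mu b q = t' q *m T q.
Proof.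
move=> bq; rewrite diff_atE; apply: (chart_diffE openT _ (smoothF_mu Hmu)) => //.
  exact: smooth_chart_at.
exact: mem_chart_at.
Qed.

Lemma gramFE q : cdom b q -> gramF q = gram J rho mu q.
Proof.
move=> bq; rewrite /gramF chart_diff_mu // /coord /JF /gram.
have -> : N q *m t q *m (t' q *m J q *m t q) *m (t' q *m T q) =
  N q *m (t q *m t' q) *m J q *m (t q *m t' q) *m T q by rewrite !mulmxA.
by rewrite tt' // !mulmx1.
Qed.

Lemma projFE q : cdom b q -> projF q = toC (t' q) *m proj_mix q *m toC (t q).
Proof. by move=> bq; rewrite /projF chart_diff_mu // projP_conj ?tt' ?t't. Qed.

Lemma smoothF_N : smoothF (cdom b) (coord b N).
Proof. by apply: smoothF_sub (rsmooth_Nf act sb) => q. Qed.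

Lemma smoothF_dmu : smoothF (cdom b) (chart_diff mu b).
Proof. by apply: smoothF_sub (smoothF_chart_diff openT sb (smoothF_mu Hmu)) => q. Qed.

End Chart.

Lemma smoothF_JF p : smoothF (cdom (chart_at p)) (JF (chart_at p)).
Proof.
apply: smoothF_local => q bq; exists (chart_at p), (cdom (chart_at p)).
split=> //; [exact: smooth_chart_at|exact: cdom_open|].
rewrite setIid => k; apply: Ck_eq (complex_smooth (kahler_complex HK) p k); first exact: cimage_open.
by move=> x _; rewrite /endo_in_chart coord_frameE diff_at_chart.
Qed.

Lemma smoothF_gramF p : smoothF (cdom (chart_at p)) (gramF (chart_at p)).
Proof.
have o := cdom_open (chart_at p); have sb := @smooth_chart_at _ _ M p.
have sJ := @smoothF_JF p.
exact: (smoothF_mulmx o (smoothF_mulmx o (smoothF_N sb) sJ) (smoothF_dmu sb)).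
Qed.

Definition chart_reg p := cdom (chart_at p) `&` [set q | gramF (chart_at p) q \in unitmx].

Lemma open_chart_reg p : open (chart_reg p).
Proof. by apply: open_unitmx; [exact: cdom_open|exact: smoothF_gramF]. Qed.

Lemma chart_regP p q : cdom (chart_at p) q -> chart_reg p q <-> reg q.
Proof.
move=> bq; have sb := @smooth_chart_at _ _ M p; rewrite /chart_reg /= gramFE //.
by split=> [[_ /(gram_unit HK act Hmu)]|/(gram_unit HK act Hmu)].
Qed.

Lemma csmooth_projF p : csmooth (chart_reg p) (projF (chart_at p)).
Proof.
have o := open_chart_reg p; have sb := @smooth_chart_at _ _ M p.
have sub : chart_reg p `<=` cdom (chart_at p) by move=> q [].
have sN : csmooth (chart_reg p) (fun q => toC (coord (chart_at p) N q)).
  by apply: csmooth_toC => //; exact: smoothF_sub sub (smoothF_N sb).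
have sJ : csmooth (chart_reg p) (fun q => toC (JF (chart_at p) q)).
  by apply: csmooth_toC => //; exact: smoothF_sub sub (@smoothF_JF p).
have sT : csmooth (chart_reg p) (fun q => toC (chart_diff mu (chart_at p) q)).
  by apply: csmooth_toC => //; exact: smoothF_sub sub (smoothF_dmu sb).
have sS : csmooth (chart_reg p) (fun q => toC (invmx (gramF (chart_at p) q))).
  apply: csmooth_toC => //; apply: smoothF_invmx => //; first by move=> q [].
  exact: smoothF_sub sub (@smoothF_gramF p).
have s1 : csmooth (chart_reg p) (fun=> 1%:M : 'M[R[i]]_d) by exact: csmooth_cst.
have spi := csmooth_scale 2^-1 o (csmooth_add o s1 (csmooth_scale 'i%C o sJ)).
have sC := csmooth_mul o (csmooth_mul o (csmooth_add o sJ (csmooth_scale 'i%C o s1)) sT) sS.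
have sCN := csmooth_mul o sC sN.
have sTSN := csmooth_mul o (csmooth_mul o (csmooth_mul o sT sS) sN) spi.
have s2 := csmooth_add o s1 (csmooth_scale (2 * 'i%C) o sTSN).
exact: (csmooth_add o sCN (csmooth_mul o (csmooth_mul o (csmooth_add o s1 (csmooth_opp o sCN)) spi) s2)).
Qed.

Section Basis.
Variables (p : M) (k : nat) (B : 'M[R[i]]_(k, d)).
Let b := chart_at p.
Let sb : smooth_chart b. Proof. exact: smooth_chart_at. Qed.

(** Vectors with constant components [B] in the chart, projected onto the fibre at [q]; for [B] a
    basis of the fibre at [p] they remain independent nearby. *)
Definition frame_mix q := B *m toC (tr b (chart_at q) q) *m proj_mix q.

Lemma coord_frame_mix q : cdom b q -> frame_mix q *m toC (tr (chart_at q) b q) = B *m projF b q.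
Proof. by move=> bq; rewrite projFE // /frame_mix !mulmxA. Qed.

Lemma smooth_frame_mix U i : open U -> U `<=` chart_reg p ->
  smooth_field U (fun q => row i (frame_mix q)).
Proof.
move=> oU sub; have sP := csmooth_projF p.
have [s1 s2] : csmooth U (fun q => row i B *m projF b q).
  apply: csmooth_mul => //; first exact: csmooth_cst.
  by case: sP => *; split; apply: (smoothF_sub sub).
have E q : U q -> row i B *m projF b q = row i (frame_mix q) *m toC (tr (chart_at q) b q).
  by move=> /sub[bq _]; rewrite -row_mul coord_frame_mix // row_mul.
apply/smooth_fieldP => //; split; apply: rsmooth_local => q Uq; exists b, U; split=> //.
- by case: (sub _ Uq).
- by apply: (smoothF_eq oU _ s1) => r Ur; rewrite E // ReM_mulr.
- by case: (sub _ Uq).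
- by apply: (smoothF_eq oU _ s2) => r Ur; rewrite E // ImM_mulr.
Qed.

End Basis.

Lemma Pmix_smooth : smooth_subbundle_on reg P.
Proof.
move=> p rp; pose k := \rank (proj_mix p); pose B : 'M[R[i]]_(k, d) := row_base (proj_mix p).
have kd : (k + k = d)%N by exact: rank_proj_mix.
have bp := mem_chart_at p; set b := chart_at p in bp.
have Bfree : row_free B by exact: row_base_free.
(* [pinvmx B] is a right inverse of [B], so [G] is the identity at [p]; wherever [G] is invertible
   the projected frame is independent. *)
pose G q := realblock (B *m projF b q *m pinvmx B).
pose U := chart_reg p `&` [set q | G q \in unitmx].
have o := open_chart_reg p.
have oU : open U.
  apply: open_unitmx => //.
  have [s1 s2] : csmooth (chart_reg p) (fun q => B *m projF b q *m pinvmx B).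
    apply: csmooth_mul => //; last exact: csmooth_cst.
    by apply: csmooth_mul => //; [exact: csmooth_cst|exact: csmooth_projF].
  by apply: smoothF_block => //; exact: smoothF_opp.
have Breg q : U q -> reg q by move=> [Vq _]; apply/(chart_regP (p:=p)) => //; case: Vq.
exists U, k, (fun i q => row i (frame_mix p B q)); split.
- exact: oU.
- split; first exact/chart_regP.
  rewrite /= /G (projFE (@smooth_chart_at _ _ M p) bp) tr_id //.
  have -> : toC (1%:M : 'M[R]_d) = 1%:M by exact: map_mx1.
  rewrite mul1mx mulmx1.
  have -> : B *m proj_mix p = B.
    apply/row_matrixP => i; rewrite row_mul proj_mix_id //.
    by rewrite -(eq_row_base (proj_mix p)); exact: row_sub.
  rewrite mulmxVp //; have -> : realblock (1%:M : 'M[R[i]]_k) = 1%:M.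
    rewrite /realblock scalar_mx_block.
    have -> : ReM (1%:M : 'M[R[i]]_k) = 1%:M.
      by apply/matrixP => i j; rewrite !mxE; case: eqP.
    have -> : ImM (1%:M : 'M[R[i]]_k) = 0.
      by apply/matrixP => i j; rewrite !mxE; case: eqP.
    by rewrite oppr0.
  exact: unitmx1.
- by move=> q /Breg.
- by move=> i; apply: smooth_frame_mix => // q [].
move=> q Uq; have -> : \matrix_(i < k) row i (frame_mix p B q) = frame_mix p B q.
  by apply/row_matrixP => i; rewrite rowK.
have bq : cdom b q by case: Uq => [[]].
have free : row_free (frame_mix p B q).
  have := Uq.2; rewrite /= /G => /realblock_unit; rewrite -coord_frame_mix // -(mulmxA (frame_mix p B q)) => u.
  have := mxrankM_maxl (frame_mix p B q) (toC (tr (chart_at q) b q) *m pinvmx B).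
  by rewrite (mxrank_unit u) => h; rewrite /row_free eqn_leq rank_leq_row.
split=> //; rewrite Pmix_proj; last exact: Breg.
have le : (frame_mix p B q <= proj_mix q)%MS by exact: submxMl.
(* Both ranks are half the dimension because the fibres are Lagrangian, so the inclusion of the
   frame in the fibre is an equality. *)
have rk : \rank (proj_mix q) = k.
  have E := etrans (rank_proj_mix (Breg _ Uq)) (esym kd).
  have inj (x y : nat) : (x + x = y + y)%N -> x = y by rewrite !addnn => /double_inj.
  exact: inj E.
have : (frame_mix p B q == proj_mix q)%MS.
  by rewrite -(mxrank_leqif_eq le) (eqP free) rk.
by move=> /eqmxP E; apply/seteqP; split=> v /=; rewrite E.
Qed.

End Frame.

Theorem theorem1p1 (R : realType) (m n : nat) (M : manifold R (m + m))
    (omega J : M -> 'M[R]_(m + m)) (rho : 'rV[R]_n -> M -> M) (mu : M -> 'rV[R]_n)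
    (HK : kahler omega J)
    (Hact : torus_action rho) (Heff : effective rho)
    (Homega : forall x, preserves_form (rho x) omega)
    (HJ : forall x, preserves_endo (rho x) J)
    (Hiso : forall x, preserves_form (rho x) (metric omega J))
    (Hmu : moment_map omega rho mu) :
  [/\ forall p, (PJ J p `&` complexify (DR mu p)) `&` complexify (IR rho p) = [set 0],
      singular_polarization omega (regular_points rho) (Pmix J rho mu) &
      real_rank_on (regular_points rho) (Pmix J rho mu) n].
Proof.
have rk := real_rank_Pmix HK Hact Hmu.
split=> //; first exact: (Pmix_direct HK Hact Hmu).
split.
- exact: (Pmix_subspace HK Hact Hmu).
- exact: (Pmix_smooth HK Hact Hmu).
- exact: (Pmix_involutive HK Hact Homega HJ Hmu).
- by move=> p; exact: (Pmix_lagrangian HK Hact Hmu).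
by exists n.
Qed.
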